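(* Let $\boldsymbol\alpha\in\mathcal A^+$. For any $k\in\mathbb N$ and any local function $f:\{0,1\}^{\mathbb Z}\to\mathbb R$ (i.e. depending on finitely many coordinates), $$\int_{\Omega_*}d\mu_{\boldsymbol\alpha}\big(\eta\,\big|\,s_\infty(\eta,0)=0\big)\,f(\Psi_k(\eta))=\int_{\Omega_*}d\mu_{\theta^k\boldsymbol\alpha}\big(\eta\,\big|\,s_\infty(\eta,0)=0\big)\,f(\eta),$$ and $$\int_{\Omega_*}d\mu_{\boldsymbol\alpha}(\eta)\,f(\Psi_k(\eta))=\frac{\bar\varepsilon(\theta^k\boldsymbol\alpha)\,\bar\varepsilon(C_k\boldsymbol\alpha)}{\bar\varepsilon(\boldsymbol\alpha)}\int_{\Omega_*}d\mu_{\theta^k\boldsymbol\alpha}(\eta)\,f(\eta)$$ $$\qquad+\frac{\bar\varepsilon(\theta^k\boldsymbol\alpha)\big(\bar\varepsilon(\boldsymbol\alpha)-\bar\varepsilon(\theta^k\boldsymbol\alpha)\bar\varepsilon(C_k\boldsymbol\alpha)\big)}{\bar\varepsilon(\boldsymbol\alpha)\big(\bar\varepsilon(\theta^k\boldsymbol\alpha)-\bar\varepsilon(\theta^{k+1}\boldsymbol\alpha)\big)}\int_{\Omega_*}d\mu_{\theta^k\boldsymbol\alpha}(\eta)\,\big(\eta^\uparrow_1(1)+\eta^\downarrow_1(1)\big)f(\eta),$$ where the last term is read as $0$ if $\bar\varepsilon(\theta^k\boldsymbol\alpha)=\bar\varepsilon(\theta^{k+1}\boldsymbol\alpha)$.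
   Context: $\mathbb N=\{1,2,\dots\}$, $0^0=1$. **Configurations.** $\Omega=\{\eta\in\{0,1\}^{\mathbb Z}:\lim_{x\to\infty}\frac1x\sum_{y=-x}^{0}\eta(y)<\frac12\}$. A site $x$ is a record of $\eta$ if $\sum_{y=z}^{x}(2\eta(y)-1)<0$ for all $z\le x$. The notions below make sense for any $\eta\in\{0,1\}^{\mathbb Z}$ whose records are unbounded below (e.g. $\eta\in\Omega$). $(s_\infty(\eta,i))_{i\in\mathbb Z}$ enumerates the records increasingly, $s_\infty(\eta,0)$ being the largest record $\le0$ ($s_\infty(\eta,i)=\infty$ if there are too few records on the right). $\Omega_*=\{\eta\in\Omega:|s_\infty(\eta,i)|<\infty\ \forall i\in\mathbb Z\}$, $\Omega_r=\{\eta\in\Omega_*:s_\infty(\eta,0)=0\}$. **Seat numbers.** $(\mathcal W_k(\eta,\cdot))_{k\in\mathbb N}$, $\mathcal W_k(\eta,\cdot):\mathbb Z\to\{0,1\}$, are the unique functions vanishing at every record and satisfying $\mathcal W_k(\eta,x)=\mathcal W_k(\eta,x-1)+\eta^{\uparrow}_k(x)-\eta^{\downarrow}_k(x)$ for all $x\in\mathbb Z$, where $\eta^{\uparrow}_k(x)=\eta(x)(1-\mathcal W_k(\eta,x-1))\prod_{j=1}^{k-1}\mathcal W_j(\eta,x-1)$ and $\eta^{\downarrow}_k(x)=(1-\eta(x))\mathcal W_k(\eta,x-1)\prod_{j=1}^{k-1}(1-\mathcal W_j(\eta,x-1))$. Define $\xi_k(\eta,\cdot)$ by $\xi_k(\eta,s_\infty(\eta,0))=0$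 and $\xi_k(\eta,x)-\xi_k(\eta,x-1)=1-\sum_{j=1}^{k}(\eta^\uparrow_j(x)+\eta^\downarrow_j(x))$; $s_k(\eta,x)=\min\{y\in\mathbb Z:\xi_k(\eta,y)=x\}$; $\zeta_k(\eta,i)=\sum_{y=s_k(\eta,i)+1}^{s_k(\eta,i+1)}(\eta^{\uparrow}_k(y)-\eta^{\uparrow}_{k+1}(y))$. The $k$-skip map is $\Psi_k(\eta)(x)=\eta(s_k(\eta,x+\xi_k(\eta,0)))$. **Excursions.** An excursion of length $2n+1$, $n\in\mathbb Z_{\ge0}$, is $\varepsilon=(\varepsilon_0,\dots,\varepsilon_{2n})\in\{0,1\}^{2n+1}$ with $\varepsilon_0=0$, $\sum_{j=1}^{m}(2\varepsilon_j-1)\ge0$ for $1\le m<2n$, and $\sum_{j=1}^{2n}(2\varepsilon_j-1)=0$. $\mathcal E$ is the set of all excursions and $|\varepsilon|$ the length. $\iota(\varepsilon)\in\{0,1\}^{\mathbb Z}$ equals $\varepsilon_x$ for $0\le x\le|\varepsilon|-1$ and $0$ elsewhere. $\zeta_k(\varepsilon)=\sum_{i=0}^{\xi_k(\iota(\varepsilon),|\varepsilon|)-1}\zeta_k(\iota(\varepsilon),i)$. **Measures.** $\mathcal A$ is the set of $\boldsymbol\alpha=(\alpha_k)_{k\in\mathbb N}\in[0,1)^{\mathbb N}$ with $Z_{\boldsymbol\alpha}=\sum_{\varepsilon\in\mathcal E}\prod_k\alpha_k^{\zeta_k(\varepsilon)}<\infty$; $\nu_{\boldsymbol\alpha}(\varepsilon)=Z_{\boldsymbol\alpha}^{-1}\prod_k\alpha_k^{\zeta_k(\varepsilon)}$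 on $\mathcal E$; $\bar\varepsilon(\boldsymbol\alpha)=\sum_\varepsilon|\varepsilon|\nu_{\boldsymbol\alpha}(\varepsilon)=1+2\sum_\varepsilon\sum_k k\zeta_k(\varepsilon)\nu_{\boldsymbol\alpha}(\varepsilon)$; $\mathcal A^+=\{\boldsymbol\alpha\in\mathcal A:\bar\varepsilon(\boldsymbol\alpha)<\infty\}$. The map $\theta$ is $(\theta\boldsymbol\alpha)_k=\alpha_{k+1}/(1-\alpha_1)^{2k}$ (it maps $\mathcal A^+$ to $\mathcal A^+$), and $(C_k\boldsymbol\alpha)_\ell=\alpha_\ell$ for $1\le\ell\le k$, $0$ for $\ell>k$. Given $(\varepsilon_i)_{i\in\mathbb Z}\in\mathcal E^{\mathbb Z}$, let $I((\varepsilon_i))\in\{0,1\}^{\mathbb Z}$ be the concatenation $\cdots\varepsilon_{-1}\varepsilon_0\varepsilon_1\cdots$ with the first letter of $\varepsilon_0$ at site $0$. $\hat\mu_{\boldsymbol\alpha}$ (a probability measure on $\Omega_r$) is the law of $I((\varepsilon_i))$ for $(\varepsilon_i)$ i.i.d. with law $\nu_{\boldsymbol\alpha}$. With $(\tau_y\eta)(x)=\eta(x+y)$, the probability measure $\mu_{\boldsymbol\alpha}$ on $\Omega_*$ is defined by $\int f\,d\mu_{\boldsymbol\alpha}=\frac1{\bar\varepsilon(\boldsymbol\alpha)}\int_{\Omega_r}d\hat\mu_{\boldsymbol\alpha}(\eta)\sum_{y=0}^{s_\infty(\eta,1)-1}f(\tau_y\eta)$. *)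

(* Defs.v *)
From HB Require Import structures.
From mathcomp Require Import all_boot all_order all_algebra.
From mathcomp Require Import all_classical all_reals all_analysis.

Set Implicit Arguments.
Unset Strict Implicit.
Unset Printing Implicit Defensive.

Import Order.TTheory GRing.Theory Num.Theory.
Import numFieldNormedType.Exports.

Local Open Scope classical_set_scope.
Local Open Scope ring_scope.

(* Indices k in {1, 2, ...} are represented by nat; index 0 of a family
   indexed by k is never constrained and never influences anything. *)

(* a, a + 1, ..., b; empty if b < a *)
Definition zrange (a b : int) : seq int :=
  if a <= b then [seq a + j%:Z | j <- iota 0 `|b - a|%N.+1] else [::].

Definition zsum (V : zmodType) (a b : int) (F : int -> V) : V :=
  \sum_(y <- zrange a b) F y.

(* The function G with G a = 0 and G x - G (x - 1) = F x for all x. *)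
Definition zprimitive_from (V : zmodType) (a : int) (F : int -> V) (x : int)
    : V :=
  if a <= x then zsum (a + 1) x F else - zsum (x + 1) a F.

Definition b2z (b : bool) : int := (nat_of_bool b)%:Z.

(* Product sigma-algebra on T^Z. The bases B are arbitrary because T is meant
   to be countable and discrete. *)

Definition cylinders (T : Type) : set (set (int -> T)) :=
  [set A | exists (x : int) (B : set T), A = [set w | B (w x)]].

Definition zprod (T : pointedType) := g_sigma_algebraType (@cylinders T).

Definition conf := zprod bool.

Definition tau (y : int) (eta : int -> bool) : int -> bool :=
  fun x => eta (x + y).

Definition is_record (eta : int -> bool) (x : int) : Prop :=
  forall z, z <= x -> zsum z x (fun y => 2 * b2z (eta y) - 1) < 0.

Definition emin (A : set int) : \bar int :=
  xget +oo%E [set m%:E | m in [set m | A m /\ forall y, A y -> m <= y]].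

Definition emax (A : set int) : \bar int :=
  xget -oo%E [set m%:E | m in [set m | A m /\ forall y, A y -> y <= m]].

Definition next_record (eta : int -> bool) (z : \bar int) : \bar int :=
  emin [set x | is_record eta x /\ (z < x%:E)%E].

Definition prev_record (eta : int -> bool) (z : \bar int) : \bar int :=
  emax [set x | is_record eta x /\ (x%:E < z)%E].

(* +oo (resp. -oo) when there are too few records on the right (left) *)
Definition s_inf (eta : int -> bool) (i : int) : \bar int :=
  let s0 := emax [set x | is_record eta x /\ x <= 0] in
  match i with
  | Posz n => iter n (next_record eta) s0
  | Negz n => iter n.+1 (prev_record eta) s0
  end.

Definition Omega (R : realType) : set conf :=
  [set eta | exists2 l : R, l < 2^-1 &
    (x%:R^-1 * (zsum (- x%:Z) 0 (fun y => b2z (eta y)))%:~R : R)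
      @[x --> \oo] --> l].

Definition Omega_star (R : realType) : set conf :=
  [set eta | Omega R eta /\ forall i, s_inf eta i \is a fin_num].

Definition Omega_r (R : realType) : set conf :=
  [set eta | Omega_star R eta /\ s_inf eta 0 = 0%:E].

Definition seat_up (eta : int -> bool) (W : nat -> int -> bool) (k : nat)
    (x : int) : int :=
  b2z (eta x) * (1 - b2z (W k (x - 1)))
    * \prod_(1 <= j < k) b2z (W j (x - 1)).

Definition seat_down (eta : int -> bool) (W : nat -> int -> bool) (k : nat)
    (x : int) : int :=
  (1 - b2z (eta x)) * b2z (W k (x - 1))
    * \prod_(1 <= j < k) (1 - b2z (W j (x - 1))).

Definition is_seat (eta : int -> bool) (W : nat -> int -> bool) : Prop :=
  forall k, (0 < k)%N ->
    (forall x, is_record eta x -> W k x = false) /\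
    (forall x, b2z (W k x) =
       b2z (W k (x - 1)) + seat_up eta W k x - seat_down eta W k x).

(* For k >= 1 and records unbounded below, [is_seat eta] has exactly one
   solution; otherwise the value is irrelevant. *)
Definition seat (eta : int -> bool) : nat -> int -> bool :=
  xget (fun _ _ => false) [set W | is_seat eta W].

Definition eta_up (eta : int -> bool) (k : nat) (x : int) : int :=
  seat_up eta (seat eta) k x.

Definition eta_down (eta : int -> bool) (k : nat) (x : int) : int :=
  seat_down eta (seat eta) k x.

Definition xi (k : nat) (eta : int -> bool) : int -> int :=
  zprimitive_from (fine (s_inf eta 0))
    (fun x => 1 - \sum_(1 <= j < k.+1) (eta_up eta j x + eta_down eta j x)).

Definition s_k (k : nat) (eta : int -> bool) (x : int) : int :=
  fine (emin [set y | xi k eta y = x]).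

Definition zeta (k : nat) (eta : int -> bool) (i : int) : int :=
  zsum (s_k k eta i + 1) (s_k k eta (i + 1))
    (fun y => eta_up eta k y - eta_up eta k.+1 y).

Definition Psi (k : nat) (eta : int -> bool) : int -> bool :=
  fun x => eta (s_k k eta (x + xi k eta 0)).

Definition is_excursion (e : seq bool) : bool :=
  let h m : int := \sum_(1 <= j < m.+1) (2 * b2z (nth false e j) - 1) in
  [&& odd (size e), ~~ nth false e 0,
      [forall m : 'I_(size e).-1, (0 < m)%N ==> (0 <= h m)]
    & h (size e).-1 == 0].

Definition excursion : Type := {e : seq bool | is_excursion e}.

HB.instance Definition _ := Countable.on excursion.

Lemma is_excursion0 : is_excursion [:: false].
Proof.
apply/and4P; split=> //; first by apply/forallP => -[].
by rewrite big_geq.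
Qed.

HB.instance Definition _ :=
  isPointed.Build excursion (Sub [:: false] is_excursion0).

Definition elen (e : excursion) : nat := size (val e).

Definition iota_exc (e : excursion) : int -> bool :=
  fun x => (0 <= x) && nth false (val e) `|x|%N.

Definition zeta_exc (k : nat) (e : excursion) : int :=
  zsum 0 (xi k (iota_exc e) (elen e)%:Z - 1) (zeta k (iota_exc e)).

Section Measures.
Variable R : realType.
Implicit Type alpha : nat -> R.

(* An infinite product over k >= 1 whose partial products stabilise, since e
   has no soliton of size k for large k. *)
Definition weight alpha (e : excursion) : R :=
  lim ((\prod_(1 <= k < n) alpha k ^ zeta_exc k e) @[n --> \oo]).

Definition Zpart alpha : \bar R :=
  \esum_(e in [set: excursion]) (weight alpha e)%:E.

Definition nu alpha (e : excursion) : R :=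
  (fine (Zpart alpha))^-1 * weight alpha e.

Definition ebar_ext alpha : \bar R :=
  \esum_(e in [set: excursion]) ((elen e)%:R * nu alpha e)%:E.

Definition ebar alpha : R := fine (ebar_ext alpha).

Definition in_A alpha : Prop :=
  (forall k, (0 < k)%N -> 0 <= alpha k < 1) /\ (Zpart alpha < +oo)%E.

Definition in_Aplus alpha : Prop := in_A alpha /\ (ebar_ext alpha < +oo)%E.

Definition theta alpha : nat -> R :=
  fun k => alpha k.+1 / (1 - alpha 1%N) ^+ (2 * k).

Definition Ctrunc (k : nat) alpha : nat -> R :=
  fun l => if (l <= k)%N then alpha l else 0.

(* Mutual independence and the common law p in one product rule: a singleton s
   gives the law of a coordinate. *)
Definition is_iid (p : excursion -> R)
    (P : set (zprod excursion) -> \bar R) : Prop :=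
  forall (s : seq int) (B : int -> set excursion), uniq s ->
    P [set w | forall i, i \in s -> B i (w i)] =
    (\prod_(i <- s) \esum_(e in B i) (p e)%:E)%E.

(* The law of an i.i.d. sequence with marginal p: the unique probability
   measure satisfying [is_iid p] (the default value is irrelevant when p is
   a probability on excursions). *)
Definition iid_law (p : excursion -> R) : probability (zprod excursion) R :=
  xget (\d_ point : probability (zprod excursion) R) [set P | is_iid p P].

(* Site of the first letter of the i-th excursion in the concatenation *)
Definition exc_start (w : int -> excursion) (i : int) : int :=
  zprimitive_from (-1) (fun j => (elen (w j))%:Z) (i - 1).

Definition concat_exc (w : zprod excursion) : conf := fun x =>
  `[< exists i, exc_start w i <= x < exc_start w (i + 1) /\
        nth false (val (w i)) `|x - exc_start w i|%N >].

Definition mu_hat alpha : set conf -> \bar R :=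
  pushforward (iid_law (nu alpha)) concat_exc.

(* The defining formula of mu_alpha, for f the indicator function of A *)
Definition mu alpha (A : set conf) : \bar R :=
  (((ebar alpha)^-1)%:E *
   \int[mu_hat alpha]_(eta in Omega_r R)
     (zsum 0 (fine (s_inf eta 1) - 1)
        (fun y => \1_A (tau y eta) : R))%:E)%E.

Definition cond_on (m : set conf -> \bar R) (B : set conf) (A : set conf)
    : \bar R :=
  (((fine (m B))^-1)%:E * m (A `&` B))%E.

Definition is_local (f : conf -> R) : Prop :=
  exists s : seq int, forall eta eta' : conf,
    (forall x, x \in s -> eta x = eta' x) -> f eta = f eta'.

End Measures.

(* Main.v *)
(** Proof idea.  Write a configuration as a concatenation of excursions [w i].  The
    1-skip acts on each excursion separately, by the map [psi] that deletes every
    letter differing from its predecessor, and seat [k + 1] of a configuration is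
    seat [k] of its 1-skip; hence [Psi k] is the [k]-fold iteration of [psi].  The
    fibre of [psi] over [e] is parametrised by one natural number per letter of
    [e] (half the length of an inserted alternating stretch), and the weight with
    parameters [alpha] factors over it: under [nu alpha] the excursion [psi e] has
    law [nu (theta alpha)] and, given it, these numbers are i.i.d. geometric.  This
    yields the first identity.

    For the second one, sum over the sites [y] of the excursion at the origin: the
    fibre average of the number of sites sent to a site of [psi e] is affine in the
    indicator that a flip follows that site.  This form is stable under iteration,
    so after [k] steps the site weight is [c1 + c2 * flip]; taking [f = 1] gives
    [ebar alpha = c1 * ebar (theta^k alpha) + c2 * (ebar (theta^k alpha) -
    ebar (theta^(k+1) alpha))], and the same relation for the truncated parameters,
    where excursions of [theta^k] are trivial, gives [c1 = ebar (Ctrunc k alpha)].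

    The law of the i.i.d. sequence is the image of Lebesgue measure under a digit
    expansion, and a maximal inequality for the partial sums of excursion lengths
    shows that almost every concatenation has the density required by [Omega]. *)
Require Import Defs.
From HB Require Import structures.
From mathcomp Require Import all_boot all_order all_algebra.
From mathcomp Require Import all_classical all_reals all_analysis.
From mathcomp Require Import measurable_realfun.
From mathcomp Require Import zify ring lra.

Set Implicit Arguments.
Unset Strict Implicit.
Unset Printing Implicit Defensive.

Import Order.TTheory GRing.Theory Num.Theory.
Import numFieldNormedType.Exports.

Local Open Scope classical_set_scope.
Local Open Scope ring_scope.

(** The obstacle is that [mu] and [cond_on] are bare set functions, that seats are obtained by
    choice, and that measurability of [Omega_star] and [Omega_r] is not at hand. Everything is
    therefore moved to pairs [(y, w)], with [y] a site of [w 0], standing for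
    [tau y (concat_exc w)]. On them records, seats and [Psi] have explicit formulas, and the pair is
    determined by the configuration, so a function of decodable configurations is measurable as soon
    as it is measurable in [w] for each [y]. An integral over a domain of unknown measurability is a
    supremum over simple functions, and a measurable set of full measure inside the domain computes
    it. The exponent [2 k] in [theta] has this origin: each of the letters of [e] carries a
    geometric number with normalisation [1 - alpha 1]. As the length of [e] minus 1 is twice the
    total size of its solitons, all these factors but one are absorbed by the powers in [theta]; the
    last one is the ratio of the two partition functions. *)

(** * Words with a first passage at -1 *)

(* [passage h u]: started at height [h], the +-1 path [u] first visits -1 at its
   last step.  Dropping the initial record of an excursion and closing it with
   the next record turns excursions into these words with [h = 0]. *)
Fixpoint passage (h : nat) (u : seq bool) : bool :=
  match u with
  | [::] => false
  | true :: u' => passage h.+1 u'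
  | false :: u' => if h is h'.+1 then passage h' u' else u' == [::]
  end.

Definition step (b : bool) : int := 2 * b2z b - 1.

Definition psum (s : seq bool) : int := \sum_(b <- s) step b.

Lemma psum_cons b s : psum (b :: s) = step b + psum s.
Proof. by rewrite /psum big_cons. Qed.

Lemma psum_take_nth (d : seq bool) m : (m <= size d)%N ->
  psum (take m d) = \sum_(1 <= j < m.+1) step (nth false (false :: d) j).
Proof.
move=> md; rewrite /psum (big_nth false) size_takel // big_add1 /= !big_mkord.
by apply: eq_bigr => i _; rewrite nth_take.
Qed.

(** Bridge from the recursive predicate to the partial-sum conditions in [is_excursion]: the passage
    is made by the closing [false], from height 0. *)
Lemma passage_rcons h d :
  passage h (rcons d false) <->
  (forall m, (m < size d)%N -> 0 <= h%:Z + psum (take m d)) /\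
  h%:Z + psum d = 0.
Proof.
elim: d h => [|b d IH] h.
  by rewrite /= /psum !big_nil addr0; case: h => [|h] //=; split=> // -[_].
have key h' : h'%:Z = h%:Z + step b ->
    passage h' (rcons d false) <->
    (forall m, (m < size (b :: d))%N -> 0 <= h%:Z + psum (take m (b :: d))) /\
    h%:Z + psum (b :: d) = 0.
  move=> hh'; rewrite IH psum_cons addrA -hh'; split=> -[H1 H2]; split=> //.
    move=> [|m] md; first by rewrite take0 /psum big_nil addr0.
    by rewrite /= psum_cons addrA -hh'; exact: H1.
  by move=> m md; have := H1 m.+1 md; rewrite /= psum_cons addrA -hh'.
case: b key => key /=; first by apply: key; rewrite /step /b2z /=; lia.
case: h key => [|h] key; last by apply: key; rewrite /step /b2z /=; lia.
split; first by case: d {IH key}.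
case=> H1 H2; case: d {IH key} H1 H2 => [|c d] H1 H2.
  by move: H2; rewrite /psum big_cons big_nil /step /b2z.
have := H1 1%N isT; rewrite /= /psum big_cons big_nil /step /b2z /=; lia.
Qed.

Lemma passage_last h u : passage h u -> exists d, u = rcons d false.
Proof.
elim: u h => // -[] u IH h /=.
  by move=> /IH[d ->]; exists (true :: d).
by case: h => [/eqP ->|h /IH[d ->]]; [exists [::] | exists (false :: d)].
Qed.

Lemma passage_odd h u : passage h u -> odd (size u) = ~~ odd h.
Proof.
elim: u h => // -[] u IH h /=; first by move/IH=> ->; rewrite /= negbK.
by case: h => [/eqP ->|h /IH ->].
Qed.

Lemma is_excursion_cons c d :
  is_excursion (c :: d) = ~~ c && passage 0 (rcons d c).
Proof.
apply/idP/idP.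
  case/and4P => /= odd_d; case: c => // _ /forallP/= H /eqP H0.
  apply/passage_rcons; rewrite !add0r; split; last first.
    by rewrite -[in RHS]H0 -[in LHS](take_size d) psum_take_nth.
  case=> [|m] md; first by rewrite take0 /psum big_nil.
  rewrite add0r psum_take_nth 1?ltnW //.
  by have := H (Ordinal md); rewrite /=.
case: c => //= /[dup] /passage_odd; rewrite size_rcons => odd_d.
move=> /passage_rcons[H1 H2]; apply/and4P; split=> //.
  apply/forallP => m /=; apply/implyP=> m0.
  by have := H1 m (ltn_ord m); rewrite add0r psum_take_nth // ltnW.
by rewrite -[X in _ == X]H2 add0r -[in X in _ == X](take_size d) psum_take_nth.
Qed.

(* [shrink] is the 1-skip: it deletes the letters that differ from their
   predecessor.  The words shrinking to [s] are the [expand p s ms]: an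
   alternating stretch, of length [2 m] or [2 m + 1] as parity dictates, is
   inserted before each letter of [s]; [slots] recovers the numbers [m]. *)
Fixpoint shrink (p : bool) (u : seq bool) : seq bool :=
  if u is c :: u' then
    if c == p then c :: shrink c u' else shrink c u'
  else [::].

Fixpoint alt (p : bool) (l : nat) : seq bool :=
  if l is l'.+1 then ~~ p :: alt (~~ p) l' else [::].

Fixpoint expand (p : bool) (s : seq bool) (ms : seq nat) : seq bool :=
  match s, ms with
  | c :: s', m :: ms' => alt p (m.*2 + (c != p)) ++ c :: expand c s' ms'
  | _, _ => [::]
  end.

Fixpoint slots (p : bool) (n : nat) (u : seq bool) : seq nat :=
  if u is c :: u' then
    if c == p then n./2 :: slots c 0 u' else slots c n.+1 u'
  else [::].

Fixpoint ups (p : bool) (u : seq bool) : nat :=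
  if u is c :: u' then ((c && ~~ p) + ups c u')%N else 0%N.

Fixpoint changes (p : bool) (u : seq bool) : nat :=
  if u is c :: u' then ((c != p) + changes c u')%N else 0%N.

Lemma shrink_cat p u v :
  shrink p (u ++ v) = shrink p u ++ shrink (last p u) v.
Proof. by elim: u p => //= c u IH p; rewrite IH; case: eqP. Qed.

Lemma size_shrink p u : (size (shrink p u) + changes p u)%N = size u.
Proof. by elim: u p => //= c u IH p; case: eqP => _ /=; rewrite -(IH c); lia. Qed.

(** Rises and falls alternate, so changes are twice the rises up to the first and last letters. *)
Lemma changes_ups p u :
  (changes p u + last p u)%N = ((ups p u).*2 + p)%N.
Proof.
by elim: u p => [p|c u IH p] /=; last by have := IH c; case: c; case: p => /=; lia.
Qed.

(** The deleted letters alternate in sign, starting with a rise. After a letter [p] they sum to [p],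
    hence the shrunk path is at height [h - p]. *)
Lemma passage_shrink (p : bool) h u : (p <= h)%N -> passage h u ->
  passage (h - p) (shrink p u).
Proof.
elim: u p h => // -[] u IH [] h ph /=.
- by move=> /(IH true h.+1 isT); rewrite !subSS subn0; case: h ph => //= h _; rewrite subn1.
- by move=> /(IH true h.+1 isT); rewrite subn1 subn0.
- by case: h ph => // h _ /(IH false h isT); rewrite subn0 subn1.
- by case: h ph => [_ /eqP -> //|h _ /(IH false h isT)]; rewrite !subn0.
Qed.

(** An alternating stretch of even length returns to its initial height. It goes down first only
    when [p = true], and then [p <= h] leaves room for the dip. *)
Lemma passage_alt (p : bool) h m u : (p <= h)%N ->
  passage h (alt p m.*2 ++ u) = passage h u.
Proof.
by elim: m h => // m IH [|h] ph; rewrite doubleS /=; case: p ph IH => //= ph IH; rewrite IH.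
Qed.


Lemma passage_expand (p : bool) h s ms : size ms = size s -> (p <= h)%N ->
  passage (h - p) s -> passage h (expand p s ms).
Proof.
elim: s ms p h => // c s IH [|m ms] //= p h [sz] ph.
have -> : alt p (m.*2 + (c != p)) = alt p m.*2 ++ alt p (c != p).
  elim: m {sz IH} => //= m IHm. rewrite !negbK.
  by congr [:: _, _ & _].
rewrite -catA passage_alt //.
case: c p ph => -[] //=.
- by case: h => // h _; rewrite subn1 /= => H; apply: IH => //; rewrite subn1.
- by move=> _; rewrite subn0 => H; apply: IH => //; rewrite subn1.
- case: h => // h _; rewrite subn1 /=; case: h => [/eqP s0|h H].
    by case: s s0 IH sz => //; case: ms.
  by apply: IH => //; rewrite subn0.
- move=> _; rewrite subn0; case: h => [/eqP s0|h H].
    by rewrite s0; case: ms sz.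
  by apply: IH => //; rewrite subn0.
Qed.

Lemma shrink_alt p l u : shrink p (alt p l ++ u) = shrink (p (+) odd l) u.
Proof. by elim: l p => [|l IH] p /=; [rewrite addbF | case: p (IH (~~ p)) => /= ->; case: (odd l)]. Qed.

Lemma odd_alt_length p c (m : nat) : p (+) odd (m.*2 + (c != p)) = c.
Proof. by rewrite oddD odd_double; case: p; case: c. Qed.

Lemma shrink_expand p s ms : size ms = size s -> shrink p (expand p s ms) = s.
Proof.
elim: s ms p => [|c s IH] [|m ms] //= p [sz].
by rewrite shrink_alt odd_alt_length /= eqxx IH.
Qed.

Lemma slots_alt p n l u : slots p n (alt p l ++ u) = slots (p (+) odd l) (n + l) u.
Proof.
elim: l p n => [|l IH] p n /=; first by rewrite addbF addn0.
by rewrite -addSnnS; case: p (IH (~~ p) n.+1) => /= ->; case: (odd l).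
Qed.

Lemma slots_expand p s ms : size ms = size s -> slots p 0 (expand p s ms) = ms.
Proof.
elim: s ms p => [|c s IH] [|m ms] //= p [sz].
rewrite slots_alt odd_alt_length /= eqxx IH // add0n; congr (_ :: _).
by case: (c != p) => /=; lia.
Qed.

Lemma expand_surj (p : bool) h u : (p <= h)%N -> passage h u ->
  exists2 ms, size ms = size (shrink p u) & u = expand p (shrink p u) ms.
Proof.
elim: u p h => // c u IH p h ph pu.
have [cp|cp] := eqVneq c p; first subst p.
- have : u = [::] \/ exists h', (c <= h')%N && passage h' u.
    move: pu ph => /=; case: c; first by right; exists h.+1.
    by case: h => [/eqP|h]; [left | right; exists h].
  case=> [->|[h' /andP[ch pu']]] /=; rewrite eqxx /=.
    by exists [:: 0%N]; rewrite /= ?eqxx.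
  have [ms sz eu] := IH c h' ch pu'.
  by exists (0%N :: ms); rewrite /= ?sz // eqxx /= -eu.
- have [h' /andP[ch pu']] : exists h', (c <= h')%N && passage h' u.
    move: pu ph => /=; case: c cp; first by exists h.+1.
    by case: p => //; case: h => // h _ pu _; exists h.
  have [ms sz eu] := IH c h' ch pu'; rewrite /= (negPf cp).
  case: (shrink c u) ms sz eu => [|c1 s1] [|m1 ms1] //= sz eu.
    by rewrite eu in pu'.
  (* Prepending [c = ~~ p] lengthens the first stretch by one letter; this completes a pair exactly
     when [c1 == p]. *)
  exists ((m1 + (c1 == p))%N :: ms1) => //.
  rewrite {1}eu /= -cat_cons; congr (_ ++ _).
  have -> : c = ~~ p by case: (c) (p) cp => -[].
  rewrite -[_ :: _]/(alt p (m1.*2 + (c1 != ~~ p)).+1); congr alt.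
  by case: (p); case: (c1) => /=; lia.
Qed.

Lemma ups_alt p l u :
  ups p (alt p l ++ u) = (uphalf (l - p) + ups (p (+) odd l) u)%N.
Proof.
elim: l p => [|l IH] p /=; first by rewrite addbF; case: p.
by rewrite IH; case: p => /=; case: (odd l) => /=; lia.
Qed.

(** Each inserted pair carries exactly one rise; an odd leftover letter carries the change that [s]
    already has at this place. *)
Lemma ups_expand p s ms : size ms = size s ->
  ups p (expand p s ms) = (sumn ms + ups p s)%N.
Proof.
elim: s ms p => [|c s IH] [|m ms] //= p [sz].
rewrite ups_alt odd_alt_length /= IH // andbN add0n.
by case: p; case: c => /=; lia.
Qed.

(** * Excursions and the 1-skip *)

Definition closed_word (e : excursion) : seq bool := rot 1 (val e).

Lemma excursion_cons (e : excursion) :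
  exists2 d, val e = false :: d & passage 0 (rcons d false).
Proof.
case: e => -[|c d] /= ed; first by have := ed.
by move: (ed); rewrite is_excursion_cons; case: c ed => // ed pd; exists d.
Qed.

Lemma closed_wordE (e : excursion) d : val e = false :: d ->
  closed_word e = rcons d false.
Proof. by move=> ed; rewrite /closed_word ed rot1_cons. Qed.

Lemma passage_closed_word e : passage 0 (closed_word e).
Proof. by have [d ed pd] := excursion_cons e; rewrite (closed_wordE ed). Qed.

Lemma size_closed_word e : size (closed_word e) = elen e.
Proof. exact: size_rot. Qed.

Lemma elen_gt0 e : (0 < elen e)%N.
Proof. by rewrite /elen; have [d ->] := excursion_cons e. Qed.

(** A last letter [true] would put the path at -1 one step before its end. *)
Lemma val_last (e : excursion) : last false (val e) = false.
Proof.
have [d -> pd] := excursion_cons e.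
case/lastP: d pd => //= d c; rewrite last_rcons.
case: c => // /passage_rcons[H1 H2].
have := H1 (size d); rewrite size_rcons ltnSn => /(_ isT).
move: H2; rewrite -cats1 take_size_cat // /psum big_cat /= big_seq1.
rewrite /step /b2z /=; set S := \sum_(_ <- _) _; lia.
Qed.

Lemma rcons_passage_excursion d : passage 0 (rcons d false) ->
  is_excursion (false :: d).
Proof. by rewrite is_excursion_cons. Qed.

Lemma shrink_is_excursion (e : excursion) :
  is_excursion (shrink false (val e)).
Proof.
have [d ed pd] := excursion_cons e.
rewrite ed /= is_excursion_cons /=.
have := passage_shrink (leq0n 0%N : (false <= 0)%N) pd.
rewrite -cats1 shrink_cat.
have -> : last false d = false by have := val_last e; rewrite ed.
by rewrite /= cats1.
Qed.

Definition psi (e : excursion) : excursion :=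
  Sub (shrink false (val e)) (shrink_is_excursion e).

Lemma closed_word_psi e : closed_word (psi e) = shrink false (closed_word e).
Proof.
have [d ed pd] := excursion_cons e.
rewrite (closed_wordE ed) (@closed_wordE _ (shrink false d)) /=; last by rewrite ed.
rewrite -!cats1 shrink_cat.
by have := val_last e; rewrite ed /= => ->.
Qed.

Lemma closed_word_inj : injective closed_word.
Proof. by move=> e1 e2 /rot_inj /val_inj. Qed.

Definition excursion_of_word (u : seq bool) : excursion :=
  insubd (point : excursion) (rotr 1 u).

Lemma excursion_of_wordK u : passage 0 u ->
  closed_word (excursion_of_word u) = u.
Proof.
move=> pu; have [d ud] := passage_last pu; subst u.
rewrite /closed_word /excursion_of_word val_insubd.
rewrite rotr1_rcons (rcons_passage_excursion pu).
by rewrite rot1_cons.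
Qed.

Definition grow (e : excursion) (ms : seq nat) : excursion :=
  excursion_of_word (expand false (closed_word e) ms).

Lemma closed_word_grow e ms : size ms = elen e ->
  closed_word (grow e ms) = expand false (closed_word e) ms.
Proof.
move=> sz; apply: excursion_of_wordK; apply: passage_expand => //.
  by rewrite size_closed_word.
by rewrite subn0 passage_closed_word.
Qed.

Definition slots_of (e : excursion) := slots false 0 (closed_word e).

Lemma psi_grow e ms : size ms = elen e -> psi (grow e ms) = e.
Proof.
move=> sz; apply: closed_word_inj; rewrite closed_word_psi closed_word_grow //.
by rewrite shrink_expand // size_closed_word.
Qed.

Lemma slots_of_grow e ms : size ms = elen e -> slots_of (grow e ms) = ms.
Proof.
move=> sz; rewrite /slots_of closed_word_grow //.
by rewrite slots_expand // size_closed_word.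
Qed.

Lemma grow_surj e : exists2 ms, size ms = elen (psi e) & grow (psi e) ms = e.
Proof.
have [ms sz eu] := expand_surj (leq0n 0%N : (false <= 0)%N) (passage_closed_word e).
have sz' : size ms = elen (psi e).
  by rewrite sz -closed_word_psi size_closed_word.
exists ms => //; apply: closed_word_inj; rewrite closed_word_grow //.
by rewrite closed_word_psi -eu.
Qed.

Definition nups (e : excursion) : nat := ups false (closed_word e).

Lemma changes_closed_word e : changes false (closed_word e) = (nups e).*2.
Proof.
have := changes_ups false (closed_word e).
have [d ed _] := excursion_cons e.
by rewrite /nups (closed_wordE ed) last_rcons !addn0.
Qed.

Lemma elen_psi e : elen e = (elen (psi e) + (nups e).*2)%N.
Proof.
by rewrite -changes_closed_word -!size_closed_word closed_word_psi size_shrink.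
Qed.

Lemma nups_grow e ms : size ms = elen e ->
  nups (grow e ms) = (sumn ms + nups e)%N.
Proof.
by move=> sz; rewrite /nups closed_word_grow // ups_expand // size_closed_word.
Qed.

Lemma nups_psi_le e : (nups (psi e) <= nups e)%N.
Proof.
have [ms sz {2}<-] := grow_surj e.
by rewrite nups_grow // leq_addl.
Qed.

Lemma nups_iter_le n e : (nups (iter n psi e) <= nups e)%N.
Proof. by elim: n => //= n; exact: leq_trans (nups_psi_le _). Qed.

Lemma elen_iter n e :
  elen e = (elen (iter n psi e) + (\sum_(j < n) nups (iter j psi e)).*2)%N.
Proof.
elim: n => [|n IH]; first by rewrite big_ord0 addn0.
by rewrite big_ord_recr /= {1}IH (elen_psi (iter n psi e)) doubleD -addnA [X in (_ + X)%N]addnC.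
Qed.

Lemma nups_iter_eq0 n e : (elen e <= n)%N -> nups (iter n psi e) = 0%N.
Proof.
move=> en; apply/eqP; rewrite -leqn0 leqNgt; apply/negP => h.
suff: (n <= \sum_(j < n) nups (iter j psi e))%N.
  have := elen_iter n e; have := elen_gt0 (iter n psi e).
  by set S := (\sum_(_ < _) _)%N; lia.
rewrite -[X in (X <= _)%N](card_ord n) -sum1_card; apply: leq_sum => j _.
apply: leq_trans h _; case: j => j /= /ltnW jn.
by rewrite -(subnK jn) iterD; exact: nups_iter_le.
Qed.

Lemma nups_eq0 e : nups e = 0%N -> elen e = 1%N.
Proof.
move=> n0; have := changes_closed_word e; rewrite n0 -size_closed_word.
by case: (closed_word e) (passage_closed_word e) => // -[] //= u /eqP ->.
Qed.

Lemma elen_sum n e : (elen e <= n)%N ->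
  elen e = (\sum_(j < n) nups (iter j psi e)).*2.+1.
Proof.
by move=> en; rewrite {1}(elen_iter n e) (nups_eq0 (nups_iter_eq0 en)).
Qed.

(** Index in [psi e] of the last surviving letter at or before [j]. The initial record survives, so
    the predecessor is never taken of 0. *)
Definition kept_index (e : excursion) (j : nat) : nat :=
  (size (shrink false (take j.+1 (val e)))).-1.

(** At the last site the default value [false] stands for the record that opens the next
    excursion. *)
Definition flips (e : excursion) (j : nat) : bool :=
  nth false (val e) j.+1 != nth false (val e) j.

Section WordSum.
Variables (R : comPzRingType) (a b : R).
Implicit Types phi : nat -> R.

(** The summand [j] belongs to the site just before the letter [nth false u j]: it is weighted by
    whether that letter is a flip, and [z] counts the letters kept earlier. *)
Definition word_sum phi (p : bool) (z : nat) (u : seq bool) : R :=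
  \sum_(j < size u) phi (z + size (shrink p (take j u)))%N *
     (a + b * (nth false u j != nth false (p :: u) j)%:R).

Lemma word_sum_cons phi p z c u :
  word_sum phi p z (c :: u) =
  phi z * (a + b * (c != p)%:R) + word_sum phi c (z + (c == p)) u.
Proof.
rewrite /word_sum big_ord_recl /= addn0; congr (_ + _).
by apply: eq_bigr => j _ /=; case: eqP => _ /=; rewrite ?addn0 ?addSnnS ?addn1 ?addSn ?addnS.
Qed.

Lemma word_sum_alt phi p z l u :
  word_sum phi p z (alt p l ++ u) =
  phi z * (a + b) * l%:R + word_sum phi (p (+) odd l) z u.
Proof.
elim: l p => [|l IH] p /=; first by rewrite addbF mulr0 add0r.
rewrite word_sum_cons.
have -> : (~~ p == p) = false by case: p.
have -> : p (+) ~~ odd l = ~~ p (+) odd l by case: p; case: (odd l).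
by rewrite addn0 IH -natr1 /=; ring.
Qed.

(** The sites sent to position [i] are those preceding the inserted letters, which are all flips and
    give [a + b] each, and the one preceding the kept letter, which gives [a]. *)
Lemma word_sum_expand phi p z s ms : size ms = size s ->
  word_sum phi p z (expand p s ms) =
  \sum_(i < size s) phi (z + i)%N *
    (a + (a + b) * ((nth 0%N ms i).*2%:R + (nth false s i != nth false (p :: s) i)%:R)).
Proof.
elim: s ms p z => [|c s IH] [|m ms] //= p z; first by rewrite /word_sum !big_ord0.
case=> sz; rewrite word_sum_alt odd_alt_length word_sum_cons eqxx /=.
rewrite big_ord_recl /= addn0 IH // addrA; congr (_ + _).
  by rewrite natrD; ring.
by apply: eq_bigr => i _; rewrite /bump /= add1n addn1 addSnnS.
Qed.

End WordSum.

Lemma sum_kept_index (R : comPzRingType) (a b : R) (phi : nat -> R) e :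
  \sum_(j < elen e) phi (kept_index e j) * (a + b * (flips e j)%:R) =
  word_sum a b phi false 0 (closed_word e).
Proof.
have [d ed _] := excursion_cons e.
rewrite (closed_wordE ed) /word_sum size_rcons /elen ed /=.
apply: eq_bigr => j _.
have jd : (j <= size d)%N by rewrite -ltnS.
rewrite /kept_index /flips ed /= add0n -cats1 take_cat.
have -> : (if (j < size d)%N then take j d else d ++ take (j - size d) [:: false]) = take j d.
  case: ltnP => // dj; have -> : nat_of_ord j = size d by lia.
  by rewrite subnn take0 cats0 take_size.
congr (_ * (_ + _ * (_ != _)%:R)).
  rewrite nth_cat; case: ltnP => // dj; have -> : nat_of_ord j = size d by lia.
  by rewrite subnn nth_default.
case: (nat_of_ord j) jd => //= i id.
by rewrite nth_cat id.
Qed.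

Lemma sum_grow (R : comPzRingType) (a b : R) (phi : nat -> R) e ms :
  size ms = elen e ->
  \sum_(j < elen (grow e ms)) phi (kept_index (grow e ms) j) *
    (a + b * (flips (grow e ms) j)%:R) =
  \sum_(i < elen e) phi i *
    (a + (a + b) * ((nth 0%N ms i).*2%:R + (flips e i)%:R)).
Proof.
move=> sz; rewrite sum_kept_index closed_word_grow // word_sum_expand.
  rewrite size_closed_word; apply: eq_bigr => i _.
  rewrite add0n; congr (_ * (_ + _ * (_ + (_ != _)%:R))).
    have [d ed _] := excursion_cons e.
    rewrite (closed_wordE ed) /flips ed /= nth_rcons.
    by case: ltnP => // di; rewrite nth_default //; case: eqP.
  have [d ed _] := excursion_cons e; rewrite (closed_wordE ed) ed /=.
  case: i => -[|i] //=; rewrite /elen ed /= ltnS => id.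
  by rewrite nth_rcons id.
by rewrite size_closed_word.
Qed.

(** * Concatenations and the k-skip *)

Lemma int_ind_from (a : int) (P : int -> Prop) : P a ->
  (forall x, a <= x -> P x -> P (x + 1)) ->
  (forall x, x <= a -> P x -> P (x - 1)) -> forall x, P x.
Proof.
move=> Pa Pup Pdn x; have [ax|xa] := leP a x.
  have -> : x = a + `|x - a|%N by lia.
  elim: `|x - a|%N => [|n IH]; first by rewrite addr0.
  have -> : a + n.+1 = a + n + 1 by lia.
  by apply: Pup => //; lia.
have -> : x = a - `|x - a|%N%:Z by lia.
elim: `|x - a|%N => [|n IH]; first by rewrite subr0.
have -> : a - n.+1%:Z = a - n%:Z - 1 by lia.
by apply: Pdn => //; lia.
Qed.

Lemma zsumE (V : zmodType) (a : int) (n : nat) (F : int -> V) :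
  zsum a (a + n - 1) F = \sum_(j < n) F (a + j%:Z).
Proof.
rewrite /zsum /zrange; case: n => [|n].
  by rewrite big_ord0 ifF ?big_nil //; lia.
have -> : a <= a + n.+1 - 1 by lia.
have -> : absz (a + n.+1 - 1 - a)%R = n by lia.
by rewrite big_map -(big_mkord xpredT (fun j => F (a + j%:Z))) /index_iota subn0.
Qed.

Lemma zsum_telescope (V : zmodType) (G F : int -> V) a b : a <= b + 1 ->
  (forall x, G x - G (x - 1) = F x) -> zsum a b F = G b - G (a - 1).
Proof.
move=> ab GF; have -> : b = a + `|(b + 1 - a)%R|%N - 1 by lia.
rewrite zsumE; elim: `|(b + 1 - a)%R|%N => [|n IH].
  by rewrite big_ord0 addr0 subrr.
rewrite big_ord_recr /= IH -GF.
have -> : a + n%:Z - 1 = a + n - 1 by lia.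
have -> : a + n.+1%:Z - 1 = a + n by lia.
by rewrite addrC addrA subrK.
Qed.

Lemma zprimitive_from_id (V : zmodType) (F : int -> V) a :
  zprimitive_from a F a = 0.
Proof.
rewrite /zprimitive_from lexx.
by rewrite -[X in zsum _ X _](_ : a + 1 + 0%N - 1 = a) ?zsumE ?big_ord0 //; lia.
Qed.

Lemma zprimitive_fromB (V : zmodType) (F : int -> V) a x :
  zprimitive_from a F x - zprimitive_from a F (x - 1) = F x.
Proof.
rewrite /zprimitive_from; case: (ltrgtP a x) => ax.
- have -> : a <= x - 1 by lia.
  have -> : x = a + 1 + `|x - a|%N - 1 by lia.
  have : (0 < `|x - a|)%N by lia.
  case: `|x - a|%N => // n _.
  have -> : a + 1 + n.+1 - 1 - 1 = a + 1 + n - 1 by lia.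
  by rewrite !zsumE big_ord_recr /= addrAC subrr add0r; congr F; lia.
- have -> : (a <= x - 1) = false by lia.
  have -> : a = x + 1 + `|x - a|%N - 1 by lia.
  rewrite zsumE.
  have -> : x + 1 + `|x - a|%N - 1 = x - 1 + 1 + `|x - a|%N.+1 - 1 by lia.
  rewrite zsumE big_ord_recl opprK.
  have e0 : x - 1 + 1 + 0%N = x by lia.
  rewrite /= e0.
  rewrite [X in _ + (_ + X)](eq_bigr (fun j : 'I__ => F (x + 1 + j%:Z))) => [|j _].
    by rewrite addrCA addNr addr0.
  by congr (F _); rewrite /bump /=; lia.
- rewrite ax.
  have -> : (x <= x - 1) = false by lia.
  rewrite opprK.
  have -> : zsum (x + 1) x F = 0.
    by rewrite -[X in zsum _ X _](_ : x + 1 + 0%N - 1 = x) ?zsumE ?big_ord0 //; lia.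
  rewrite -[X in zsum _ X _](_ : x - 1 + 1 + 1%N - 1 = x); last lia.
  by rewrite zsumE big_ord1 add0r; congr F; rewrite /=; lia.
Qed.

Lemma zprimitive_from_unique (V : zmodType) (F G : int -> V) a x :
  (forall x, G x - G (x - 1) = F x) -> zprimitive_from a F x = G x - G a.
Proof.
move=> GF; rewrite /zprimitive_from; have [ax|ax] := leP a x.
  by rewrite (zsum_telescope _ GF) ?addrK //; lia.
rewrite (zsum_telescope _ GF); last lia.
by rewrite addrK opprB.
Qed.

Lemma emin_eq (A : set int) m : A m -> (forall y, A y -> m <= y) ->
  emin A = m%:E.
Proof.
move=> Am mA; rewrite /emin; apply: xget_unique.
  by exists m.
by move=> _ [m' [Am' m'A] <-]; congr EFin; apply/eqP; rewrite eq_le mA // m'A.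
Qed.

Lemma emax_eq (A : set int) m : A m -> (forall y, A y -> y <= m) ->
  emax A = m%:E.
Proof.
move=> Am mA; rewrite /emax; apply: xget_unique.
  by exists m.
by move=> _ [m' [Am' m'A] <-]; congr EFin; apply/eqP; rewrite eq_le mA // m'A.
Qed.

Section Concat.
Implicit Types w : int -> excursion.

Lemma exc_start0 w : exc_start w 0 = 0.
Proof. by rewrite /exc_start add0r zprimitive_from_id. Qed.

Lemma exc_startS w i : exc_start w (i + 1) = exc_start w i + (elen (w i))%:Z.
Proof.
rewrite /exc_start addrK.
by have := zprimitive_fromB (fun j => (elen (w j))%:Z) (-1) i; lia.
Qed.

Lemma le_exc_start w i j : i <= j ->
  j - i <= exc_start w j - exc_start w i.
Proof.
move=> ij; have -> : j = i + `|j - i|%N by lia.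
elim: `|j - i|%N => [|n IH]; first by rewrite addr0; lia.
have -> : i + n.+1 = i + n + 1 by lia.
by rewrite exc_startS; have := elen_gt0 (w (i + n)); lia.
Qed.

Lemma exc_index w x :
  exists i, exc_start w i <= x < exc_start w (i + 1).
Proof.
elim/(@int_ind_from 0): x => [|x _ [i ix]|x _ [i ix]].
- by exists 0; rewrite exc_startS exc_start0; have := elen_gt0 (w 0); lia.
- have [h|h] := ltP (x + 1) (exc_start w (i + 1)); first by exists i; lia.
  exists (i + 1); rewrite [exc_start w (i + 1 + 1)]exc_startS.
  by have := elen_gt0 (w (i + 1)); lia.
- have [h|h] := leP (exc_start w i) (x - 1); first by exists i; lia.
  exists (i - 1); rewrite subrK.
  have := exc_startS w (i - 1); rewrite subrK => e.
  by have := elen_gt0 (w (i - 1)); lia.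
Qed.

Lemma exc_index_unique w x i j :
  exc_start w i <= x < exc_start w (i + 1) ->
  exc_start w j <= x < exc_start w (j + 1) -> i = j.
Proof.
move=> hi hj; case: (ltrgtP i j) => // ij.
  have /(le_exc_start w) : i + 1 <= j by lia.
  lia.
have /(le_exc_start w) : j + 1 <= i by lia.
lia.
Qed.

Lemma exc_pos w x :
  exists i (j : nat), (j < elen (w i))%N /\ x = exc_start w i + j%:Z.
Proof.
have [i ix] := exc_index w x; exists i, `|x - exc_start w i|%N.
by move: ix; rewrite exc_startS; lia.
Qed.

Lemma concat_at w i (j : nat) : (j < elen (w i))%N ->
  concat_exc w (exc_start w i + j%:Z) = nth false (val (w i)) j.
Proof.
move=> ji; rewrite /concat_exc; apply/asboolP/idP => [[i' [h]]|h].
  have -> : i' = i.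
    by apply: exc_index_unique h _; rewrite exc_startS; lia.
  by rewrite addrC addKr absz_nat.
exists i; rewrite exc_startS addrC addKr absz_nat; split=> //; lia.
Qed.

Lemma concat_start w i : concat_exc w (exc_start w i) = false.
Proof.
have := concat_at (elen_gt0 (w i)); rewrite addr0 => ->.
by have [d ->] := excursion_cons (w i).
Qed.

Lemma concat_before_start w i : concat_exc w (exc_start w i - 1) = false.
Proof.
have := exc_startS w (i - 1); rewrite subrK => ->.
have e0 := elen_gt0 (w (i - 1)).
have -> : exc_start w (i - 1) + elen (w (i - 1)) - 1 =
  exc_start w (i - 1) + (elen (w (i - 1))).-1%:Z by lia.
rewrite concat_at; last by rewrite ltn_predL.
by rewrite /elen nth_last val_last.
Qed.

(* At the last position of an excursion both sides are [false]: the next site is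
   the record that starts the next excursion. *)
Lemma concat_next w i (j : nat) : (j < elen (w i))%N ->
  concat_exc w (exc_start w i + j%:Z + 1) = nth false (val (w i)) j.+1.
Proof.
move=> ji; have [h|h] := ltnP j.+1 (elen (w i)).
  by rewrite -(concat_at h); congr concat_exc; lia.
rewrite nth_default // -(concat_start w (i + 1)) exc_startS.
by congr concat_exc; lia.
Qed.

Lemma concat_flips w i (j : nat) : (j < elen (w i))%N ->
  (concat_exc w (exc_start w i + j%:Z + 1) != concat_exc w (exc_start w i + j%:Z))
  = flips (w i) j.
Proof. by move=> ji; rewrite (concat_at ji) concat_next. Qed.

Lemma kept_index0 e : kept_index e 0 = 0%N.
Proof. by have [d ed _] := excursion_cons e; rewrite /kept_index ed /= take0. Qed.

Lemma size_shrink_take_gt0 (e : excursion) j :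
  (0 < size (shrink false (take j.+1 (val e))))%N.
Proof. by have [d -> _] := excursion_cons e. Qed.

Lemma kept_indexS e (j : nat) : (j.+1 < elen e)%N ->
  kept_index e j.+1 = (kept_index e j + (nth false (val e) j.+1 == nth false (val e) j))%N.
Proof.
move=> je; rewrite /kept_index (take_nth false je) -cats1 shrink_cat size_cat.
have := size_shrink_take_gt0 e j.
have -> : last false (take j.+1 (val e)) = nth false (val e) j.
  by rewrite (take_nth false (ltnW je)) last_rcons.
by rewrite /=; case: eqP => _ /=; lia.
Qed.

Lemma kept_index_lt e (j : nat) : (j < elen e)%N -> (kept_index e j < elen (psi e))%N.
Proof.
move=> je; rewrite /elen /= -[in X in (_ < X)%N](cat_take_drop j.+1 (val e)).
rewrite shrink_cat size_cat /kept_index.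
by have := size_shrink_take_gt0 e j; lia.
Qed.

Lemma kept_index_last e : kept_index e (elen e).-1 = (elen (psi e)).-1.
Proof. by rewrite /kept_index prednK ?elen_gt0 // take_size. Qed.

Lemma nth_psi e (j : nat) : (j.+1 < elen e)%N ->
  nth false (val e) j.+1 = nth false (val e) j ->
  nth false (val (psi e)) (kept_index e j.+1) = nth false (val e) j.+1.
Proof.
move=> je ej; rewrite /= -[in X in nth _ X _](cat_take_drop j.+1 (val e)).
rewrite shrink_cat (drop_nth false je) /= .
have -> : last false (take j.+1 (val e)) = nth false (val e) j.
  by rewrite (take_nth false (ltnW je)) last_rcons.
rewrite kept_indexS // ej eqxx /= nth_cat /kept_index.
have := size_shrink_take_gt0 e j; case: (size _) => // n _ /=.
by rewrite addn1 ltnn subnn.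
Qed.

Definition psis w : int -> excursion := fun i => psi (w i).

(* Counts the sites of [concat_exc w] that survive the 1-skip. *)
Definition skip1 w (x : int) : int :=
  let i := xget 0 [set i | exc_start w i <= x < exc_start w (i + 1)] in
  exc_start (psis w) i + kept_index (w i) `|x - exc_start w i|%N.

Lemma skip1_at w i (j : nat) : (j < elen (w i))%N ->
  skip1 w (exc_start w i + j%:Z) = exc_start (psis w) i + kept_index (w i) j.
Proof.
move=> ji; rewrite /skip1.
have -> : xget 0 [set i0 | exc_start w i0 <= exc_start w i + j < exc_start w (i0 + 1)] = i.
  apply: xget_unique => /=; first by rewrite exc_startS; lia.
  by move=> i' h; apply: exc_index_unique h _; rewrite exc_startS; lia.
by rewrite addrC addKr absz_nat.
Qed.

Lemma skip1_start w i : skip1 w (exc_start w i) = exc_start (psis w) i.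
Proof.
by have := skip1_at (elen_gt0 (w i)); rewrite addr0 kept_index0 addr0.
Qed.

Lemma skip1_before_start w i :
  skip1 w (exc_start w i - 1) = exc_start (psis w) i - 1.
Proof.
have := exc_startS w (i - 1); rewrite subrK => ->.
have := exc_startS (psis w) (i - 1); rewrite subrK => ->.
have e0 := elen_gt0 (w (i - 1)).
have -> : exc_start w (i - 1) + elen (w (i - 1)) - 1 =
  exc_start w (i - 1) + (elen (w (i - 1))).-1%:Z by lia.
rewrite skip1_at; last by rewrite ltn_predL.
rewrite kept_index_last; have := elen_gt0 (psi (w (i - 1))); rewrite /psis; lia.
Qed.

(** The deletion rule stays local across a boundary of two excursions: both letters there are
    [false], and the record survives. *)
Lemma skip1B w x :
  skip1 w x - skip1 w (x - 1) = b2z (concat_exc w x == concat_exc w (x - 1)).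
Proof.
have [i [[|j] [ji ->]]] := exc_pos w x.
  rewrite addr0 skip1_start skip1_before_start concat_start concat_before_start.
  by rewrite /b2z /=; lia.
have -> : exc_start w i + j.+1 - 1 = exc_start w i + j by lia.
have ji' : (j < elen (w i))%N by lia.
by rewrite !skip1_at // !concat_at // kept_indexS // /b2z; lia.
Qed.

Lemma concat_skip1 w x : concat_exc w x = concat_exc w (x - 1) ->
  concat_exc (psis w) (skip1 w x) = concat_exc w x.
Proof.
have [i [[|j] [ji ->]]] := exc_pos w x.
  by rewrite addr0 skip1_start !concat_start.
have -> : exc_start w i + j.+1 - 1 = exc_start w i + j by lia.
have ji' : (j < elen (w i))%N by lia.
rewrite skip1_at // [X in X = _ -> _]concat_at // [X in _ = X -> _]concat_at //.
move=> ej; rewrite (concat_at ji) concat_at ?kept_index_lt //.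
exact: nth_psi.
Qed.

Fixpoint skip k w (x : int) : int :=
  if k is k'.+1 then skip k' (psis w) (skip1 w x) else x.

Fixpoint kept_index_iter k (e : excursion) (j : nat) : nat :=
  if k is k'.+1 then kept_index_iter k' (psi e) (kept_index e j) else j.

Definition psi_iter k w : int -> excursion := fun i => iter k psi (w i).

Lemma psi_iterS k w : psi_iter k (psis w) = psi_iter k.+1 w.
Proof. by apply/funext => i; rewrite /psi_iter /psis -iterSr. Qed.

Lemma skip_at k w i (j : nat) : (j < elen (w i))%N ->
  skip k w (exc_start w i + j%:Z) =
  exc_start (psi_iter k w) i + kept_index_iter k (w i) j.
Proof.
elim: k w j => //= k IH w j ji; rewrite skip1_at // IH ?kept_index_lt //.
by rewrite psi_iterS.
Qed.

Lemma skip_start k w i : skip k w (exc_start w i) = exc_start (psi_iter k w) i.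
Proof. by elim: k w => // k IH w; rewrite /= skip1_start IH psi_iterS. Qed.

Lemma skip_before_start k w i :
  skip k w (exc_start w i - 1) = exc_start (psi_iter k w) i - 1.
Proof. by elim: k w => // k IH w; rewrite /= skip1_before_start IH psi_iterS. Qed.

Lemma skipB k w x : exists b : bool, skip k w x - skip k w (x - 1) = b2z b.
Proof.
elim: k w x => [|k IH] w x /=; first by exists true; rewrite /b2z; lia.
have := skip1B w x; case: eqP => _ /=; rewrite /b2z /= => e.
  have -> : skip1 w (x - 1) = skip1 w x - 1 by lia.
  exact: IH.
exists false; have -> : skip1 w (x - 1) = skip1 w x by lia.
by rewrite subrr.
Qed.

Lemma concat_skip k w x : skip k w x != skip k w (x - 1) ->
  concat_exc (psi_iter k w) (skip k w x) = concat_exc w x.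
Proof.
elim: k w x => [|k IH] w x //= h.
have := skip1B w x; case: eqP => [exx|_] /=; rewrite /b2z /= => e.
  rewrite -(concat_skip1 exx) -psi_iterS IH //.
  by have <- : skip1 w (x - 1) = skip1 w x - 1 by lia.
move: h; have -> : skip1 w (x - 1) = skip1 w x by lia.
by rewrite eqxx.
Qed.

Lemma skip_mono k w x y : x <= y -> skip k w x <= skip k w y.
Proof.
move=> xy; have -> : y = x + `|y - x|%N by lia.
elim: `|y - x|%N => [|n IH]; first by rewrite addr0.
have [b] := skipB k w (x + n.+1).
have -> : x + n.+1 - 1 = x + n by lia.
by rewrite /b2z; case: b => /=; lia.
Qed.

(** The increments of [skip] are 0 or 1 and starts are sent to starts, so it is unbounded on both
    sides and each value has a first preimage. *)
Lemma skip_hit k w x :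
  exists y, [/\ skip k w y = x, skip k w (y - 1) = x - 1 &
    forall z, skip k w z = x -> y <= z].
Proof.
have lo : skip k w (exc_start w (x - `|x| - 1)) <= x - 1.
  rewrite skip_start.
  have /(le_exc_start (psi_iter k w)) : x - `|x| - 1 <= 0 by lia.
  by rewrite exc_start0; lia.
have hi : x <= skip k w (exc_start w `|x|).
  rewrite skip_start.
  have /(le_exc_start (psi_iter k w)) : 0 <= `|x| by lia.
  by rewrite exc_start0; lia.
set l := exc_start w (x - `|x| - 1) in lo.
set u := exc_start w `|x| in hi.
have lu : l <= u.
  rewrite leNgt; apply/negP => ul.
  by have := skip_mono k w (ltW ul); lia.
have ex : exists n : nat, x <= skip k w (l + n%:Z).
  by exists `|u - l|%N; have -> : l + `|u - l|%N = u by lia.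
case: (ex_minnP ex) => n xn nmin.
have n0 : (0 < n)%N by case: n xn {nmin} => //; rewrite addr0; lia.
have hlt : skip k w (l + n - 1) < x.
  rewrite ltNge; apply/negP => h.
  have := nmin n.-1; have -> : l + n.-1%:Z = l + n - 1 by lia.
  by move=> /(_ h); lia.
have [b eb] := skipB k w (l + n).
exists (l + n); split.
- by move: eb; rewrite /b2z; case: b => /=; lia.
- by move: eb; rewrite /b2z; case: b => /=; lia.
- move=> z hz; rewrite leNgt; apply/negP => zl.
  have /(skip_mono k w) : z <= l + n - 1 by lia.
  lia.
Qed.

End Concat.

(** * Records, seat numbers and the formula for [Psi] *)

Section Records.
Implicit Types w : int -> excursion.

(** Based at the site -1; in a concatenation the start of excursion [i] then has height
    [- (i + 1)]. *)
Definition conf_height (eta : int -> bool) : int -> int :=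
  zprimitive_from (-1) (fun y => step (eta y)).

Lemma conf_heightB eta x :
  conf_height eta x - conf_height eta (x - 1) = step (eta x).
Proof. exact: (zprimitive_fromB (fun y => step (eta y)) (-1) x). Qed.

(** The sum over [[z, x]] is the increment of the height from [z - 1] to [x], so records are the
    strict running minima. *)
Lemma is_record_height eta x : is_record eta x <->
  forall z, z < x -> conf_height eta x < conf_height eta z.
Proof.
have E z : z <= x -> zsum z x (fun y => 2 * b2z (eta y) - 1) =
    conf_height eta x - conf_height eta (z - 1).
  by move=> zx; rewrite (zsum_telescope _ (conf_heightB eta)) //; lia.
split=> H z zx.
  have zx' : z + 1 <= x by lia.
  by have := H _ zx'; rewrite E // addrK; lia.
rewrite E //.
have zx' : z - 1 < x by lia.
by have := H _ zx'; lia.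
Qed.

Definition height w := conf_height (concat_exc w).

Lemma heightB w x : height w x - height w (x - 1) = step (concat_exc w x).
Proof. exact: conf_heightB. Qed.

Lemma height_at w i (j : nat) : (j < elen (w i))%N ->
  height w (exc_start w i + j%:Z) =
  height w (exc_start w i) + psum (take j (behead (val (w i)))).
Proof.
elim: j => [|j IH] ji; first by rewrite take0 /psum big_nil !addr0.
have ji' : (j < size (behead (val (w i))))%N by rewrite size_behead -ltnS prednK // elen_gt0.
rewrite (take_nth false) // -cats1 /psum big_cat big_seq1 /= -/(psum _) addrA.
rewrite -IH; last lia.
have := heightB w (exc_start w i + j.+1).
have -> : exc_start w i + j.+1 - 1 = exc_start w i + j by lia.
by rewrite concat_at // nth_behead => h; rewrite -[step _]h; lia.
Qed.

Lemma psum_take_excursion (e : excursion) (j : nat) : (j < elen e)%N ->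
  0 <= psum (take j (behead (val e))).
Proof.
have [d ed /passage_rcons[H1 H2]] := excursion_cons e.
rewrite /elen ed /= ltnS => jd; have [h|h] := ltnP j (size d).
  by have := H1 j h; rewrite add0r.
by rewrite take_oversize // -[psum d]add0r H2.
Qed.

Lemma psum_excursion (e : excursion) : psum (behead (val e)) = 0.
Proof.
have [d ed /passage_rcons[H1 H2]] := excursion_cons e.
by rewrite ed /= -[LHS]add0r H2.
Qed.

Lemma height_start w i : height w (exc_start w i) = - (i + 1).
Proof.
have S j : height w (exc_start w (j + 1)) = height w (exc_start w j) - 1.
  have := heightB w (exc_start w (j + 1)).
  rewrite concat_start exc_startS.
  have e0 := elen_gt0 (w j).
  have -> : exc_start w j + elen (w j) - 1 = exc_start w j + (elen (w j)).-1%:Z by lia.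
  rewrite (@height_at w j (elen (w j)).-1) ?ltn_predL // take_oversize ?size_behead // psum_excursion.
  by rewrite /step /b2z /=; lia.
elim/(@int_ind_from 0): i => [|i _ IH|i _ IH].
- have := heightB w (exc_start w 0); rewrite concat_start exc_start0 sub0r.
  by rewrite [height w (-1)]zprimitive_from_id /step /b2z /=; lia.
- by rewrite S IH; lia.
- by have := S (i - 1); rewrite subrK IH; lia.
Qed.

Lemma height_ge w i x : exc_start w i <= x < exc_start w (i + 1) ->
  - (i + 1) <= height w x.
Proof.
move=> ix; have -> : x = exc_start w i + `|(x - exc_start w i)%R|%N by lia.
have ji : (`|(x - exc_start w i)%R| < elen (w i))%N by move: ix; rewrite exc_startS; lia.
by rewrite height_at // height_start; have := psum_take_excursion ji; lia.
Qed.

(** Inside an excursion the height never falls below its value at the start, and each start is one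
    lower than the preceding one. *)
Lemma is_record_start w x :
  is_record (concat_exc w) x <-> exists i, x = exc_start w i.
Proof.
rewrite is_record_height -/(height w); split=> [H|[i ->] z zi].
  have [i ix] := exc_index w x; exists i.
  apply/eqP; rewrite eq_sym eq_le; apply/andP; split; first by case/andP: ix.
  rewrite leNgt; apply/negP => /H.
  by have := height_ge ix; rewrite height_start; lia.
have [j jz] := exc_index w z.
have ji : j + 1 <= i.
  rewrite leNgt; apply/negP => ij.
  have /(le_exc_start w) : i <= j by lia.
  lia.
by have := height_ge jz; rewrite height_start; lia.
Qed.

Lemma is_record_tau eta y x : is_record (tau y eta) x <-> is_record eta (x + y).
Proof.
have E z : zsum z x (fun v => 2 * b2z (tau y eta v) - 1) =
    zsum (z + y) (x + y) (fun v => 2 * b2z (eta v) - 1).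
  have [zx|xz] := leP z x.
    have -> : x = z + `|(x - z)%R|.+1%N - 1 by lia.
    rewrite zsumE.
    have -> : z + `|(x - z)%R|.+1%N - 1 + y = z + y + `|(x - z)%R|.+1%N - 1 by lia.
    rewrite zsumE; apply: eq_bigr => j _.
    by rewrite /tau addrAC.
  rewrite /zsum /zrange.
  have -> : (z <= x) = false by lia.
  have -> : (z + y <= x + y) = false by lia.
  by rewrite !big_nil.
split=> H z zx.
  have zx' : z - y <= x by lia.
  by have := H _ zx'; rewrite E subrK.
rewrite E; apply: H; lia.
Qed.

Lemma lt_exc_start w i j : (exc_start w i < exc_start w j) = (i < j).
Proof.
apply/idP/idP => h.
  by rewrite ltNge; apply/negP => ji; have := le_exc_start w ji; lia.
by have := le_exc_start w (ltW h); lia.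
Qed.

Lemma exc_start_inj w : injective (exc_start w).
Proof.
move=> i j e; have := lt_exc_start w i j; have := lt_exc_start w j i.
by rewrite e ltxx; lia.
Qed.

Lemma le_exc_start_mono w i j : (exc_start w i <= exc_start w j) = (i <= j).
Proof. by rewrite !leNgt lt_exc_start. Qed.

Lemma record_tau_concat w (y : nat) x :
  is_record (tau y%:Z (concat_exc w)) x <-> exists i, x = exc_start w i - y%:Z.
Proof.
rewrite is_record_tau is_record_start; split=> -[i e]; exists i; lia.
Qed.

Lemma exc_start1 w : exc_start w 1 = elen (w 0).
Proof. by rewrite -[1]add0r exc_startS exc_start0 add0r. Qed.

Lemma s_inf_tau w (y : nat) i : (y < elen (w 0%R))%N ->
  s_inf (tau y%:Z (concat_exc w)) i = (exc_start w i - y%:Z)%:E.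
Proof.
move=> y0; set eta := tau _ _.
have S0 : emax [set x | is_record eta x /\ x <= 0] = (- y%:Z)%:E.
  apply: emax_eq.
    split=> /=; last lia.
    by apply/record_tau_concat; exists 0; rewrite exc_start0; lia.
  move=> _ [/record_tau_concat[j ->] h].
  suff : exc_start w j <= exc_start w 0 by rewrite exc_start0; lia.
  rewrite le_exc_start_mono leNgt; apply/negP => j0.
  have : exc_start w 1 <= exc_start w j by rewrite le_exc_start_mono; lia.
  by rewrite exc_start1; lia.
have SN j : next_record eta (exc_start w j - y%:Z)%:E =
    (exc_start w (j + 1) - y%:Z)%:E.
  apply: emin_eq.
    split; first by apply/record_tau_concat; exists (j + 1).
    by rewrite lte_fin ltrD2r lt_exc_start; lia.
  move=> _ [/record_tau_concat[l ->]]; rewrite lte_fin ltrD2r lt_exc_start.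
  by rewrite lerD2r le_exc_start_mono; lia.
have SP j : prev_record eta (exc_start w j - y%:Z)%:E =
    (exc_start w (j - 1) - y%:Z)%:E.
  apply: emax_eq.
    split; first by apply/record_tau_concat; exists (j - 1).
    by rewrite lte_fin ltrD2r lt_exc_start; lia.
  move=> _ [/record_tau_concat[l ->]]; rewrite lte_fin ltrD2r lt_exc_start.
  by rewrite lerD2r le_exc_start_mono; lia.
rewrite /s_inf S0; case: i => n.
  elim: n => [|n /= ->]; first by rewrite exc_start0 sub0r.
  by rewrite SN; congr (exc_start w _ - _)%:E; lia.
elim: n => [|n IH].
  have -> : (- y%:Z)%:E = (exc_start w 0 - y%:Z)%:E by rewrite exc_start0 sub0r.
  by rewrite /= SP.
by rewrite iterS IH SP; congr (exc_start w _ - _)%:E; lia.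
Qed.

Lemma seat_up_ext eta W W' k x : (0 < k)%N ->
  (forall j, (0 < j <= k)%N -> W j (x - 1) = W' j (x - 1)) ->
  seat_up eta W k x = seat_up eta W' k x.
Proof.
move=> k0 WW; rewrite /seat_up WW ?k0 ?leqnn //; congr (_ * _).
by apply: eq_big_nat => j jk; rewrite WW //; lia.
Qed.

Lemma seat_down_ext eta W W' k x : (0 < k)%N ->
  (forall j, (0 < j <= k)%N -> W j (x - 1) = W' j (x - 1)) ->
  seat_down eta W k x = seat_down eta W' k x.
Proof.
move=> k0 WW; rewrite /seat_down WW ?k0 ?leqnn //; congr (_ * _).
by apply: eq_big_nat => j jk; rewrite WW //; lia.
Qed.

Lemma b2z_inj : injective b2z.
Proof. by case=> -[]. Qed.

(** All seats vanish at a record to the left of [x], and from there the recursion determines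
    them. *)
Lemma is_seat_unique eta W W' :
  (forall x, exists2 r, r <= x & is_record eta r) ->
  is_seat eta W -> is_seat eta W' ->
  forall k x, (0 < k)%N -> W k x = W' k x.
Proof.
move=> rec sW sW' k x k0; have [r rx rr] := rec x.
suff H (n : nat) j : (0 < j)%N -> W j (r + n%:Z) = W' j (r + n%:Z).
  by have := H `|(x - r)%R|%N k k0; have -> : r + `|(x - r)%R|%N = x by lia.
elim: n j => [|n IH] j j0.
  rewrite addr0; have [Wr _] := sW _ j0; have [Wr' _] := sW' _ j0.
  by rewrite Wr ?Wr'.
have [_ Wr] := sW _ j0; have [_ Wr'] := sW' _ j0.
apply: b2z_inj; rewrite Wr Wr'.
have e : r + n.+1 - 1 = r + n%:Z by lia.
have IH' l : (0 < l <= j)%N -> W l (r + n.+1 - 1) = W' l (r + n.+1 - 1).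
  by case/andP=> l0 _; rewrite e IH.
rewrite (seat_up_ext _ j0 IH') (seat_down_ext _ j0 IH').
by rewrite IH' // j0 leqnn.
Qed.

(* Seat 1 copies the configuration; seat k + 1 is seat k of the 1-skip. *)
Fixpoint wseat_pred k w (x : int) : bool :=
  if k is k'.+1 then wseat_pred k' (psis w) (skip1 w x) else concat_exc w x.

Definition wseat w k := wseat_pred k.-1 w.

Lemma seat_up1 eta W x : W 1%N =1 eta ->
  seat_up eta W 1 x = b2z (eta x) * (1 - b2z (eta (x - 1))).
Proof. by move=> We; rewrite /seat_up big_geq // mulr1 We. Qed.

Lemma seat_down1 eta W x : W 1%N =1 eta ->
  seat_down eta W 1 x = (1 - b2z (eta x)) * b2z (eta (x - 1)).
Proof. by move=> We; rewrite /seat_down big_geq // mulr1 We. Qed.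

Lemma skip1_pred w x : concat_exc w x = concat_exc w (x - 1) ->
  skip1 w (x - 1) = skip1 w x - 1.
Proof. by move=> e; have := skip1B w x; rewrite e eqxx /b2z /=; lia. Qed.

Lemma skip1_pred_flip w x : concat_exc w x != concat_exc w (x - 1) ->
  skip1 w (x - 1) = skip1 w x.
Proof. by move=> e; have := skip1B w x; rewrite (negPf e) /b2z /=; lia. Qed.

(** Seat 1 at [x - 1] is the previous letter. Where the letter changes, this factor annihilates the
    product; elsewhere it repeats the letter at [x] and drops out, leaving the seat rule of the
    1-skip. *)
Lemma wseat_upS w k x : seat_up (concat_exc w) (wseat w) k.+2 x =
  b2z (concat_exc w x == concat_exc w (x - 1)) *
  seat_up (concat_exc (psis w)) (wseat (psis w)) k.+1 (skip1 w x).
Proof.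
rewrite /seat_up big_ltn // big_add1 /=.
have [exx|nxx] := eqVneq (concat_exc w x) (concat_exc w (x - 1)).
  rewrite concat_skip1 // -(skip1_pred exx) mul1r.
  rewrite /wseat /= -exx mulrCA mulrA; congr (_ * _).
    by rewrite mulrA; case: concat_exc.
  by rewrite big_nat [RHS]big_nat; apply: eq_bigr => -[].
rewrite mul0r /wseat /=.
by case: (concat_exc w x) (concat_exc w (x - 1)) nxx => -[] //; rewrite /b2z /= ?mul0r ?mulr0.
Qed.

Lemma wseat_downS w k x : seat_down (concat_exc w) (wseat w) k.+2 x =
  b2z (concat_exc w x == concat_exc w (x - 1)) *
  seat_down (concat_exc (psis w)) (wseat (psis w)) k.+1 (skip1 w x).
Proof.
rewrite /seat_down big_ltn // big_add1 /=.
have [exx|nxx] := eqVneq (concat_exc w x) (concat_exc w (x - 1)).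
  rewrite concat_skip1 // -(skip1_pred exx) mul1r.
  rewrite /wseat /= -exx mulrCA mulrA; congr (_ * _).
    by rewrite mulrA; case: concat_exc.
  by rewrite big_nat [RHS]big_nat; apply: eq_bigr => -[].
rewrite mul0r /wseat /=.
by case: (concat_exc w x) (concat_exc w (x - 1)) nxx => -[] //; rewrite /b2z /= ?mul0r ?mulr0.
Qed.

Lemma wseat_is_seat w : is_seat (concat_exc w) (wseat w).
Proof.
case=> // k _; elim: k w => [|k IH] w; split.
- by move=> x /is_record_start[i ->]; rewrite /wseat /= concat_start.
- move=> x; rewrite seat_up1 // seat_down1 // /wseat /=.
  by case: (concat_exc w x); case: (concat_exc w (x - 1)).
- move=> x /is_record_start[i ->]; rewrite /wseat /= skip1_start.
  have [+ _] := IH (psis w); apply.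
  by apply/is_record_start; exists i.
- move=> x; rewrite wseat_upS wseat_downS.
  have [exx|nxx] := eqVneq (concat_exc w x) (concat_exc w (x - 1)).
    rewrite !mul1r.
    have [_ ->] := IH (psis w).
    by rewrite /wseat /= (skip1_pred exx).
  by rewrite /wseat /= (skip1_pred_flip nxx) !mul0r addr0 subr0.
Qed.

Lemma is_seat_tau eta W y : is_seat eta W ->
  is_seat (tau y eta) (fun k x => W k (x + y)).
Proof.
move=> sW k k0; have [W0 W1] := sW k k0; split.
  by move=> x /is_record_tau /W0.
move=> x; rewrite W1 /seat_up /seat_down /tau.
by have -> : x + y - 1 = x - 1 + y by lia.
Qed.

Lemma records_below w (y : nat) x :
  exists2 r, r <= x & is_record (tau y%:Z (concat_exc w)) r.
Proof.
exists (exc_start w (- `|x| ) - y%:Z).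
  have /(le_exc_start w) : - `|x| <= 0 by lia.
  by rewrite exc_start0; lia.
by apply/record_tau_concat; exists (- `|x|).
Qed.

Lemma seat_tau_concat w (y : nat) k x : (0 < k)%N ->
  seat (tau y%:Z (concat_exc w)) k x = wseat w k (x + y%:Z).
Proof.
move=> k0; have sW := is_seat_tau y (wseat_is_seat w).
have sS : is_seat (tau y (concat_exc w)) (seat (tau y (concat_exc w))).
  exact: (@xgetPex _ _ [set W | is_seat _ W] (ex_intro _ _ sW)).
exact: (is_seat_unique (@records_below w y) sS sW x k0).
Qed.

Lemma eta_up_tau w (y : nat) k x : (0 < k)%N ->
  eta_up (tau y%:Z (concat_exc w)) k x =
  seat_up (concat_exc w) (wseat w) k (x + y%:Z).
Proof.
move=> k0; rewrite /eta_up.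
rewrite (@seat_up_ext _ _ (fun k x => wseat w k (x + y))) //.
  rewrite /seat_up /tau.
  by have -> : x + y - 1 = x - 1 + y by lia.
by move=> j /andP[j0 _]; rewrite seat_tau_concat.
Qed.

Lemma eta_down_tau w (y : nat) k x : (0 < k)%N ->
  eta_down (tau y%:Z (concat_exc w)) k x =
  seat_down (concat_exc w) (wseat w) k (x + y%:Z).
Proof.
move=> k0; rewrite /eta_down.
rewrite (@seat_down_ext _ _ (fun k x => wseat w k (x + y))) //.
  rewrite /seat_down /tau.
  by have -> : x + y - 1 = x - 1 + y by lia.
by move=> j /andP[j0 _]; rewrite seat_tau_concat.
Qed.

Lemma eta_flip_tau w (y : nat) x :
  eta_up (tau y%:Z (concat_exc w)) 1 x + eta_down (tau y%:Z (concat_exc w)) 1 x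
  = b2z (concat_exc w (x + y%:Z) != concat_exc w (x + y%:Z - 1)).
Proof.
rewrite eta_up_tau // eta_down_tau // seat_up1 // seat_down1 //.
by case: (concat_exc w (x + y)); case: (concat_exc w (x + y - 1)).
Qed.

(** Seat 1 moves exactly at the flips, where [skip1] stalls and the later seats are idle; at the
    other sites the formula is the one for the 1-skip. This identifies [skip] with [xi]. *)
Lemma skipB_seat k w x : skip k w x - skip k w (x - 1) =
  1 - \sum_(1 <= j < k.+1) (seat_up (concat_exc w) (wseat w) j x +
                            seat_down (concat_exc w) (wseat w) j x).
Proof.
elim: k w x => [|k IH] w x; first by rewrite big_geq //=; lia.
rewrite big_ltn // big_add1 /= seat_up1 // seat_down1 //.
under eq_big_nat => j /andP[j0 _].
  rewrite -(prednK j0) wseat_upS wseat_downS -mulrDr (prednK j0).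
  over.
rewrite -mulr_sumr.
have [exx|nxx] := eqVneq (concat_exc w x) (concat_exc w (x - 1)).
  rewrite mul1r (skip1_pred exx) IH exx.
  by case: concat_exc; rewrite /b2z /= ?mulr0 ?mul0r ?addr0 ?add0r.
rewrite mul0r (skip1_pred_flip nxx) subrr.
by case: (concat_exc w x) (concat_exc w (x - 1)) nxx => -[] //.
Qed.

Lemma xi_tau k w (y : nat) x : (y < elen (w 0%R))%N ->
  xi k (tau y%:Z (concat_exc w)) x = skip k w (x + y%:Z).
Proof.
move=> y0; rewrite /xi s_inf_tau //= exc_start0 sub0r.
rewrite (@zprimitive_from_unique _ _ (fun v => skip k w (v + y))).
  have -> : - y%:Z + y = 0 by lia.
  have : skip k w (exc_start w 0) = 0 by rewrite skip_start exc_start0.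
  by rewrite exc_start0 => ->; rewrite subr0.
move=> v; have -> : v - 1 + y = v + y - 1 by lia.
rewrite skipB_seat; congr (1 - _).
by apply: eq_big_nat => j /andP[j0 _]; rewrite eta_up_tau // eta_down_tau.
Qed.

Lemma s_k_tau k w (y : nat) x : (y < elen (w 0%R))%N ->
  exists2 v, s_k k (tau y%:Z (concat_exc w)) x = v - y%:Z &
    [/\ skip k w v = x, skip k w (v - 1) = x - 1 &
        forall z, skip k w z = x -> v <= z].
Proof.
move=> y0; have [v [h1 h2 h3]] := skip_hit k w x; exists v => //.
rewrite /s_k (@emin_eq _ (v - y%:Z)) //=.
  by rewrite xi_tau // subrK.
by move=> z; rewrite xi_tau // => /h3; lia.
Qed.

(** The first site of a level of [xi] is one where [skip] increases, hence its letter survives all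
    [k] deletions. *)
Lemma Psi_tau k w (y : nat) : (y < elen (w 0%R))%N ->
  Psi k (tau y%:Z (concat_exc w)) =
  tau (kept_index_iter k (w 0) y)%:Z (concat_exc (psi_iter k w)).
Proof.
move=> y0; apply/funext => x; rewrite /Psi.
have := @s_k_tau k w y (x + xi k (tau y (concat_exc w)) 0) y0.
have -> : xi k (tau y (concat_exc w)) 0 = kept_index_iter k (w 0) y.
  rewrite xi_tau // add0r -[y%:Z]add0r -{1}(exc_start0 w) skip_at //.
  by rewrite exc_start0 add0r.
case=> v -> [hv hv1 _]; rewrite {1}/tau subrK -(@concat_skip k) hv //.
by rewrite hv1; lia.
Qed.

End Records.

(** * Soliton counts of a single excursion *)

Lemma tau0 (eta : int -> bool) : tau 0%:Z eta = eta.
Proof. by apply/funext => x; rewrite /tau addr0. Qed.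

(** [point] is a lone record, so this padding realises the zero extension of [e]. *)
Definition isolated (e : excursion) : int -> excursion :=
  fun i => if i == 0 then e else point.

Lemma iota_concat e : iota_exc e = concat_exc (isolated e).
Proof.
apply/funext => x; have [i [j [ji ->]]] := exc_pos (isolated e) x.
rewrite concat_at // /iota_exc.
have [i0|i0] := eqVneq i 0.
  by rewrite i0 exc_start0 add0r /isolated eqxx.
have -> : nth false (val (isolated e i)) j = false.
  by move: ji; rewrite /isolated (negPf i0) /elen /=; case: j.
apply/negP => /andP[h0 h].
have [il|ig] := ltP i 0.
  have : i + 1 <= 0 by lia.
  by rewrite -(le_exc_start_mono (isolated e)) exc_startS exc_start0; lia.
have : 1 <= i by lia.
rewrite -(le_exc_start_mono (isolated e)) exc_start1 {1}/isolated eqxx => h1.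
by move: h; rewrite nth_default // -/(elen e); lia.
Qed.

Lemma ups_sum p u :
  ups p u = (\sum_(j < size u) (nth false u j && ~~ nth false (p :: u) j))%N.
Proof.
elim: u p => [|c u IH] p; first by rewrite big_ord0.
by rewrite /= big_ord_recl /= IH.
Qed.

Lemma nups_sum e : nups e =
  (\sum_(j < elen e) (nth false (val e) j.+1 && ~~ nth false (val e) j))%N.
Proof.
have [d ed _] := excursion_cons e.
rewrite /nups ups_sum size_closed_word; apply: eq_bigr => j _.
rewrite (closed_wordE ed) ed /= nth_rcons.
have -> : (if (j < size d)%N then nth false d j else if nat_of_ord j == size d then false else false) = nth false d j.
  by case: ltnP => // dj; rewrite [RHS]nth_default //; case: eqP.
case: j => -[|j] //=; rewrite /elen ed /= ltnS => jd.
by rewrite nth_rcons jd.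
Qed.

(** A primitive of the upward moves of seat [k + 1]: that of seat 1, read along the k-skip. *)
Fixpoint up_count k (w : int -> excursion) (x : int) : int :=
  if k is k'.+1 then up_count k' (psis w) (skip1 w x)
  else zprimitive_from 0 (seat_up (concat_exc w) (wseat w) 1) x.

Lemma up_countB k w x : up_count k w x - up_count k w (x - 1) =
  seat_up (concat_exc w) (wseat w) k.+1 x.
Proof.
elim: k w x => [|k IH] w x /=; first exact: (zprimitive_fromB _ 0 x).
rewrite wseat_upS.
have [exx|nxx] := eqVneq (concat_exc w x) (concat_exc w (x - 1)).
  by rewrite mul1r (skip1_pred exx) IH.
by rewrite mul0r (skip1_pred_flip nxx) subrr.
Qed.

Lemma up_count_start k w i : up_count k w (exc_start w i) =
  up_count 0 (psi_iter k w) (exc_start (psi_iter k w) i).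
Proof. by elim: k w => // k IH w; rewrite /= skip1_start IH psi_iterS. Qed.

Lemma up_count0 k w : up_count k w 0 = 0.
Proof.
by rewrite -{1}(exc_start0 w) up_count_start exc_start0 /= zprimitive_from_id.
Qed.

Lemma up_count_excursion k w :
  up_count k w (exc_start w 1) = nups (iter k psi (w 0)).
Proof.
rewrite up_count_start exc_start1 -/(psi_iter k w 0).
set v := psi_iter k w.
have -> : up_count 0 v (elen (v 0)) =
    zsum 1 (elen (v 0)) (seat_up (concat_exc v) (wseat v) 1).
  by rewrite (zsum_telescope _ (up_countB 0 v)) ?subrr ?up_count0 ?subr0; lia.
have -> : (elen (v 0))%:Z = 1 + (elen (v 0))%:Z - 1 by lia.
rewrite zsumE nups_sum (big_morph Posz PoszD (erefl _)); apply: eq_bigr => j _.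
rewrite seat_up1 //.
have jv := ltn_ord j.
have := concat_next jv; have := concat_at jv; rewrite exc_start0 add0r.
have -> : 1 + j%:Z = j%:Z + 1 by lia.
rewrite addrK => -> ->.
by case: (nth _ _ j.+1); case: (nth _ _ j).
Qed.

(** The sum over [i] telescopes to the upward moves of seat [k + 1] minus those of seat [k + 2] over
    the whole excursion, and these are the rises of the iterated skips. *)
Lemma zeta_excS k e :
  zeta_exc k.+1 e = (nups (iter k psi e))%:Z - (nups (iter k.+1 psi e))%:Z.
Proof.
rewrite /zeta_exc iota_concat -(tau0 (concat_exc _)).
set w := isolated e; have we : w 0 = e by rewrite /w /isolated eqxx.
have e0 : (0 < elen (w 0%R))%N by exact: elen_gt0.
have -> : xi k.+1 (tau 0%:Z (concat_exc w)) (elen e) = exc_start (psi_iter k.+1 w) 1.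
  by rewrite xi_tau // addr0 -{1}we -exc_start1 skip_start.
pose U x := up_count k w x - up_count k.+1 w x.
have UB x : U x - U (x - 1) =
    eta_up (tau 0%:Z (concat_exc w)) k.+1 x - eta_up (tau 0%:Z (concat_exc w)) k.+2 x.
  by rewrite !eta_up_tau // addr0 -!up_countB /U; lia.
pose s x := s_k k.+1 (tau 0%:Z (concat_exc w)) x.
have s_mono x : s x <= s (x + 1).
  rewrite /s; have [v -> [hv hv1 _]] := @s_k_tau k.+1 w 0 x e0.
  have [v' -> [hv' hv1' _]] := @s_k_tau k.+1 w 0 (x + 1) e0.
  rewrite lerD2r leNgt; apply/negP => /ltW /(skip_mono k.+1 w); lia.
have s_start i : s (exc_start (psi_iter k.+1 w) i) = exc_start w i.
  rewrite /s; have [v -> [hv hv1 hmin]] := @s_k_tau k.+1 w 0 (exc_start (psi_iter k.+1 w) i) e0.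
  rewrite subr0; apply/eqP; rewrite eq_le hmin ?skip_start //=.
  rewrite leNgt; apply/negP => vi.
  have /(skip_mono k.+1 w) : v <= exc_start w i - 1 by lia.
  by rewrite skip_before_start; lia.
have zetaE i : zeta k.+1 (tau 0%:Z (concat_exc w)) i = U (s (i + 1)) - U (s (i + 1 - 1)).
  rewrite /zeta (zsum_telescope _ UB) ?addrK //.
  by have := s_mono i; rewrite /s; lia.
rewrite (@zsum_telescope _ (fun i => U (s (i + 1)))); last 2 first.
- have /(le_exc_start (psi_iter k.+1 w)) : 0 <= 1 :> int by [].
  by rewrite exc_start0; lia.
- by move=> i; rewrite zetaE subrK addrK.
rewrite subrK sub0r addNr.
have s0 : s 0 = 0.
  by rewrite -[X in s X](exc_start0 (psi_iter k.+1 w)) s_start exc_start0.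
rewrite s0 s_start /U !up_count_excursion !up_count0 we; lia.
Qed.

(** * Weights *)

Section Weights.
Variable R : realType.
Implicit Types alpha : nat -> R.

Lemma esumZl (T : choiceType) (S : set T) (a : T -> \bar R) (r : R) : 0 <= r ->
  (forall x, S x -> (0 <= a x)%E) ->
  (\esum_(x in S) (r%:E * a x) = r%:E * \esum_(x in S) a x)%E.
Proof.
move=> r0 a0; rewrite /esum -ereal_supZl //; last first.
  by apply/set0P; exists 0%E; exists set0; [exact: fsets_set0 | rewrite fsbig_set0].
have key X : fsets S X ->
    (\sum_(x \in X) (r%:E * a x) = r%:E * \sum_(x \in X) a x)%E.
  case=> finX XS; rewrite !fsbig_finite // big_seq [in RHS]big_seq.
  rewrite ge0_sume_distrr // => x; rewrite in_fset_set // inE => /XS; exact: a0.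
congr ereal_sup; apply/seteqP; split=> [_ [X XS <-]|_ [_ [X XS <-] <-]].
  by exists (\sum_(x \in X) a x)%E; [exists X | rewrite key].
by exists X => //; rewrite key.
Qed.

(** Shifted by one: this counts the solitons of size [k + 1]. The truncated subtraction is exact by
    [nups_psi_le]. *)
Definition soliton_number (k : nat) (e : excursion) : nat :=
  (nups (iter k psi e) - nups (iter k.+1 psi e))%N.

Lemma zeta_exc_soliton k e : zeta_exc k.+1 e = soliton_number k e.
Proof.
by rewrite zeta_excS /soliton_number; have := nups_psi_le (iter k psi e); rewrite iterS; lia.
Qed.

Lemma soliton_number_psi k e : soliton_number k (psi e) = soliton_number k.+1 e.
Proof. by rewrite /soliton_number -!iterSr. Qed.

Lemma soliton_number_eq0 k e : (elen e <= k)%N -> soliton_number k e = 0%N.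
Proof. by move=> h; rewrite /soliton_number (nups_iter_eq0 h). Qed.

Lemma weightE alpha n e : (elen e <= n)%N ->
  weight alpha e = \prod_(j < n) alpha j.+1 ^+ soliton_number j e.
Proof.
move=> en; rewrite /weight; apply/lim_near_cst => //; exists n.+1 => //= m /= nm.
rewrite -(prednK (leq_trans (ltn0Sn n) nm)) big_add1 big_mkord /=.
have {}nm : (n <= m.-1)%N by lia.
rewrite -(subnKC nm) big_split_ord /= [X in _ * X]big1 ?mulr1 => [|j _].
  by apply: eq_bigr => j _; rewrite zeta_exc_soliton.
by rewrite zeta_exc_soliton soliton_number_eq0 //; lia.
Qed.

Lemma weight_ge0 alpha e : (forall k, (0 < k)%N -> 0 <= alpha k) ->
  0 <= weight alpha e.
Proof.
move=> a0; rewrite (weightE _ (leqnn _)); apply: prodr_ge0 => j _.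
by rewrite exprn_ge0 // a0.
Qed.

Lemma sum_soliton n e : (elen e <= n)%N ->
  (elen e).-1 = (\sum_(j < n) 2 * (j.+1 * soliton_number j e))%N.
Proof.
move=> en; rewrite (elen_sum en) /= -big_distrr /= -mul2n; congr (2 * _)%N.
(* Summation by parts; the boundary term vanishes at [m = n], where no rise is left. *)
have /(_ n) : forall m, (\sum_(j < m) j.+1 * soliton_number j e + m * nups (iter m psi e)
    = \sum_(j < m) nups (iter j psi e))%N.
  elim=> [|m IH]; first by rewrite !big_ord0.
  rewrite !big_ord_recr /= -IH /soliton_number.
  have := nups_psi_le (iter m psi e).
  set S := (\sum_(_ < _) _)%N; rewrite iterS.
  move: (nups (psi _)) (nups (iter m psi e)) => u v uv.
  have -> : v = (u + (v - u))%N by lia.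
  rewrite addKn; nia.
by rewrite (nups_iter_eq0 en) muln0 addn0.
Qed.

(** By [sum_soliton] the denominators in [theta] multiply to the power of [1 - alpha 1] with
    exponent [(elen (psi e)).-1], which the explicit factor compensates. *)
Lemma weight_psi alpha e : alpha 1%N < 1 ->
  weight alpha e = alpha 1%N ^+ soliton_number 0 e *
    (1 - alpha 1%N) ^+ (elen (psi e)).-1 * weight (theta alpha) (psi e).
Proof.
move=> a1; have en := elen_psi e.
have e1 : (elen e <= (elen e).+1)%N by [].
have e2 : (elen (psi e) <= elen e)%N by lia.
rewrite (weightE alpha e1) (weightE (theta alpha) e2) big_ord_recl /= -mulrA.
congr (_ * _); rewrite (sum_soliton e2) expr_sum -big_split /=.
apply: eq_bigr => j _; rewrite /bump /= add1n soliton_number_psi /theta.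
rewrite expr_div_n -exprM -mulnA mulrCA divff ?mulr1 //.
by rewrite expf_neq0 // subr_eq0 gt_eqF.
Qed.

Lemma soliton_number_grow e ms : size ms = elen e ->
  soliton_number 0 (grow e ms) = sumn ms.
Proof. by move=> sz; rewrite /soliton_number /= psi_grow // nups_grow // addnK. Qed.

Lemma weight_grow alpha e ms : alpha 1%N < 1 -> size ms = elen e ->
  weight alpha (grow e ms) = alpha 1%N ^+ sumn ms *
    (1 - alpha 1%N) ^+ (elen e).-1 * weight (theta alpha) e.
Proof.
by move=> a1 sz; rewrite (weight_psi _ a1) (soliton_number_grow sz) (psi_grow sz).
Qed.

Lemma nups_point : nups point = 0%N.
Proof. by rewrite nups_sum big1 // => -[[|//] h]. Qed.

Lemma weight_point alpha : weight alpha point = 1.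
Proof.
rewrite (@weightE _ 1) // big_ord1.
have -> : soliton_number 0 point = 0%N by rewrite /soliton_number /= nups_point.
by rewrite expr0.
Qed.

Lemma bij_grow : set_bij [set p : excursion * seq nat | size p.2 = elen p.1] setT
   (fun p => grow p.1 p.2).
Proof.
split=> [//|[e ms] [e' ms']|e _] /=.
  rewrite !inE /= => sz sz' eg.
  have ee : e = e' by rewrite -(psi_grow sz) -(psi_grow sz') eg.
  by rewrite -(slots_of_grow sz) -(slots_of_grow sz') eg ee.
have [ms sz eg] := grow_surj e.
by exists (psi e, ms).
Qed.

(* The partial sums are [(s - r^N (s + y N)) / (1 - r)], [s] the claimed sum
   times [1 - r]. *)
Lemma esum_affine_geometric (r x y : R) : 0 <= r < 1 -> 0 <= x -> 0 <= y ->
  (\esum_(m in [set: nat]) ((x + y * m%:R) * r ^+ m)%:E =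
   ((x + y * (r / (1 - r))) / (1 - r))%:E)%E.
Proof.
move=> /andP[r0 r1] x0 y0.
have r1' : 1 - r != 0 by rewrite subr_eq0 gt_eqF.
have t0 (a b : R) m : 0 <= a -> 0 <= b -> 0 <= (a + b * m%:R) * r ^+ m.
  by move=> a0 b0; rewrite mulr_ge0 ?exprn_ge0 // addr_ge0 // mulr_ge0.
have S (a b : R) N : \sum_(0 <= m < N) (a + b * m%:R) * r ^+ m =
    ((a + b * (r / (1 - r))) - r ^+ N * ((a + b * (r / (1 - r))) + b * N%:R)) / (1 - r).
  elim: N => [|N IH]; first by rewrite big_nil expr0; field.
  by rewrite big_nat_recr //= IH exprS -natr1; field.
have rn0 : (fun N => r ^+ N) @ \oo --> (0 : R).
  by apply: cvg_expr; rewrite ger0_norm.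
(* [N r^N] is the general term of a series with bounded partial sums. *)
have nrn0 : (fun N => N%:R * r ^+ N) @ \oo --> (0 : R).
  have -> : (fun N => N%:R * r ^+ N) = (fun N => (0 + 1 * N%:R) * r ^+ N).
    by apply/funext => N; rewrite add0r mul1r.
  apply: cvg_series_cvg_0; apply: nondecreasing_is_cvgn.
    apply/nondecreasing_seqP => N; rewrite /series /= big_nat_recr //= lerDl.
    exact: t0.
  exists ((r / (1 - r)) / (1 - r)) => _ [N _ <-].
  rewrite /series /= S add0r !mul1r ler_wpM2r ?invr_ge0 ?subr_ge0 ?(ltW r1) //.
  rewrite gerBl mulr_ge0 ?exprn_ge0 // addr_ge0 // divr_ge0 // subr_ge0 ltW //.
rewrite -nneseries_esumT; last by move=> m; rewrite lee_fin t0.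
apply/cvg_lim => //.
set s := x + _ in S *.
rewrite (_ : (fun _ => _) =
  EFin \o (fun N => (s - (s * r ^+ N + y * (N%:R * r ^+ N))) / (1 - r))); last first.
  by apply/funext => N; rewrite sumEFin S /=; congr EFin; rewrite -/s; ring.
apply: cvg_EFin; first exact: nearW.
have -> : s / (1 - r) = (s - (s * 0 + y * 0)) / (1 - r).
  by rewrite !mulr0 addr0 subr0.
apply: cvgM; last exact: cvg_cst.
apply: cvgB; first exact: cvg_cst.
by apply: cvgD; apply: cvgM => //; exact: cvg_cst.
Qed.

(** The constant [k] carries the induction: while the other slots are summed, the term of the first
    one is absorbed in it. *)
Lemma esum_slots (r : R) n (k : R) (p q : nat -> R) : 0 <= r < 1 -> 0 <= k ->
  (forall i, 0 <= p i) -> (forall i, 0 <= q i) ->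
  (\esum_(ms in [set ms : seq nat | size ms = n])
    (r ^+ sumn ms * (k + \sum_(i < n) (p i + q i * (nth 0%N ms i)%:R)))%:E =
  ((1 - r)^-1 ^+ n * (k + \sum_(i < n) (p i + q i * (r / (1 - r)))))%:E)%E.
Proof.
move=> /[dup] r01 /andP[r0 r1].
elim: n k p q => [|n IH] k p q k0 p0 q0.
  have -> : [set ms : seq nat | size ms = 0%N] = [set [::]].
    by apply/seteqP; split=> [ms /size0nil|_ ->].
  by rewrite esum_set1 !big_ord0 /= ?addr0 ?mul1r // lee_fin.
rewrite (reindex_esum ([set: nat] `*`` fun=> [set ms : seq nat | size ms = n]) _
   (fun z => z.1 :: z.2)); last first.
  split=> [[m ms] /= [_ ->] //|[m ms] [m' ms'] _ _ [-> ->] //|].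
  by case=> [//|m ms] /= [sz]; exists (m, ms).
have t0 (k' : R) (p' q' : nat -> R) ms : 0 <= k' -> (forall i, 0 <= p' i) ->
    (forall i, 0 <= q' i) ->
    0 <= r ^+ sumn ms * (k' + \sum_(i < n) (p' i + q' i * (nth 0%N ms i)%:R)).
  move=> ? ? ?; rewrite mulr_ge0 ?exprn_ge0 // addr_ge0 // sumr_ge0 // => i _.
  by rewrite addr_ge0 // mulr_ge0.
pose t m := (k + p 0%N + q 0%N * m%:R).
have tm0 m : 0 <= t m by rewrite !addr_ge0 // mulr_ge0.
pose S1 := \sum_(i < n) (p i.+1 + q i.+1 * (r / (1 - r))).
have S10 : 0 <= S1.
  apply: sumr_ge0 => i _; rewrite addr_ge0 // mulr_ge0 // divr_ge0 // subr_ge0.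
  exact: ltW.
transitivity (\esum_(m in [set: nat]) \esum_(ms in [set ms : seq nat | size ms = n])
    ((r ^+ m)%:E * (r ^+ sumn ms * (t m +
       \sum_(i < n) (p i.+1 + q i.+1 * (nth 0%N ms i)%:R)))%:E))%E.
  rewrite esum_esum; last first.
    move=> m ms _ _; rewrite -EFinM lee_fin mulr_ge0 ?exprn_ge0 //.
    by apply: (t0 (t m) (p \o S) (q \o S) ms) => [|i|i] /=.
  apply: eq_esum => -[m ms] /= _; rewrite -EFinM exprD -mulrA; congr (_ * (_ * _))%:E.
  by rewrite big_ord_recl /t /= !addrA.
transitivity (\esum_(m in [set: nat]) (((1 - r)^-1 ^+ n)%:E *
    ((k + p 0%N + S1 + q 0%N * m%:R) * r ^+ m)%:E))%E.
  apply: eq_esum => m _; rewrite esumZl ?exprn_ge0 //; last first.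
    by move=> ms _; rewrite lee_fin; apply: (t0 (t m) (p \o S) (q \o S) ms) => [|i|i] /=.
  rewrite (IH (t m) (p \o S) (q \o S)) //= -/S1 -!EFinM; congr EFin; rewrite /t; ring.
have c0 : 0 <= k + p 0%N + S1 by rewrite !addr_ge0.
rewrite esumZl ?exprn_ge0 ?invr_ge0 ?subr_ge0 1?ltW //; last first.
  by move=> m _; rewrite lee_fin mulr_ge0 ?exprn_ge0 // addr_ge0 // mulr_ge0.
rewrite esum_affine_geometric // -EFinM; congr EFin.
rewrite big_ord_recl /= exprS -/S1; ring.
Qed.

End Weights.

(** * Averages over the fibres of the 1-skip *)

Section Fibres.
Variable R : realType.
Implicit Types alpha : nat -> R.

(** This form passes to [theta alpha] and to [Ctrunc k alpha]. The bound [alpha 1 < 1], required for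
    dividing by [1 - alpha 1], is recovered from the finite partition function in [alpha1_lt1]. *)
Definition summable_weights alpha : Prop :=
  (forall k, (0 < k)%N -> 0 <= alpha k) /\ (Zpart alpha < +oo)%E.

Lemma esum_grow (g : excursion -> \bar R) : (forall e, 0 <= g e)%E ->
  (\esum_(e in [set: excursion]) g e =
   \esum_(e in [set: excursion])
     \esum_(ms in [set ms : seq nat | size ms = elen e]) g (grow e ms))%E.
Proof.
move=> g0; rewrite esum_esum // (reindex_esum _ _ _ _ bij_grow).
congr (esum _ _); apply/seteqP; split=> [p //|p []//].
Qed.

Section Alpha.
Variable alpha : nat -> R.
Hypothesis sw : summable_weights alpha.

Let r := alpha 1%N.

Let a0 k : (0 < k)%N -> 0 <= alpha k. Proof. by have [h _] := sw; exact: h. Qed.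

Lemma nu_weight_ge0 e : 0 <= weight alpha e.
Proof. exact: weight_ge0. Qed.

Lemma Zpart_ge1 : (1%:E <= Zpart alpha)%E.
Proof.
rewrite /Zpart; apply: esum_ge; exists [set point]; first by split.
by rewrite fsbig_set1 weight_point.
Qed.

Lemma Zpart_fin : Zpart alpha \is a fin_num.
Proof.
rewrite ge0_fin_numE; first by have [] := sw.
exact: le_trans Zpart_ge1.
Qed.

Lemma fine_Zpart_gt0 : 0 < fine (Zpart alpha).
Proof.
rewrite fine_gt0 // (lt_le_trans _ Zpart_ge1) ?lte_fin //=.
by have [] := sw.
Qed.

Lemma nu_ge0 e : 0 <= nu alpha e.
Proof. by rewrite /nu mulr_ge0 ?nu_weight_ge0 // invr_ge0 ltW // fine_Zpart_gt0. Qed.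

Lemma soliton_number_point j : soliton_number j point = 0%N.
Proof.
have := nups_iter_le j point; rewrite nups_point leqn0 => /eqP h.
by rewrite /soliton_number h sub0n.
Qed.

Lemma weight_single m : weight alpha (grow point [:: m]) = r ^+ m.
Proof.
rewrite (@weightE _ _ (elen (grow point [:: m])).+1) // big_ord_recl /=.
rewrite soliton_number_grow //= addn0 big1 ?mulr1 // => j _.
by rewrite /bump add1n -soliton_number_psi psi_grow // soliton_number_point expr0.
Qed.

(** The excursions grown from a lone record by [m] alternating pairs have weight [r ^+ m]; for
    [r >= 1] any [N] of them would weigh at least [N]. *)
Lemma alpha1_lt1 : r < 1.
Proof.
rewrite ltNge; apply/negP => r1.
have inj : set_inj [set: nat] (fun m => grow point [:: m]).
  move=> m m' _ _ e.
  by have [] : [:: m] = [:: m'] by rewrite -(@slots_of_grow point [:: m]) // e slots_of_grow.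
have H N : (N%:R%:E <= Zpart alpha)%E.
  apply: esum_ge; exists ((fun m => grow point [:: m]) @` `I_N).
    by split=> //; apply: finite_image.
  rewrite fsbig_image; last by move=> m m' _ _; apply: inj; rewrite inE.
  rewrite -(fsbig_ord _ N (fun m => (weight alpha (grow point [:: m]))%:E)) sumEFin lee_fin.
  rewrite -[N in N%:R]card_ord -sum1_card natr_sum; apply: ler_sum => m _.
  by rewrite weight_single exprn_ege1.
have [_ Zoo] := sw.
have := H (Num.bound (fine (Zpart alpha))).
rewrite -{2}(fineK Zpart_fin) lee_fin leNgt => /negP; apply.
by apply: archi_boundP; rewrite ltW // fine_Zpart_gt0.
Qed.

Let rb := r / (1 - r).

Let r01 : 0 <= r < 1. Proof. by rewrite a0 // alpha1_lt1. Qed.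

Let r1n0 : 1 - r != 0. Proof. by rewrite subr_eq0 gt_eqF // alpha1_lt1. Qed.

Lemma theta_ge0 k : (0 < k)%N -> 0 <= theta alpha k.
Proof. by move=> k0; rewrite divr_ge0 ?a0 // exprn_ge0 // subr_ge0 ltW // alpha1_lt1. Qed.

Lemma weight_theta_ge0 e : 0 <= weight (theta alpha) e.
Proof. by apply: weight_ge0 => k; exact: theta_ge0. Qed.

(** The geometric sums give one factor [(1 - r)^-1] per letter of [e], and the weight cancels all of
    them but one. *)
Lemma esum_weight_grow e (k : R) (p q : nat -> R) : 0 <= k ->
  (forall i, 0 <= p i) -> (forall i, 0 <= q i) ->
  (\esum_(ms in [set ms : seq nat | size ms = elen e])
    (weight alpha (grow e ms) *
      (k + \sum_(i < elen e) (p i + q i * (nth 0%N ms i)%:R)))%:E =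
  ((1 - r)^-1 * (weight (theta alpha) e *
    (k + \sum_(i < elen e) (p i + q i * rb))))%:E)%E.
Proof.
move=> k0 p0 q0.
have c0 : 0 <= (1 - r) ^+ (elen e).-1 * weight (theta alpha) e.
  by rewrite mulr_ge0 ?weight_theta_ge0 // exprn_ge0 // subr_ge0 ltW // alpha1_lt1.
rewrite (eq_esum (b := fun ms => (((1 - r) ^+ (elen e).-1 * weight (theta alpha) e)%:E *
   (r ^+ sumn ms *
     (k + \sum_(i < elen e) (p i + q i * (nth 0%N ms i)%:R)))%:E)%E)); last first.
  move=> ms /= sz; rewrite weight_grow ?alpha1_lt1 // -EFinM; congr EFin.
  by rewrite -/r; ring.
rewrite esumZl //; last first.
  move=> ms _; rewrite lee_fin mulr_ge0 ?exprn_ge0 ?a0 // addr_ge0 // sumr_ge0 // => i _.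
  by rewrite addr_ge0 // mulr_ge0.
rewrite esum_slots // -EFinM -/rb; congr EFin; set S := (k + _).
have -> : (1 - r)^-1 ^+ elen e = (1 - r)^-1 * ((1 - r) ^+ (elen e).-1)^-1.
  by rewrite -{1}(prednK (elen_gt0 e)) exprS exprVn.
have n0 : (1 - r) ^+ (elen e).-1 != 0 by rewrite expf_neq0.
move: ((1 - r) ^+ _) n0 => u u0.
by field; rewrite u0 r1n0.
Qed.

Lemma Zpart_theta : Zpart alpha = ((1 - r)^-1%:E * Zpart (theta alpha))%E.
Proof.
rewrite /Zpart esum_grow; last by move=> e; rewrite lee_fin nu_weight_ge0.
rewrite -esumZl ?invr_ge0 ?subr_ge0 1?ltW ?alpha1_lt1 //; last first.
  by move=> e _; rewrite lee_fin weight_theta_ge0.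
apply: eq_esum => e _.
have := @esum_weight_grow e 1 (fun=> 0) (fun=> 0) ler01 (fun=> lexx _) (fun=> lexx _).
under eq_esum => ms _ do (rewrite big1 ?addr0 ?mulr1; last by move=> *; rewrite mul0r addr0).
by move=> ->; rewrite big1 ?addr0 ?mulr1 // => *; rewrite mul0r addr0.
Qed.

Lemma summable_theta : summable_weights (theta alpha).
Proof.
split; first exact: theta_ge0.
have [_] := sw; rewrite Zpart_theta.
have : (0 <= Zpart (theta alpha))%E.
  by apply: esum_ge0 => e _; rewrite lee_fin weight_theta_ge0.
case: (Zpart (theta alpha)) => [z _ _|_|//]; first exact: ltry.
by rewrite gt0_muley // lte_fin invr_gt0 subr_gt0 alpha1_lt1.
Qed.

Lemma nu_theta_scale e :
  (fine (Zpart alpha))^-1 * ((1 - r)^-1 * weight (theta alpha) e) =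
  nu (theta alpha) e.
Proof.
rewrite /nu Zpart_theta.
have : Zpart (theta alpha) \is a fin_num.
  have [h1 h2] := summable_theta; rewrite ge0_fin_numE //.
  by apply: esum_ge0 => e' _; rewrite lee_fin weight_theta_ge0.
case: (Zpart (theta alpha)) => [z _|//|//] /=.
by rewrite invfM invrK mulrACA mulfV // mul1r.
Qed.

(* The slots of [e] are i.i.d. geometric and independent of [psi e]. *)
Lemma esum_nu_slots (k : excursion -> R) (p q : excursion -> nat -> R) :
  (forall e, 0 <= k e) -> (forall e i, 0 <= p e i) -> (forall e i, 0 <= q e i) ->
  (\esum_(e in [set: excursion]) (nu alpha e * (k (psi e) +
     \sum_(i < elen (psi e)) (p (psi e) i + q (psi e) i * (nth 0%N (slots_of e) i)%:R)))%:E =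
   \esum_(e in [set: excursion]) (nu (theta alpha) e *
     (k e + \sum_(i < elen e) (p e i + q e i * rb)))%:E)%E.
Proof.
move=> k0 p0 q0.
rewrite esum_grow; last first.
  move=> e; rewrite lee_fin mulr_ge0 ?nu_ge0 // addr_ge0 // sumr_ge0 // => i _.
  by rewrite addr_ge0 // mulr_ge0.
apply: eq_esum => e _.
rewrite (eq_esum (b := fun ms => ((fine (Zpart alpha))^-1%:E * (weight alpha (grow e ms) *
   (k e + \sum_(i < elen e) (p e i + q e i * (nth 0%N ms i)%:R)))%:E)%E)); last first.
  by move=> ms /= sz; rewrite psi_grow // slots_of_grow // /nu -EFinM mulrA.
rewrite esumZl ?invr_ge0; last 2 first.
- by rewrite ltW // fine_Zpart_gt0.
- move=> ms _; rewrite lee_fin mulr_ge0 ?nu_weight_ge0 // addr_ge0 // sumr_ge0 // => i _.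
  by rewrite addr_ge0 // mulr_ge0.
by rewrite esum_weight_grow // -EFinM -nu_theta_scale !mulrA.
Qed.

Lemma esum_nu_psi (g : excursion -> R) : (forall e, 0 <= g e) ->
  (\esum_(e in [set: excursion]) (nu alpha e * g (psi e))%:E =
   \esum_(e in [set: excursion]) (nu (theta alpha) e * g e)%:E)%E.
Proof.
move=> g0.
have := @esum_nu_slots g (fun _ _ => 0) (fun _ _ => 0) g0 (fun _ _ => lexx _) (fun _ _ => lexx _).
under eq_esum => e _ do (rewrite big1 ?addr0; last by move=> *; rewrite mul0r addr0).
move=> ->; apply: eq_esum => e _.
by rewrite big1 ?addr0 // => *; rewrite mul0r addr0.
Qed.

(** [sum_grow] with each slot number replaced by its geometric mean [rb], regrouped as a constant
    plus a multiple of the flip indicator; this is one step of [mix]. *)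
Lemma esum_nu_kept_index (a b : R) (phi : excursion -> nat -> R) :
  0 <= a -> 0 <= b -> (forall e i, 0 <= phi e i) ->
  (\esum_(e in [set: excursion]) (nu alpha e *
     \sum_(j < elen e) phi (psi e) (kept_index e j) * (a + b * (flips e j)%:R))%:E =
   \esum_(e in [set: excursion]) (nu (theta alpha) e *
     \sum_(i < elen e) phi e i *
       ((a * (1 + 2 * rb) + b * (2 * rb)) + (a + b) * (flips e i)%:R))%:E)%E.
Proof.
move=> ca0 b0 phi0.
have p0 e i : 0 <= phi e i * (a + (a + b) * (flips e i)%:R).
  by rewrite mulr_ge0 // addr_ge0 // mulr_ge0 // addr_ge0.
have q0 (e : excursion) i : 0 <= phi e i * (2 * (a + b)).
  by rewrite mulr_ge0 // mulr_ge0 // addr_ge0.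
have E := esum_nu_slots (fun=> lexx 0) p0 q0.
rewrite (eq_esum (b := fun e => (nu alpha e * (0 + \sum_(i < elen (psi e))
     (phi (psi e) i * (a + (a + b) * (flips (psi e) i)%:R) +
      phi (psi e) i * (2 * (a + b)) * (nth 0%N (slots_of e) i)%:R)))%:E)); last first.
  move=> e _; have [ms sz eg] := grow_surj e; congr (_ * _)%:E.
  have := sum_grow a b (phi (psi e)) sz; rewrite eg => ->.
  have := slots_of_grow sz; rewrite eg => ->.
  by rewrite add0r; apply: eq_bigr => i _; rewrite -muln2 natrM; ring.
rewrite E; apply: eq_esum => e _; congr (_ * _)%:E; rewrite add0r.
by apply: eq_bigr => i _; ring.
Qed.

End Alpha.
End Fibres.

(** * Iterated averages and mean lengths *)

Section Iteration.
Variable R : realType.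
Implicit Types alpha : nat -> R.

(* A weight [a + b] on the sites of an excursion that are followed by a flip, and
   [a] on the others, averages to a weight of the same form on the sites of the
   [k]-skip, with the coefficients [mix k alpha a b]. *)
Fixpoint mix k alpha (a b : R) : R * R :=
  if k is k'.+1 then
    let r := alpha 1%N / (1 - alpha 1%N) in
    mix k' (theta alpha) (a * (1 + 2 * r) + b * (2 * r)) (a + b)
  else (a, b).

Lemma summable_iter_theta k alpha : summable_weights alpha ->
  summable_weights (iter k (@theta R) alpha).
Proof. by move=> sw; elim: k => //= k; exact: summable_theta. Qed.

Lemma odds_ge0 alpha : summable_weights alpha ->
  0 <= alpha 1%N / (1 - alpha 1%N).
Proof.
move=> sw; have [a0 _] := sw.
by rewrite divr_ge0 ?a0 // subr_ge0 ltW // alpha1_lt1.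
Qed.

Lemma mix_ge0 k alpha a b : summable_weights alpha -> 0 <= a -> 0 <= b ->
  0 <= (mix k alpha a b).1 /\ 0 <= (mix k alpha a b).2.
Proof.
elim: k alpha a b => //= k IH alpha a b sw a0 b0.
have r0 := odds_ge0 sw.
apply: IH; [exact: summable_theta | | exact: addr_ge0].
by rewrite addr_ge0 // mulr_ge0 // ?addr_ge0 // mulr_ge0.
Qed.

Lemma esum_nu_iter k alpha (a b : R) (phi : excursion -> nat -> R) :
  summable_weights alpha -> 0 <= a -> 0 <= b -> (forall e i, 0 <= phi e i) ->
  (\esum_(e in [set: excursion]) (nu alpha e *
     \sum_(j < elen e) phi (iter k psi e) (kept_index_iter k e j) *
        (a + b * (flips e j)%:R))%:E =
   \esum_(e in [set: excursion]) (nu (iter k (@theta R) alpha) e *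
     \sum_(i < elen e) phi e i *
       ((mix k alpha a b).1 + (mix k alpha a b).2 * (flips e i)%:R))%:E)%E.
Proof.
elim: k alpha a b => //= k IH alpha a b sw a0 b0 phi0.
have r0 := odds_ge0 sw.
rewrite -[theta (iter k _ alpha)]/(iter k.+1 (@theta R) alpha) iterSr -IH //.
- rewrite -(@esum_nu_kept_index _ _ sw a b
    (fun e i => phi (iter k psi e) (kept_index_iter k e i))) //.
  apply: eq_esum => e _; congr (_ * _)%:E; apply: eq_bigr => j _.
  by rewrite -[psi (iter k psi e)]/(iter k.+1 psi e) iterSr.
- exact: summable_theta.
- by rewrite addr_ge0 // mulr_ge0 // ?addr_ge0 // mulr_ge0.
- exact: addr_ge0.
Qed.

Lemma esum_nu_psi_iter k alpha (g : excursion -> R) :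
  summable_weights alpha -> (forall e, 0 <= g e) ->
  (\esum_(e in [set: excursion]) (nu alpha e * g (iter k psi e))%:E =
   \esum_(e in [set: excursion]) (nu (iter k (@theta R) alpha) e * g e)%:E)%E.
Proof.
elim: k alpha => // k IH alpha sw g0.
rewrite iterSr -IH //; last exact: summable_theta.
rewrite -(esum_nu_psi sw) //; apply: eq_esum => e _.
by rewrite iterSr.
Qed.

Lemma esum_nu alpha : summable_weights alpha ->
  (\esum_(e in [set: excursion]) (nu alpha e)%:E = 1)%E.
Proof.
move=> sw; rewrite /nu; under eq_esum do rewrite EFinM.
rewrite esumZl ?invr_ge0.
- rewrite -/(Zpart alpha) -{2}(fineK (Zpart_fin sw)) -EFinM mulVf //.
  by rewrite gt_eqF // fine_Zpart_gt0.
- by rewrite ltW // fine_Zpart_gt0.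
- by move=> e _; rewrite lee_fin nu_weight_ge0.
Qed.

Lemma sum_flips (e : excursion) :
  \sum_(j < elen e) (flips e j)%:R = (nups e).*2%:R :> R.
Proof.
rewrite -natr_sum; congr _%:R.
rewrite -changes_closed_word.
have -> : forall p u, changes p u =
    (\sum_(j < size u) (nth false u j != nth false (p :: u) j))%N.
  move=> p u; elim: u p => [|c u IH] p; first by rewrite big_ord0.
  by rewrite /= big_ord_recl /= IH.
rewrite size_closed_word; apply: eq_bigr => j _.
have [d ed _] := excursion_cons e.
rewrite (closed_wordE ed) /flips ed /= nth_rcons.
have -> : (if (j < size d)%N then nth false d j else if nat_of_ord j == size d then false else false) = nth false d j.
  by case: ltnP => // dj; rewrite [RHS]nth_default //; case: eqP.
case: j => -[|j] //=; rewrite /elen ed /= ltnS => jd.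
by rewrite nth_rcons jd.
Qed.

Definition flip_mean alpha : \bar R :=
  \esum_(e in [set: excursion]) (nu alpha e * (nups e).*2%:R)%:E.

Lemma ebar_ext_ge0 alpha : summable_weights alpha -> (0 <= ebar_ext alpha)%E.
Proof.
by move=> sw; apply: esum_ge0 => e _; rewrite lee_fin mulr_ge0 // nu_ge0.
Qed.

Lemma flip_mean_ge0 alpha : summable_weights alpha -> (0 <= flip_mean alpha)%E.
Proof.
by move=> sw; apply: esum_ge0 => e _; rewrite lee_fin mulr_ge0 // nu_ge0.
Qed.

Lemma ebar_ext_theta alpha : summable_weights alpha ->
  (ebar_ext alpha = ebar_ext (theta alpha) + flip_mean alpha)%E.
Proof.
move=> sw; rewrite /ebar_ext.
under eq_esum do rewrite mulrC.
under [in RHS]eq_esum do rewrite mulrC.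
rewrite -(esum_nu_psi sw (g := fun e => (elen e)%:R)) // -esumD.
- by apply: eq_esum => e _; rewrite elen_psi natrD mulrDr.
- by move=> e _; rewrite lee_fin mulr_ge0 // nu_ge0.
- by move=> e _; rewrite lee_fin mulr_ge0 // nu_ge0.
Qed.

(** [esum_nu_iter] with [phi = 1]: on the left the sites are counted, on the right sites and flips
    are counted separately. *)
Lemma ebar_ext_mix k alpha : summable_weights alpha ->
  let c := mix k alpha 1 0 in
  (ebar_ext alpha = c.1%:E * ebar_ext (iter k (@theta R) alpha) +
                    c.2%:E * flip_mean (iter k (@theta R) alpha))%E.
Proof.
move=> sw c; have [c1 c2] := mix_ge0 k sw (@ler01 R) (lexx 0).
have sk := summable_iter_theta k sw.
rewrite -/c in c1 c2; rewrite -!esumZl //.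
- rewrite -esumD; last 2 first.
  + by move=> e _; rewrite -EFinM lee_fin mulr_ge0 // mulr_ge0 // nu_ge0.
  + by move=> e _; rewrite -EFinM lee_fin mulr_ge0 // mulr_ge0 // nu_ge0.
  have := @esum_nu_iter k alpha 1 0 (fun _ _ => 1) sw ler01 (lexx _) (fun _ _ => ler01).
  rewrite -/c => E.
  rewrite (_ : ebar_ext alpha = \esum_(e in [set: excursion]) (nu alpha e *
     \sum_(j < elen e) 1 * (1 + 0 * (flips e j)%:R))%:E).
    rewrite E; apply: eq_esum => e _; rewrite -!EFinM -EFinD; congr EFin.
    rewrite -mulr_sumr mul1r big_split /= -mulr_sumr sum_flips.
    by rewrite sumr_const card_ord -mulr_natr; ring.
  apply: eq_esum => e _; congr EFin.
  under eq_bigr do rewrite mul0r addr0 mulr1.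
  by rewrite sumr_const card_ord mulrC.
- by move=> e _; rewrite lee_fin mulr_ge0 // nu_ge0.
- by move=> e _; rewrite lee_fin mulr_ge0 // nu_ge0.
Qed.

Lemma ebar_ext_theta_lty k alpha : summable_weights alpha ->
  (ebar_ext alpha < +oo)%E -> (ebar_ext (iter k (@theta R) alpha) < +oo)%E.
Proof.
move=> sw; elim: k => //= k IH h.
have sk := summable_iter_theta k sw.
apply: le_lt_trans (IH h); rewrite [leRHS]ebar_ext_theta // leeDl //.
exact: flip_mean_ge0.
Qed.

Lemma ebar_ext_fin alpha : summable_weights alpha ->
  (ebar_ext alpha < +oo)%E -> ebar_ext alpha = (ebar alpha)%:E.
Proof. by move=> sw h; rewrite /ebar fineK // ge0_fin_numE // ebar_ext_ge0. Qed.

Lemma flip_meanE alpha : summable_weights alpha -> (ebar_ext alpha < +oo)%E ->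
  flip_mean alpha = (ebar alpha - ebar (theta alpha))%:E.
Proof.
move=> sw h; have := ebar_ext_theta sw.
rewrite (ebar_ext_fin sw h) (ebar_ext_fin (summable_theta sw)); last first.
  exact: (@ebar_ext_theta_lty 1).
case: (flip_mean alpha) (flip_mean_ge0 sw) => [f _||]//.
by rewrite -EFinD => -[->]; rewrite addrAC subrr add0r.
Qed.

Lemma ebar_mix k alpha : summable_weights alpha -> (ebar_ext alpha < +oo)%E ->
  let c := mix k alpha 1 0 in
  let theta_k := iter k (@theta R) alpha in
  ebar alpha = c.1 * ebar theta_k + c.2 * (ebar theta_k - ebar (theta theta_k)).
Proof.
move=> sw h c t; apply: EFin_inj.
have sk : summable_weights t by exact: summable_iter_theta.
have hk : (ebar_ext t < +oo)%E by exact: ebar_ext_theta_lty.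
by rewrite -ebar_ext_fin // (ebar_ext_mix k sw) -/t (flip_meanE sk hk) (ebar_ext_fin sk hk).
Qed.

Lemma ebar_ext_ge1 alpha : summable_weights alpha -> (1 <= ebar_ext alpha)%E.
Proof.
move=> sw; rewrite -(esum_nu sw); apply: le_esum => e _; rewrite lee_fin.
by rewrite ler_peMl ?nu_ge0 // ler1n elen_gt0.
Qed.

Lemma weight_Ctrunc_le k alpha e : (forall k, (0 < k)%N -> 0 <= alpha k) ->
  0 <= weight (Ctrunc k alpha) e <= weight alpha e.
Proof.
move=> a0; rewrite !(weightE _ (leqnn _)) prodr_ge0 /=; last first.
  by move=> j _; rewrite exprn_ge0 // /Ctrunc; case: ifP => // _; exact: a0.
apply: ler_prod => j _; rewrite /Ctrunc; case: ifP => _.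
  by rewrite exprn_ge0 ?a0 /=.
rewrite exprn_ge0 //=; case: (soliton_number j e) => [|n]; first by rewrite !expr0.
by rewrite expr0n /= exprn_ge0 // a0.
Qed.

Lemma summable_Ctrunc k alpha : summable_weights alpha ->
  summable_weights (Ctrunc k alpha).
Proof.
move=> [a0 h]; split; first by move=> j j0; rewrite /Ctrunc; case: ifP => // _; exact: a0.
apply: le_lt_trans h; apply: le_esum => e _; rewrite lee_fin.
by have /andP[] := weight_Ctrunc_le k e a0.
Qed.

Lemma theta_Ctrunc k alpha : theta (Ctrunc k.+1 alpha) = Ctrunc k (theta alpha).
Proof.
by apply/funext => l; rewrite /theta /Ctrunc ltnS; case: ifP; rewrite ?mul0r.
Qed.

Lemma iter_theta_Ctrunc k alpha :
  iter k (@theta R) (Ctrunc k alpha) = Ctrunc 0 (iter k (@theta R) alpha).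
Proof.
elim: k alpha => // k IH alpha.
by rewrite iterSr theta_Ctrunc IH -iterSr.
Qed.

(** [mix k] reads only the first [k] parameters, which the truncation keeps. *)
Lemma mix_Ctrunc k alpha a b : mix k (Ctrunc k alpha) a b = mix k alpha a b.
Proof. by elim: k alpha a b => //= k IH alpha a b; rewrite theta_Ctrunc IH. Qed.

Lemma weight_Ctrunc0 alpha e : (1 < elen e)%N -> weight (Ctrunc 0 alpha) e = 0.
Proof.
move=> e1; rewrite (weightE _ (leqnn _)).
have [j sj] : exists j : 'I_(elen e), soliton_number j e != 0%N.
  apply/existsP; rewrite -negb_forall; apply/negP => /forallP h.
  have := sum_soliton (leqnn (elen e)).
  rewrite big1 => [|j _]; first by lia.
  by rewrite (eqP (h j)) muln0.
apply/eqP/prodf_eq0; exists j => //.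
by rewrite /Ctrunc /= expr0n (negPf sj).
Qed.

Lemma ebar_ext_Ctrunc0 alpha : summable_weights alpha ->
  ebar_ext (Ctrunc 0 alpha) = 1%E.
Proof.
move=> sw; have s0 := summable_Ctrunc 0 sw; rewrite -(esum_nu s0).
apply: eq_esum => e _; have [e1|e1] := ltnP 1 (elen e).
  by rewrite /nu weight_Ctrunc0 // !mulr0.
have -> : elen e = 1%N by have := elen_gt0 e; lia.
by rewrite mul1r.
Qed.

Lemma ebar_Ctrunc k alpha : summable_weights alpha ->
  ebar (Ctrunc k alpha) = (mix k alpha 1 0).1.
Proof.
move=> sw; have s := summable_Ctrunc k sw.
have sk := summable_iter_theta k sw; have s0 := summable_Ctrunc 0 sk.
have e0 := ebar_ext_Ctrunc0 sk.
have := ebar_ext_mix k s; rewrite /= iter_theta_Ctrunc mix_Ctrunc e0.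
have lt0 : (ebar_ext (Ctrunc 0 (iter k (@theta R) alpha)) < +oo)%E by rewrite e0 ltry.
have -> : flip_mean (Ctrunc 0 (iter k (@theta R) alpha)) = 0%E.
  (* The mean length 1 splits into a mean length, already at least 1, and the nonnegative
     [flip_mean]. *)
  have := ebar_ext_theta s0; rewrite e0 => e1.
  have := ebar_ext_ge1 (summable_theta s0); have := flip_mean_ge0 s0.
  move: e1; case: (ebar_ext (theta _)) => [x||//]; case: (flip_mean _) => [y||//] //.
  rewrite -EFinD => -[xy]; rewrite !lee_fin => y0 x1.
  by congr EFin; lra.
by rewrite mule1 mule0 adde0 /ebar => ->.
Qed.

End Iteration.

(** * The product sigma-algebra *)

Section ProductSigmaAlgebra.
Variables (T : pointedType) (code : T -> nat).
Hypothesis code_inj : injective code.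
Implicit Types (w : zprod T) (A : set (zprod T)).

Lemma measurable_coord x (B : set T) :
  measurable ([set w : zprod T | B (w x)] : set (zprod T)).
Proof. by apply: sub_sigma_algebra; exists x, B. Qed.

Lemma measurable_fun_zprod d (S : measurableType d) (g : S -> zprod T) :
  (forall x (B : set T), measurable [set s | B (g s x)]) ->
  measurable_fun setT g.
Proof.
move=> mg; apply: (measurability (rT := zprod T) (@cylinders T)) => //.
by move=> _ [_ [x [B ->]] <-]; rewrite setTI; exact: mg.
Qed.

Definition agree (n : nat) w w' := forall i : int, (`|i| <= n)%N -> w i = w' i.

Definition locally_determined A :=
  forall w, A w -> exists n, forall w', agree n w w' -> A w'.

(** The coordinates from [- p.1] to [p.1] are prescribed through their codes, so that these sets are
    indexed by a countable type; entry [i] stands for the coordinate [i - p.1]. *)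
Definition window_set (p : nat * seq nat) : set (zprod T) :=
  \bigcap_(i in `I_(p.1.*2.+1))
    [set w | code (w (i%:Z - p.1%:Z)) = nth 0%N p.2 i].

(* A set open for the product of discrete topologies is a countable union of
   cylinders. *)
Lemma measurable_locally_determined A : locally_determined A -> measurable A.
Proof.
move=> oA.
have -> : A = \bigcup_p (if `[< window_set p `<=` A >] then window_set p else set0).
  apply/seteqP; split=> [w Aw|w [p _]]; last by case: asboolP => // sub /sub.
  have [n nA] := oA w Aw.
  exists (n, mkseq (fun i => code (w (i%:Z - n%:Z))) n.*2.+1) => //.
  case: asboolP => [_|[]].
    by move=> i /= ni; rewrite nth_mkseq.
  move=> w' w'p; apply: nA => i ni.
  have /(w'p) /= : (`|(i + n%:Z)%R| < n.*2.+1)%N by lia.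
  rewrite nth_mkseq; last lia.
  have -> : `|(i + n%:Z)%R|%:Z - n%:Z = i by lia.
  by move/code_inj.
apply: countable_bigcupT_measurable => // p.
case: asboolP => _ //; apply: bigcap_measurableType => i _.
exact: (measurable_coord _ [set t | code t = nth 0%N p.2 i]).
Qed.

Definition boxes : set (set (zprod T)) :=
  [set A | exists2 s : seq int, uniq s & exists B : int -> set T,
     A = [set w | forall i, i \in s -> B i (w i)]].

Lemma measurable_box (s : seq int) (B : int -> set T) :
  measurable ([set w | forall i, i \in s -> B i (w i)] : set (zprod T)).
Proof.
have -> : [set w : zprod T | forall i, i \in s -> B i (w i)] =
    \bigcap_(n in `I_(size s)) [set w | B (nth 0 s n) (w (nth 0 s n))].
  apply/seteqP; split=> w h i /= ni; first exact: h (mem_nth _ ni).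
  by rewrite -(nth_index 0 ni); apply: h; rewrite /= index_mem.
by apply: bigcap_measurableType => n _; exact: measurable_coord.
Qed.

Lemma boxes_setI : setI_closed boxes.
Proof.
move=> _ _ [s us [B ->]] [s' us' [B' ->]].
exists (undup (s ++ s')); first exact: undup_uniq.
exists (fun i => [set t | (i \in s -> B i t) /\ (i \in s' -> B' i t)]).
apply/seteqP; split=> w /=.
  by move=> [h h'] i _; split=> hi; [exact: h | exact: h'].
move=> h; split=> i hi; have := h i; rewrite mem_undup mem_cat hi ?orbT;
  by move=> /(_ isT)[h1 h2]; auto.
Qed.

Lemma measurable_boxes : @measurable _ (zprod T) = <<s boxes >>.
Proof.
apply/seteqP; split.
  apply: smallest_sub; first exact: smallest_sigma_algebra.
  move=> _ [x [B ->]]; apply: sub_sigma_algebra.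
  exists [:: x] => //; exists (fun=> B).
  apply/seteqP; split=> w /=; first by move=> Bx i; rewrite inE => /eqP ->.
  by apply; rewrite inE.
apply: smallest_sub; first exact: sigma_algebra_measurable.
by move=> _ [s _ [B ->]]; exact: measurable_box.
Qed.

Lemma zprod_measure_unique (R : realType) (P Q : {measure set (zprod T) -> \bar R}) :
  (P setT < +oo)%E ->
  (forall (s : seq int) (B : int -> set T), uniq s ->
    P [set w | forall i, i \in s -> B i (w i)] =
    Q [set w | forall i, i \in s -> B i (w i)]) ->
  forall A, measurable A -> P A = Q A.
Proof.
move=> Pfin PQ A mA.
apply: (@measure_unique _ _ _ boxes (fun=> setT)) => //.
- exact: measurable_boxes.
- exact: boxes_setI.
- by move=> _; exists [::] => //; exists (fun=> setT); apply/seteqP; split.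
- by rewrite bigcup_const //; exists 0%N.
- by move=> _ [s us [B ->]]; exact: PQ.
Qed.

End ProductSigmaAlgebra.

(** * Independent excursions *)

(* The library attaches the measure structure of a pushforward to the proof that
   the map is measurable, which unification cannot find. *)
Lemma pushforward_measure d d' (T1 : measurableType d) (T2 : measurableType d')
    (R : realType) (m : {measure set T1 -> \bar R}) (f : T1 -> T2) :
  measurable_fun setT f ->
  exists m' : {measure set T2 -> \bar R}, forall A, m' A = m (f @^-1` A).
Proof.
move=> mf.
by exists (measure_function_pushforward__canonical__measure_function_Measure m mf).
Qed.

(** * Independent digits under Lebesgue measure *)

Section NestedIntervals.
Variable R : realType.
Local Notation leb := (@lebesgue_measure R).
Local Notation RM := (measurableTypeR R).

Lemma measurable_affine (a q : R) :
  measurable_fun setT ((fun u => (u - a) / q) : RM -> RM).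
Proof.
by apply: measurable_funM => //; apply: measurable_funB.
Qed.

(** The image measure divided by [q] agrees with Lebesgue measure on half-open intervals, hence
    everywhere by uniqueness. *)
Lemma lebesgue_affine (a q : R) (A : set RM) : 0 < q -> measurable A ->
  leb [set u | A ((u - a) / q)] = (q%:E * leb A)%E.
Proof.
move=> q0 mA.
have qV0 : 0 <= q^-1 by rewrite invr_ge0 ltW.
have [m mE] := pushforward_measure leb (measurable_affine a q).
have : leb A = mscale (NngNum qV0) m A.
  apply: lebesgue_measure_unique => // _ [[x y] _ <-].
  transitivity (q^-1%:E * m `]x, y]%classic)%E; last by [].
  rewrite mE.
  have -> : (fun u => (u - a) / q) @^-1` `]x, y] = `]a + q * x, a + q * y]%classic.
    apply/seteqP; split=> u /=; rewrite !in_itv /= ltr_pdivlMr // ler_pdivrMr //.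
      by move=> /andP[h1 h2]; apply/andP; split; nra.
    by move=> /andP[h1 h2]; apply/andP; split; nra.
  rewrite lebesgue_measure_itv [X in _ = (_ * X)%E]lebesgue_measure_itv /= !lte_fin ltrD2l ltr_pM2l //.
  case: ifP => _; last by rewrite mule0.
  rewrite -!EFinB -EFinM; congr EFin; field; exact: lt0r_neq0.
move=> ->; transitivity (q%:E * (q^-1%:E * m A))%E; last by [].
by rewrite mE muleA -EFinM divff ?mul1e // gt_eqF.
Qed.

Variable q : nat -> R.
Hypothesis q_ge0 : forall n, 0 <= q n.
Hypothesis q_sum : (\sum_(n <oo) (q n)%:E = 1)%E.

Definition cumul n : R := \sum_(m < n) q m.

Lemma cumulS n : cumul n.+1 = cumul n + q n.
Proof. by rewrite /cumul big_ord_recr. Qed.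

Lemma cumul_mono m n : (m <= n)%N -> cumul m <= cumul n.
Proof.
move=> mn; rewrite -(subnKC mn); elim: (n - m)%N => [|k IH]; first by rewrite addn0.
by rewrite addnS cumulS; apply: le_trans IH _; rewrite lerDl.
Qed.

Lemma cumul_le1 n : cumul n <= 1.
Proof.
rewrite -lee_fin -q_sum /cumul -sumEFin -(big_mkord xpredT (fun m => (q m)%:E)).
by apply: nneseries_lim_ge => m _ _; rewrite lee_fin.
Qed.

Lemma cumul_cover u : 0 <= u < 1 -> exists n, cumul n <= u < cumul n.+1.
Proof.
move=> /andP[u0 u1].
have [n un] : exists n, u < cumul n.
  apply/not_existsP => h; have : (1 <= u%:E)%E.
    rewrite -q_sum; apply: lime_le; first by apply: is_cvg_nneseries => n _ _; rewrite lee_fin.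
    apply: nearW => n; rewrite sumEFin lee_fin big_mkord leNgt; exact/negP/h.
  by rewrite lee_fin leNgt u1.
have ex : exists n, u < cumul n by exists n.
case: (ex_minnP ex) => -[|k] uk kmin; first by move: uk; rewrite /cumul big_ord0 ltNge u0.
exists k; rewrite uk andbT leNgt; apply/negP => /kmin; by rewrite ltnn.
Qed.

Definition digit (u : R) : nat := xget 0%N [set n | cumul n <= u < cumul n.+1].

Lemma cumul_unique u (m n : nat) :
  cumul m <= u < cumul m.+1 -> cumul n <= u < cumul n.+1 -> m = n.
Proof.
move=> /andP[h1 h2] /andP[h3 h4].
case: (ltngtP m n) => // mn.
  by have := le_lt_trans (le_trans (cumul_mono mn) h3) h2; rewrite ltxx.
by have := le_lt_trans (le_trans (cumul_mono mn) h1) h4; rewrite ltxx.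
Qed.

Lemma digitE u n : cumul n <= u < cumul n.+1 -> digit u = n.
Proof.
by move=> h; apply: xget_unique => // m h'; exact: (@cumul_unique u).
Qed.

(* The digits of [u] in the iterated subdivision of [0, 1[ into intervals of
   lengths proportional to [q]; they are i.i.d. of law [q] under Lebesgue measure. *)
Definition zoom (u : R) : R := (u - cumul (digit u)) / q (digit u).

Definition digits (u : R) (i : nat) : nat := digit (iter i zoom u).

Local Notation I := (`[0, 1[%classic : set RM).

Lemma branchE n : I `&` [set u | digit u = n] = `[cumul n, cumul n.+1[%classic.
Proof.
apply/seteqP; split=> u /=; rewrite !in_itv /=.
  by move=> [/cumul_cover[m h] <-]; rewrite (digitE h).
move=> h; split; last exact: digitE.
have := cumul_mono (leq0n n); rewrite {1}/cumul big_ord0.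
by have := cumul_le1 n.+1; lra.
Qed.

Lemma zoom_I u : 0 <= u < 1 -> 0 <= zoom u < 1.
Proof.
move=> /cumul_cover[n h]; rewrite /zoom (digitE h); move: h.
rewrite cumulS => /andP[h1 h2]; have qn : 0 < q n by lra.
rewrite divr_ge0 ?subr_ge0 //= ltr_pdivrMr //; lra.
Qed.

Definition digits_in (B : nat -> set nat) (N : nat) : set RM :=
  I `&` [set u | forall i, (i < N)%N -> B i (digits u i)].

(** Split by the first digit: on its interval [zoom] is affine, so the constraints on the other
    digits form an affine copy of a set with one digit fewer. *)
Lemma digits_inS B N : digits_in B N.+1 =
  \bigcup_(n in B 0%N) (`[cumul n, cumul n.+1[%classic `&`
     [set u | digits_in (fun i => B i.+1) N ((u - cumul n) / q n)]).
Proof.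
apply/seteqP; split=> [u [Iu uB]|u [n Bn []]].
  exists (digit u); first exact: (uB 0%N).
  split; first by rewrite -branchE.
  split; first by move: Iu; rewrite /= !in_itv /=; exact: zoom_I.
  by move=> i iN; have := uB i.+1 iN; rewrite /digits iterSr.
rewrite -branchE => -[Iu du] [_ uB]; split=> //.
case=> [|i] iN; first by rewrite /digits /= du.
by have := uB i iN; rewrite /digits iterSr /zoom du.
Qed.

Lemma measurable_digits_in B N : measurable (digits_in B N).
Proof.
elim: N B => [|N IH] B.
  have -> : digits_in B 0 = I by apply/seteqP; split=> [u []|u].
  exact: measurable_itv.
rewrite digits_inS; apply: bigcup_measurable => n _; apply: measurableI.
  exact: measurable_itv.
by rewrite -[X in measurable X]setTI; apply: measurable_affine.
Qed.

Lemma lebesgue_digits_in B N : leb (digits_in B N) =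
  (\prod_(i < N) \esum_(n in B i) (q n)%:E)%E.
Proof.
elim: N B => [|N IH] B.
  have -> : digits_in B 0 = I by apply/seteqP; split=> [u []|u].
  by rewrite lebesgue_measure_itv /= lte_fin ltr01 oppr0 adde0 big_ord0.
rewrite digits_inS measure_bigcup; last 2 first.
- move=> n _; apply: measurableI; first exact: measurable_itv.
  by rewrite -[X in measurable X]setTI; apply: measurable_affine => //; exact: measurable_digits_in.
- apply/trivIsetP => m n _ _ mn; apply/seteqP; split=> // u [[+ _] [+ _]].
  by rewrite -!branchE => -[_ /= dm] [_ /= dn]; move: mn; rewrite -dm -dn eqxx.
have Ifin : leb (digits_in (fun i => B i.+1) N) \is a fin_num.
  rewrite ge0_fin_numE ?measure_ge0 //.
  apply: (@le_lt_trans _ _ (leb I)).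
    apply: le_measure; rewrite ?inE; [exact: measurable_digits_in | exact: measurable_itv | by move=> u []].
  by rewrite lebesgue_measure_itv /= lte_fin ltr01 oppr0 adde0 ltry.
have term n : leb (`[cumul n, cumul n.+1[%classic `&`
     [set u | digits_in (fun i => B i.+1) N ((u - cumul n) / q n)]) =
   ((fine (leb (digits_in (fun i => B i.+1) N)))%:E * (q n)%:E)%E.
  rewrite fineK // muleC.
  (* A digit of mass 0 has an empty interval; there the affine map would divide by zero. *)
  have [qn|qn] := eqVneq (q n) 0.
    by rewrite cumulS qn addr0 set_itvco0 // set0I measure0 mul0e.
  have qn0 : 0 < q n by rewrite lt0r qn q_ge0.
  rewrite -(lebesgue_affine (cumul n) qn0 (measurable_digits_in _ _)); congr (leb _).
  apply/seteqP; split=> [u []//|u Du] /=; split=> //.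
  have [Iu _] := Du; rewrite /= !in_itv /= cumulS; move: Iu; rewrite /= in_itv /=.
  rewrite ler_pdivlMr // ltr_pdivrMr // mul0r mul1r => /andP[h1 h2].
  by rewrite -subr_ge0 h1 /= -ltrBlDl.
rewrite (eq_eseriesr (g := fun n => ((fine (leb (digits_in (fun i => B i.+1) N)))%:E * (q n)%:E)%E)) //.
rewrite nneseries_esum; last by move=> n _; rewrite mule_ge0 // lee_fin // fine_ge0.
rewrite set_mem_set esumZl; last 2 first.
- by rewrite fine_ge0.
- by move=> n _; rewrite lee_fin.
  by rewrite fineK // IH big_ord_recl muleC.
by move=> n _; exact: term.
Qed.

End NestedIntervals.

Section UnitMass.
Context d (T : measurableType d) (R : realType).
Variables (m : {measure set T -> \bar R}) (m1 : m setT = 1%E).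

Definition unit_mass_measure of m setT = 1%E : set T -> \bar R := m.

HB.instance Definition _ := Measure.on (unit_mass_measure m1).
HB.instance Definition _ :=
  Measure_isProbability.Build _ _ _ (unit_mass_measure m1) m1.

End UnitMass.

Lemma probability_of_measure d (T : measurableType d) (R : realType)
    (m : {measure set T -> \bar R}) : m setT = 1%E ->
  exists P : probability T R, forall A, P A = m A.
Proof. by move=> m1; exists (unit_mass_measure m1). Qed.

Section Iid.
Variable R : realType.
Variable p : excursion -> R.
Hypothesis p_ge0 : forall e, 0 <= p e.
Hypothesis p_sum : (\esum_(e in [set: excursion]) (p e)%:E = 1)%E.

Local Notation RM := (measurableTypeR R).

(** Numbers that code no excursion get mass 0, so their decoding to [point] does not affect the
    law. *)
Let q (n : nat) : R := oapp p 0 (pickle_inv n : option excursion).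

Let dec (n : nat) : excursion := odflt point (pickle_inv n : option excursion).

Let q_ge0 n : 0 <= q n.
Proof. by rewrite /q; case: pickle_inv. Qed.

Let esum_q (B : set excursion) :
  (\esum_(n in [set n | B (dec n)]) (q n)%:E = \esum_(e in B) (p e)%:E)%E.
Proof.
have -> : (\esum_(n in [set n | B (dec n)]) (q n)%:E =
    \esum_(n in pickle @` B) (q n)%:E)%E.
  rewrite esum_mkcond [RHS]esum_mkcond; apply: eq_esum => n _.
  case: ifPn => [/set_mem h1|/negP h1]; case: ifPn => [/set_mem h2|/negP h2] //.
    move: h1 h2; rewrite /q /dec; case: (pickle_inv n) (@pickle_invK excursion n) => //= e en Be.
    move=> h; exfalso; apply: h; apply/mem_set; exists e => //.
    by move: Be; rewrite -en pickleK_inv.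
  by exfalso; apply: h1; apply/mem_set; case: h2 => e Be <-; rewrite /= /dec pickleK_inv.
rewrite esum_image; last by move=> x y _ _; apply: (pcan_inj (@pickleK_inv _)).
by apply: eq_esum => e _; rewrite /q pickleK_inv.
Qed.

Let q_sum : (\sum_(n <oo) (q n)%:E = 1)%E.
Proof.
rewrite nneseries_esumT; last by move=> n; rewrite lee_fin.
by rewrite -p_sum -esum_q; congr (esum _ _); apply/seteqP; split.
Qed.

(** The integer coordinates are enumerated by [pickle]: coordinate [i] is decoded from the digit of
    rank [pickle i]. *)
Let W (u : RM) : zprod excursion :=
  fun i => if 0 <= u < 1 then dec (digits q u (pickle i)) else point.

Local Notation I := (`[0, 1[%classic : set RM).

Let measurable_W : measurable_fun setT W.
Proof.
apply: measurable_fun_zprod => x B.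
rewrite (_ : [set u | B (W u x)] =
   digits_in q (fun j => if j == pickle x then [set n | B (dec n)] else setT) (pickle x).+1
   `|` (~` I `&` [set u | B point])).
  apply: measurableU; first exact: measurable_digits_in.
  apply: measurableI; first by apply: measurableC; exact: measurable_itv.
  by have [Bp|nBp] := pselect (B point);
    [rewrite (_ : [set _ | _] = setT) | rewrite (_ : [set _ | _] = set0)] => //;
    apply/seteqP; split.
apply/seteqP; split=> u /=; rewrite /W /digits_in /= in_itv /=.
  case: ifP => [Iu Bu|Iu Bp]; [left | by right; split=> //; rewrite Iu].
  by split=> // i _; case: eqP => // ->.
case=> [[-> h]|[/negP/negbTE -> //]].
by have := h _ (ltnSn _); rewrite eqxx.
Qed.

Lemma iid_exists : exists P : probability (zprod excursion) R, is_iid p P.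
Proof.
have mI : measurable I by exact: measurable_itv.
have [m mE] := pushforward_measure (mrestr (@lebesgue_measure R) mI) measurable_W.
have {}mE A : m A = lebesgue_measure (W @^-1` A `&` I) by rewrite mE.
have [|P PE] := @probability_of_measure _ _ _ m.
  by rewrite mE preimage_setT setTI lebesgue_measure_itv /= lte_fin ltr01 oppr0 adde0.
exists P => s B us; rewrite PE mE.
have [N NE] : exists N, N = (\max_(i <- s) pickle i).+1 by eexists.
(* A digit whose rank codes no index in [s] is unconstrained and contributes the total mass 1. *)
pose B' (j : nat) := [set n | forall i, i \in s -> pickle i = j -> B i (dec n)].
have -> : W @^-1` [set w | forall i, i \in s -> B i (w i)] `&` I = digits_in q B' N.
  apply/seteqP; split=> u; rewrite /digits_in /W /= in_itv /=.
    move=> [h Iu]; rewrite Iu in h *; split=> // j jN i si ij.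
    by have := h i si; rewrite ij.
  move=> [Iu h]; rewrite Iu; split=> // i si; apply: (h (pickle i)) => //.
  by rewrite NE ltnS; apply: leq_bigmax_seq.
rewrite lebesgue_digits_in //.
pose f j := (\esum_(n in B' j) (q n)%:E)%E.
have fs i : i \in s -> f (pickle i) = (\esum_(e in B i) (p e)%:E)%E.
  move=> si; rewrite -esum_q /f; congr (esum _ _); apply/seteqP; split=> n /=.
    by move=> /(_ i si erefl).
  by move=> h i' _ /(pcan_inj (@pickleK_inv _)) ->.
transitivity (\prod_(i <- s) f (pickle i))%E; last first.
  by apply: eq_big_seq => i si; exact: fs.
transitivity (\prod_(i < N) f i)%E; first by [].
rewrite -[LHS](big_mkord xpredT f) -[RHS](big_map pickle xpredT f).
rewrite [LHS](bigID (mem (map pickle s))) /=.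
rewrite [X in (_ * X)%E]big1 ?mule1 => [|j jns].
  rewrite -big_filter. apply: perm_big; apply: uniq_perm.
  - by rewrite filter_uniq // iota_uniq.
  - by rewrite map_inj_uniq //; exact: (pcan_inj (@pickleK_inv _)).
  - move=> j; rewrite mem_filter mem_index_iota /=; case: (boolP (j \in _)) => //=.
    move=> /mapP[i si ->]; rewrite NE ltnS; exact: leq_bigmax_seq.
rewrite /f -p_sum -esum_q; congr (esum _ _); apply/seteqP; split=> n //= _ i si ij.
by case/mapP: jns; exists i.
Qed.

End Iid.

Lemma esum_pickle (R : realType) (a : excursion -> \bar R) :
  (\esum_(n in [set: nat]) oapp a 0 (pickle_inv n : option excursion) =
   \esum_(e in [set: excursion]) a e)%E.
Proof.
transitivity (\esum_(n in pickle @` [set: excursion])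
    oapp a 0%E (pickle_inv n : option excursion))%E.
  rewrite [RHS]esum_mkcond; apply: eq_esum => n _.
  case: ifPn => // /negP h; case E : (pickle_inv n) => [e|//] /=.
  by exfalso; apply: h; apply/mem_set; exists e => //; have := @pickle_invK excursion n; rewrite E.
rewrite esum_image; last by move=> x y _ _; apply: (pcan_inj (@pickleK_inv _)).
by apply: eq_esum => e _; rewrite pickleK_inv.
Qed.

Section SetFunctionIntegral.
Import HBNNSimple.

(* The integral of [analysis] is defined for arbitrary set functions and only
   looks at their values on measurable sets. *)
Lemma eq_set_function_integral d (T : measurableType d) (R : realType)
    (m1 m2 : set T -> \bar R) (D : set T) (f : T -> \bar R) :
  (forall A, measurable A -> m1 A = m2 A) ->
  (\int[m1]_(x in D) f x = \int[m2]_(x in D) f x)%E.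
Proof.
move=> m12.
have E (h : {nnsfun T >-> R}) : sintegral m1 h = sintegral m2 h.
  by apply: eq_fsbigr => r _; rewrite m12.
rewrite /integral; congr (ereal_sup _ - ereal_sup _)%E; apply/seteqP;
  by split=> _ [h hf <-]; exists h.
Qed.

Lemma integral_of_pushforward d d' (T1 : measurableType d)
    (T2 : measurableType d') (R : realType) (m : {measure set T1 -> \bar R})
    (m' : set T2 -> \bar R) (phi : T1 -> T2) (F : T2 -> \bar R) :
  measurable_fun setT phi ->
  (forall A, measurable A -> m' A = m (phi @^-1` A)) ->
  measurable_fun setT F -> (forall x, 0 <= F x)%E ->
  (\int[m']_x F x = \int[m]_x F (phi x))%E.
Proof.
move=> mphi mE mF F0.
rewrite (@eq_set_function_integral _ _ _ m' (pushforward m phi)) //.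
by rewrite ge0_integral_pushforward.
Qed.

End SetFunctionIntegral.

(** * Integration against i.i.d. laws *)

Section IidLaws.
Variable R : realType.
Local Notation excs := (zprod excursion).
Implicit Types (p : excursion -> R) (P Q : probability excs R).

Lemma iid_lawP p : (forall e, 0 <= p e) ->
  (\esum_(e in [set: excursion]) (p e)%:E = 1)%E -> is_iid p (iid_law p).
Proof.
move=> p0 p1; have [P iP] := iid_exists p0 p1.
exact: (@xgetPex _ _ [set P : probability excs R | is_iid p P] (ex_intro _ P iP)).
Qed.

Lemma iid_marginal p P (B : set excursion) i : is_iid p P ->
  P [set w | B (w i)] = (\esum_(e in B) (p e)%:E)%E.
Proof.
move=> iP; have := iP [:: i] (fun=> B) isT; rewrite big_seq1 => <-.
congr (P _); apply/seteqP; split=> w /=; first by move=> h j; rewrite inE => /eqP ->.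
by apply; rewrite inE.
Qed.

Lemma measurable_fun_coord d (Y : measurableType d) (i : int) (G : excursion -> Y) :
  measurable_fun setT (fun w : excs => G (w i)).
Proof.
by move=> _ B mB; rewrite setTI; exact: (measurable_coord i (G @^-1` B)).
Qed.

Lemma integral_coord p P (G : excursion -> \bar R) i : is_iid p P ->
  (forall e, 0 <= p e) -> (forall e, 0 <= G e)%E ->
  (\int[P]_w G (w i) = \esum_(e in [set: excursion]) ((p e)%:E * G e))%E.
Proof.
move=> iP p0 G0.
pose F (n : nat) : set excs := [set w | pickle (w i) = n].
have mF n : measurable (F n).
  by have := measurable_coord i [set e : excursion | pickle e = n].
have FT : \bigcup_n F n = setT by apply/seteqP; split=> // w _; exists (pickle (w i)).
rewrite -FT ge0_integral_bigcup //; last 2 first.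
- by rewrite FT; exact: measurable_fun_coord.
- apply/trivIsetP => m n _ _ mn; apply/seteqP; split=> // w [/= h1 h2].
  by move: mn; rewrite -h1 -h2 eqxx.
rewrite nneseries_esumT; last by move=> n; exact: integral_ge0.
rewrite -(esum_pickle (fun e => (p e)%:E * G e)%E); apply: eq_esum => n _.
case E : (pickle_inv n : option excursion) => [e|] /=; last first.
  rewrite (_ : F n = set0) ?integral_set0 //; apply/seteqP; split=> // w /= wn.
  by move: E; rewrite -wn pickleK_inv.
have Fe w : F n w -> w i = e.
  by rewrite /F /= => wn; move: E; rewrite -wn pickleK_inv => -[].
rewrite (eq_integral (fun=> G e)) => [|w /set_mem /Fe -> //].
rewrite integral_cst // muleC; congr (_ * _)%E.
rewrite -(@esum_set1 _ _ e (fun e => (p e)%:E)) ?lee_fin // -(iid_marginal _ i iP).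
by congr (P _); apply/seteqP; split=> w /=; [exact: Fe | rewrite /F /= => ->; have := @pickle_invK excursion n; rewrite E].
Qed.

Definition replace0 (w : excs) (e : excursion) : excs := fun i => if i == 0 then e else w i.

Lemma measurable_replace0 :
  measurable_fun setT ((fun z => replace0 z.2 (z.1 0)) : excs * excs -> excs).
Proof.
apply: measurable_fun_zprod => x B; rewrite /replace0.
case: (x == 0).
  have /(_ measurableT) := @measurable_fst _ _ excs excs.
  by move=> /(_ _ (measurable_coord 0 B)); rewrite setTI.
have /(_ measurableT) := @measurable_snd _ _ excs excs.
by move=> /(_ _ (measurable_coord x B)); rewrite setTI.
Qed.

Lemma measurable_replace0l e : measurable_fun setT (replace0^~ e).
Proof.
apply: measurable_fun_zprod => x B; rewrite /replace0; case: (x == 0).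
  by have [Bp|nBp] := pselect (B e);
    [rewrite (_ : [set _ | _] = setT) | rewrite (_ : [set _ | _] = set0)] => //;
    apply/seteqP; split.
exact: measurable_coord.
Qed.

(** Boxes form a generating family closed under intersection, so agreement on them identifies [Q]
    with the image measure. Resampling, shifting and skipping are all treated this way. *)
Lemma integral_map_boxes d (T : measurableType d) (m : {measure set T -> \bar R})
    (h : T -> excs) Q (F : excs -> \bar R) : measurable_fun setT h ->
  measurable_fun setT F -> (forall w, 0 <= F w)%E ->
  (forall (s : seq int) (B : int -> set excursion), uniq s ->
     Q [set w | forall i, i \in s -> B i (w i)] =
     m (h @^-1` [set w | forall i, i \in s -> B i (w i)])) ->
  (\int[m]_x F (h x) = \int[Q]_w F w)%E.
Proof.
move=> mh mF F0 mE; have [m' m'E] := pushforward_measure m mh.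
transitivity (\int[m']_w F w)%E.
  by apply/esym/(integral_of_pushforward mh) => // A _; exact: m'E.
apply: eq_measure_integral => A mA _; apply/esym; move: A mA.
apply: zprod_measure_unique; last by move=> s B us; rewrite m'E; exact: mE.
exact: (le_lt_trans (probability_le1 Q measurableT) (ltry _)).
Qed.

(* Resampling the coordinate 0 does not change the law. *)
Lemma integral_replace0 p P (F : excs -> \bar R) : is_iid p P ->
  (forall e, 0 <= p e) -> measurable_fun setT F -> (forall w, 0 <= F w)%E ->
  (\int[P]_w F w = \esum_(e in [set: excursion])
     ((p e)%:E * \int[P]_w F (replace0 w e)))%E.
Proof.
move=> iP p0 mF F0.
rewrite -(integral_map_boxes (m := (P \x P)%E) measurable_replace0 mF F0); last first.
  move=> s B us; rewrite /= iP //.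
  pose s1 := [seq i <- s | i == 0]; pose s2 := [seq i <- s | i != 0].
  rewrite (_ : _ @^-1` _ = [set w | forall i, i \in s1 -> B i (w i)] `*`
                           [set w | forall i, i \in s2 -> B i (w i)]); last first.
    apply/seteqP; split=> -[w w'] /=; rewrite /replace0.
      move=> h; split=> i; rewrite mem_filter => /andP[i0 si]; have := h i si.
        by rewrite i0; move/eqP: i0 => ->.
      by rewrite (negPf i0).
    move=> [h1 h2] i si; case: ifP => i0.
      by have := h1 i; rewrite mem_filter i0 si => /(_ isT); rewrite (eqP i0).
    by apply: h2; rewrite mem_filter i0 si.
  apply: etrans (esym (product_measure1E _ _ (measurable_box _ _) (measurable_box _ _))).
  rewrite /= !iP ?filter_uniq //.
  by rewrite [LHS](bigID (fun i => i == 0)) /= !big_filter.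
rewrite fubini_tonelli1 //; last exact: measurableT_comp mF measurable_replace0.
rewrite -(integral_coord 0%R iP) //; last by move=> e; exact: integral_ge0.
Qed.

Definition shift (w : excs) : excs := fun i => w (i - 1).

Lemma measurable_shift : measurable_fun setT shift.
Proof. by apply: measurable_fun_zprod => x B; exact: measurable_coord. Qed.

Lemma integral_shift p P (F : excs -> \bar R) : is_iid p P ->
  measurable_fun setT F -> (forall w, 0 <= F w)%E ->
  (\int[P]_w F (shift w) = \int[P]_w F w)%E.
Proof.
move=> iP mF F0.
apply: (integral_map_boxes measurable_shift) => // s B us.
rewrite (_ : _ @^-1` _ = [set w | forall i, i \in [seq i - 1 | i <- s] -> B (i + 1) (w i)]).
  have us' : uniq [seq i - 1 | i <- s] by rewrite map_inj_uniq //; exact: addIr.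
  apply: etrans (iP s B us) _; apply: etrans _ (esym (iP _ (fun i => B (i + 1)) us')).
  by rewrite big_map; apply: eq_bigr => i _; rewrite subrK.
apply/seteqP; split=> w /= h.
  by move=> _ /mapP[i si ->]; rewrite subrK; exact: h.
by move=> i si; have := h (i - 1) (map_f _ si); rewrite subrK.
Qed.

Lemma measurable_map_coord (g : excursion -> excursion) :
  measurable_fun setT ((fun w => (fun i => g (w i))) : excs -> excs).
Proof. by apply: measurable_fun_zprod => x B; exact: (measurable_coord x (g @^-1` B)). Qed.

Lemma esum_nu_psi_iter_set k alpha (B : set excursion) : summable_weights alpha ->
  (\esum_(e in [set e | B (iter k psi e)]) (nu alpha e)%:E =
   \esum_(e in B) (nu (iter k (@theta R) alpha) e)%:E)%E.
Proof.
move=> sw; rewrite esum_mkcond [RHS]esum_mkcond.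
transitivity (\esum_(e in [set: excursion]) (nu alpha e * \1_B (iter k psi e))%:E)%E.
  apply: eq_esum => e _; rewrite indicE.
  rewrite (_ : (e \in [set e | B (iter k psi e)]) = (iter k psi e \in B)) ?in_setE; last first.
    by apply/idP/idP => /set_mem /mem_set.
  by case: (_ \in B); rewrite ?mulr1 ?mulr0.
rewrite esum_nu_psi_iter //.
by apply: eq_esum => e _; rewrite indicE; case: (_ \in B); rewrite ?mulr1 ?mulr0.
Qed.

Lemma integral_psi_iter k alpha P Q (F : excs -> \bar R) : summable_weights alpha ->
  is_iid (nu alpha) P -> is_iid (nu (iter k (@theta R) alpha)) Q ->
  measurable_fun setT F -> (forall w, 0 <= F w)%E ->
  (\int[P]_w F (psi_iter k w) = \int[Q]_w F w)%E.
Proof.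
move=> sw iP iQ mF F0.
apply: (integral_map_boxes (measurable_map_coord (iter k psi))) => // s B us.
apply: etrans (iQ s B us) _.
apply: etrans _ (esym (iP s (fun i => [set e | B i (iter k psi e)]) us)).
by apply: eq_bigr => i _; rewrite esum_nu_psi_iter_set.
Qed.

End IidLaws.

(** * Density of ones *)

Section LargeNumbers.
Variable R : realType.
Local Notation excs := (zprod excursion).
Variables (p : excursion -> R) (P : probability excs R).
Hypothesis (iP : is_iid p P) (p_ge0 : forall e, 0 <= p e).

Definition pmean (U : excursion -> R) : \bar R :=
  \esum_(e in [set: excursion]) (p e * U e)%:E.

Lemma integral_coord_pmean (F : excursion -> R) i : (forall e, 0 <= F e) ->
  (\int[P]_w (F (w i))%:E = pmean F)%E.
Proof.
move=> F0; rewrite -[LHS]/(\int[P]_w ((EFin \o F) (w i)))%E.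
by rewrite (integral_coord _ iP).
Qed.

Section Drift.
Variables U V : excursion -> R.
Hypotheses (U0 : forall e, 0 <= U e) (V0 : forall e, 0 <= V e).

(** The walk runs to the left, as does the average in [Omega]. The increment is split as [U - V]
    with both parts nonnegative, so that only nonnegative functions are integrated. *)
Definition walk (n : nat) (w : excs) : R :=
  \sum_(j < n) (U (w (- j%:Z)) - V (w (- j%:Z))).

Definition walk_unbounded : set excs :=
  [set w | forall K : nat, exists n, K%:R < walk n w].

(* The running maximum of [walk 0], ..., [walk n]. *)
Fixpoint walk_max (n : nat) (w : excs) : R :=
  if n is n'.+1 then Num.max 0 (U (w 0) - V (w 0) + walk_max n' (shift w)) else 0.

Lemma walkS n w : walk n.+1 w = U (w 0) - V (w 0) + walk n (shift w).
Proof.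
rewrite /walk big_ord_recl /= oppr0; congr (_ + _); apply: eq_bigr => j _.
by rewrite /bump /= /shift; congr (U (w _) - V (w _)); lia.
Qed.

Lemma walk_max_ge0 n w : 0 <= walk_max n w.
Proof. by case: n => //= n; rewrite le_max lexx. Qed.

Lemma walk_le_max n w : walk n w <= walk_max n w.
Proof.
elim: n w => [|n IH] w; first by rewrite /walk big_ord0.
by rewrite walkS /= le_max lerD2l IH orbT.
Qed.

Lemma walk_maxS n w : walk_max n w <= walk_max n.+1 w.
Proof.
elim: n w => [|n IH] w; first exact: walk_max_ge0.
rewrite /=; move: (IH (shift w)) => /= h.
by rewrite ge_max !le_max lexx /= lerD2l h orbT.
Qed.

Lemma walk_max_le n w : walk_max n w <= \sum_(j < n) U (w (- j%:Z)).
Proof.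
elim: n w => [|n IH] w /=; first by rewrite big_ord0.
rewrite big_ord_recl /= oppr0 ge_max; apply/andP; split.
  by rewrite addr_ge0 // sumr_ge0.
apply: lerD; first by rewrite gerBl.
apply: le_trans (IH _) _; apply: ler_sum => j _.
by rewrite /shift /bump /=; have -> : - j%:Z - 1 = - (1 + j)%N%:Z by lia.
Qed.

(** A positive maximum is attained after the first step, and the rest of the path is a path of the
    shifted sequence. *)
Lemma walk_max_step n w : 0 < walk_max n w ->
  V (w 0) + walk_max n w <= U (w 0) + walk_max n (shift w).
Proof.
case: n => [|n] /=; first by rewrite ltxx.
move=> h; have -> : Num.max 0 (U (w 0) - V (w 0) + walk_max n (shift w)) =
    U (w 0) - V (w 0) + walk_max n (shift w).
  by apply/max_idPr; rewrite leNgt; apply/negP => /ltW /max_idPl e; rewrite e ltxx in h.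
by have := walk_maxS n (shift w) => /= h'; lra.
Qed.

Lemma measurable_walk n : measurable_fun setT (walk n).
Proof.
apply: measurable_sum => j; apply: measurable_funB.
  exact: (@measurable_fun_coord _ _ (- j%:Z) U).
exact: (@measurable_fun_coord _ _ (- j%:Z) V).
Qed.

Lemma measurable_walk_max n : measurable_fun setT (walk_max n).
Proof.
elim: n => [|n IH] /=; first exact: measurable_cst.
apply: measurable_maxr => //; apply: measurable_funD.
  apply: measurable_funB; first exact: (@measurable_fun_coord _ _ 0 U).
  exact: (@measurable_fun_coord _ _ 0 V).
exact: measurableT_comp IH measurable_shift.
Qed.

Lemma measurable_walk_unbounded : measurable walk_unbounded.
Proof.
have -> : walk_unbounded = \bigcap_(K : nat) \bigcup_n [set w | K%:R < walk n w].
  apply/seteqP; split=> w h K; first by move=> _; have [n] := h K; exists n.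
  by have [n _ hn] := h K I; exists n.
apply: bigcap_measurableType => K _; apply: bigcupT_measurable => n.
have := measurable_walk n measurableT (measurable_itv `]K%:R, +oo[).
rewrite setTI; congr measurable; apply/seteqP; split=> w; rewrite /= in_itv /= andbT //.
Qed.

Lemma walk_unbounded_of_close (w w' : excs) (C : R) :
  (forall n, exists m, walk n w - C <= walk m w') ->
  walk_unbounded w -> walk_unbounded w'.
Proof.
move=> h uw K.
have [n hn] := uw (K + Num.bound `|C|)%N.
have [m hm] := h n; exists m; apply: lt_le_trans hm.
rewrite ltrBrDr; apply: le_lt_trans hn; rewrite natrD lerD2l.
apply: le_trans (ler_norm _) _; rewrite ltW //; exact: archi_boundP.
Qed.

Lemma walk_unbounded_shift w : walk_unbounded (shift w) <-> walk_unbounded w.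
Proof.
split.
  apply: (@walk_unbounded_of_close _ _ (- (U (w 0) - V (w 0)))) => n; exists n.+1.
  by rewrite walkS opprK addrC.
apply: (@walk_unbounded_of_close _ _ `|U (w 0) - V (w 0)|) => -[|n].
  by exists 0%N; rewrite /walk !big_ord0 sub0r oppr_le0.
exists n; rewrite walkS; have := ler_norm (U (w 0) - V (w 0)); lra.
Qed.

Lemma walk_unbounded_replace0 w e : walk_unbounded (replace0 w e) <-> walk_unbounded w.
Proof.
have H w' e' : walk_unbounded w' -> walk_unbounded (replace0 w' e').
  apply: (@walk_unbounded_of_close _ _
    (`|U (w' 0) - V (w' 0)| + `|U e' - V e'|)) => n; exists n.
  case: n => [|n].
    by rewrite /walk !big_ord0 sub0r oppr_le0 addr_ge0.
  rewrite /walk !big_ord_recl /= oppr0 {1 2}/replace0 eqxx.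
  rewrite (eq_bigr (fun j : 'I_n => U (replace0 w' e' (- (bump 0 j)%:Z)) -
     V (replace0 w' e' (- (bump 0 j)%:Z)))) => [|j _]; last first.
    by [].
  set S := \sum_(_ < _) _.
  have := ler_norm (U (w' 0) - V (w' 0)); have := ler_norm (- (U e' - V e')).
  rewrite normrN; lra.
split; last exact: H.
move=> /(H _ (w 0)); congr walk_unbounded; apply/funext => i.
by rewrite /replace0; case: eqVneq => [->|].
Qed.

Lemma measurable_EFin_mul (f g : excs -> R) : measurable_fun setT f ->
  measurable_fun setT g -> measurable_fun setT (fun w => (f w * g w)%:E).
Proof. by move=> mf mg; apply/measurable_EFinP; exact: measurable_funM. Qed.

(** The event is unchanged when coordinate 0 is replaced, so it is independent of [w 0]. *)
Lemma integral_coord_indic (F : excursion -> R) : (forall e, 0 <= F e) ->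
  (\int[P]_w (F (w 0) * \1_walk_unbounded w)%:E = pmean F * P walk_unbounded)%E.
Proof.
move=> F0; have mA := measurable_walk_unbounded.
rewrite (integral_replace0 iP) //; last 2 first.
- apply: measurable_EFin_mul => //; exact: (@measurable_fun_coord _ _ 0 F).
- by move=> w; rewrite lee_fin mulr_ge0.
have Pfin : P walk_unbounded \is a fin_num by exact: fin_num_measure.
rewrite -(fineK Pfin) muleC /pmean -esumZl ?fine_ge0 //; last first.
  by move=> e _; rewrite lee_fin mulr_ge0.
apply: eq_esum => e _.
rewrite (eq_integral (fun w => (F e)%:E * (\1_walk_unbounded w)%:E)%E) => [|w _]; last first.
  rewrite -EFinM; congr (_ * _)%:E; rewrite !indicE; congr ((nat_of_bool _)%:R).
  by apply/idP/idP => /set_mem/walk_unbounded_replace0/mem_set.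
rewrite ge0_integralZl_EFin // ?integral_indic ?setIT //; last first.
  by apply/measurable_EFinP.
transitivity ((p e)%:E * ((F e)%:E * (fine (P walk_unbounded))%:E))%E.
  by congr (_ * (_ * _))%E; rewrite fineK.
by rewrite -!EFinM; congr EFin; ring.
Qed.

(* Garsia's maximal inequality on the shift-invariant event
   [walk_unbounded], which moreover does not depend on the coordinate 0. *)
Lemma walk_unbounded_null : (pmean U < +oo)%E -> (pmean U < pmean V)%E ->
  P walk_unbounded = 0%E.
Proof.
move=> Ufin UV; have mA := measurable_walk_unbounded.
set A := walk_unbounded in mA *.
have mU : measurable_fun setT (fun w : excs => U (w 0)) by exact: (@measurable_fun_coord _ _ 0 U).
have mV : measurable_fun setT (fun w : excs => V (w 0)) by exact: (@measurable_fun_coord _ _ 0 V).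
have mM := measurable_walk_max.
have m1A : measurable_fun setT (\1_A : excs -> R) by [].
have shA w : \1_A (shift w) = \1_A w :> R.
  by rewrite !indicE; congr ((nat_of_bool _)%:R); apply/idP/idP => /set_mem h; apply/mem_set; exact/walk_unbounded_shift.
pose B n := A `&` [set w | 0 < walk_max n w].
have mB n : measurable (B n).
  apply: measurableI => //.
  have := measurable_walk_max n measurableT (measurable_itv `]0, +oo[).
  rewrite setTI.
  by congr measurable; apply/seteqP; split=> w; rewrite /= in_itv /= andbT.
have B_mono m n w : (m <= n)%N -> \1_(B m) w <= \1_(B n) w :> R.
  move=> mn; rewrite !indicE; case: (boolP (w \in B m)) => [/set_mem[wA h]|_ //].
  rewrite mem_set //; split=> //=; apply: lt_le_trans h _.
  rewrite -(subnKC mn); elim: (n - m)%N => [|k IH]; first by rewrite addn0.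
  by rewrite addnS; exact: le_trans IH (walk_maxS _ _).
(* [walk_max_step] is integrated over [A]: the maximum and its shift have the same finite integral
   there, as [A] is shift-invariant, and cancel. *)
have key n : (\int[P]_w (V (w 0%R) * \1_(B n) w)%:E <=
              \int[P]_w (U (w 0%R) * \1_A w)%:E)%E.
  pose c := (\int[P]_w (walk_max n w * \1_A w)%:E)%E.
  have mc : measurable_fun setT (fun w => (walk_max n w * \1_A w)%:E).
    exact: measurable_EFin_mul.
  have c0 w : (0 <= (walk_max n w * \1_A w)%:E)%E by rewrite lee_fin mulr_ge0 // walk_max_ge0.
  have cfin : c \is a fin_num.
    rewrite ge0_fin_numE; last exact: integral_ge0.
    have mUj j : measurable_fun setT (fun w : excs => (U (w (- j%:Z)%R))%:E).
      by apply/measurable_EFinP; exact: (@measurable_fun_coord _ _ (- j%:Z) U).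
    apply: (@le_lt_trans _ _ (\int[P]_w (\sum_(j < n) (U (w (- j%:Z)%R))%:E))%E).
      apply: ge0_le_integral => //.
      - by apply: emeasurable_sum => j; exact: mUj.
      - move=> w _; rewrite sumEFin lee_fin; apply: le_trans (walk_max_le n w).
        by rewrite ler_piMr ?walk_max_ge0 // indicE; case: (_ \in _).
    rewrite ge0_integral_sum //; last by move=> j w _; rewrite lee_fin.
    apply: lte_sum_pinfty => j _.
    by rewrite integral_coord_pmean.
  have csh : c = (\int[P]_w (walk_max n (shift w) * \1_A w)%:E)%E.
    rewrite /c -(integral_shift iP mc c0); apply: eq_integral => w _.
    by rewrite shA.
  rewrite -(leeD2rE _ _ cfin) [in leRHS]csh /c -!ge0_integralD //.
  - apply: ge0_le_integral => //.
    + by move=> w _; rewrite adde_ge0 // lee_fin mulr_ge0.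
    + by apply: emeasurable_funD => //; exact: measurable_EFin_mul.
    + apply: emeasurable_funD => //; apply: measurable_EFin_mul => //.
      exact: measurableT_comp (mM n) measurable_shift.
    + move=> w _; rewrite -!EFinD lee_fin !indicE /B in_setI.
      case: (boolP (w \in A)) => /= wA; last by rewrite !mulr0.
      rewrite !mulr1; have [h|h] := ltP 0 (walk_max n w).
        by rewrite mem_set //= mulr1; exact: walk_max_step.
      have -> : walk_max n w = 0 by apply/eqP; rewrite eq_le h walk_max_ge0.
      rewrite memNset /= => [|]; last by rewrite ltNge h.
      by rewrite mulr0 addr0 addr_ge0 // walk_max_ge0.
  - by move=> w _; rewrite lee_fin mulr_ge0.
  - exact: measurable_EFin_mul.
  - by move=> w _; rewrite lee_fin mulr_ge0 // walk_max_ge0.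
  - by apply: measurable_EFin_mul => //; exact: measurableT_comp (mM n) measurable_shift.
  - by move=> w _; rewrite lee_fin mulr_ge0.
  - exact: measurable_EFin_mul.
(* [B n] increases to [A], because an unbounded walk becomes positive. *)
have lim : (\int[P]_w (V (w 0%R) * \1_A w)%:E <=
            \int[P]_w (U (w 0%R) * \1_A w)%:E)%E.
  have -> : (\int[P]_w (V (w 0%R) * \1_A w)%:E =
      \int[P]_w (limn (fun n => (V (w 0%R) * \1_(B n) w)%:E)))%E.
    apply: eq_integral => w _; apply/esym/lim_near_cst => //.
    have [wA|wA] := pselect (A w); last first.
      by apply: nearW => n; rewrite !indicE !memNset // => -[].
    have [n0 hn0] := wA 0%N; exists n0 => // n /= n0n.
    rewrite !indicE !mem_set //; split=> //=.
    apply: lt_le_trans hn0 _; apply: le_trans (walk_le_max _ _) _.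
    elim: n n0n => [|n IH]; first by rewrite leqn0 => /eqP ->.
    by rewrite leq_eqVlt => /orP[/eqP ->//|/IH h]; exact: le_trans h (walk_maxS _ _).
  rewrite monotone_convergence //.
  - apply: lime_le; last by apply: nearW => n; exact: key.
    apply: ereal_nondecreasing_is_cvgn => m n mn; apply: ge0_le_integral => //.
    + by move=> w _; rewrite lee_fin mulr_ge0.
    + exact: measurable_EFin_mul.
    + exact: measurable_EFin_mul.
    + by move=> w _; rewrite lee_fin ler_wpM2l // B_mono.
  - by move=> n; exact: measurable_EFin_mul.
  - by move=> n w _; rewrite lee_fin mulr_ge0.
  - by move=> w _ m n mn; rewrite lee_fin ler_wpM2l // B_mono.
(* By independence both sides carry the factor [P A]; were it positive, it would cancel and
   contradict the strict inequality of the means. *)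
move: lim; rewrite !integral_coord_indic // -/A.
have PA : P A \is a fin_num by exact: fin_num_measure.
apply: contra_leP => /eqP PA0.
rewrite lte_pmul2r //.
by rewrite lt0e PA0 measure_ge0.
Qed.

End Drift.
End LargeNumbers.

(** * From the growth of lengths to the density of ones *)

Section Density.
Variable R : realType.
Implicit Types w : zprod excursion.

Definition density (eta : int -> bool) (x : nat) : R :=
  x%:R^-1 * (zsum (- x%:Z) 0 (fun y => b2z (eta y)))%:~R.

Lemma zsum_tau_concat w (y x : nat) :
  2 * zsum (- x%:Z) 0 (fun v => b2z (tau y%:Z (concat_exc w) v)) =
  height w y - height w (y%:Z - x%:Z - 1) + x%:Z + 1.
Proof.
rewrite /zsum mulr_sumr -/(zsum (- x%:Z) 0 (fun v => 2 * b2z (tau y%:Z (concat_exc w) v))).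
rewrite (@zsum_telescope _ (fun v => height w (v + y) + v)); [|lia|].
  have -> : - x%:Z - 1 + y = y%:Z - x%:Z - 1 by lia.
  by rewrite add0r; lia.
move=> v; have := heightB w (v + y); rewrite /step /tau.
have -> : v - 1 + y = v + y - 1 by lia.
lia.
Qed.

(** The excursion at the origin is included; distances are thus measured from the start of excursion
    1, at the site [elen (w 0)]. *)
Definition left_length w (n : nat) : nat := (\sum_(j < n) elen (w (- j%:Z)))%N.

Lemma exc_start_left w (n : nat) :
  exc_start w (1 - n%:Z) = (elen (w 0))%:Z - (left_length w n)%:Z.
Proof.
elim: n => [|n IH]; first by rewrite subr0 exc_start1 /left_length big_ord0 subr0.
rewrite /left_length big_ord_recr /=; have := exc_startS w (- n%:Z).
have -> : - n%:Z + 1 = 1 - n%:Z by lia.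
have -> : 1 - n.+1%:Z = - n%:Z by lia.
rewrite IH /left_length PoszD.
by move: (\sum_(_ < _) _)%N (elen (w (- n%:Z))) => S e; lia.
Qed.

Lemma height_le_step w x (n : nat) : height w (x + n%:Z) <= height w x + n%:Z.
Proof.
elim: n => [|n IH]; first by rewrite !addr0.
have := heightB w (x + n.+1%:Z).
have -> : x + n.+1%:Z - 1 = x + n%:Z by lia.
rewrite /step /b2z; case: concat_exc => /=; lia.
Qed.

(** The site lies in excursion [- m], whose start has height [m - 1]; the height exceeds this by at
    most the length of that excursion. *)
Lemma height_left_int w (z : int) : z < 0 -> exists m : nat,
  [/\ z < (elen (w 0))%:Z - (left_length w m)%:Z,
      (elen (w 0))%:Z - (left_length w m.+1)%:Z <= z,
      m%:Z - 1 <= height w z &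
      height w z <= m%:Z - 1 + ((left_length w m.+1)%:Z - (left_length w m)%:Z)].
Proof.
move=> z0.
have [i iz] := exc_index w z.
have i0 : i <= -1.
  rewrite leNgt; apply/negP => h; have : exc_start w 0 <= exc_start w i.
    by rewrite le_exc_start_mono; lia.
  rewrite exc_start0; lia.
have [m im] : exists m : nat, i = - m%:Z by exists `|i|%N; lia.
have hlo := height_ge iz.
have hhi := height_le_step w (exc_start w i) `|(z - exc_start w i)%R|%N.
rewrite height_start in hhi.
have {}hhi : height w z <= - (i + 1) + (z - exc_start w i).
  move: hhi; have -> : exc_start w i + `|(z - exc_start w i)%R|%N = z by lia.
  by lia.
have s1 : exc_start w i = (elen (w 0))%:Z - (left_length w m.+1)%:Z.
  by rewrite -exc_start_left; congr exc_start; lia.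
have s2 : exc_start w (i + 1) = (elen (w 0))%:Z - (left_length w m)%:Z.
  by rewrite -exc_start_left; congr exc_start; lia.
exists m; rewrite s1 s2 in iz; rewrite s1 in hhi.
move: iz hhi hlo => /andP[h1 h2] hhi hlo; rewrite im in hhi hlo.
split=> //; last move: hhi h2 => {h1 hlo s1 s2}; lia.
Qed.

Definition almost_linear (c1 c2 : R) w := exists K : R,
  forall n, c1 * n%:R - K <= (left_length w n)%:R <= c2 * n%:R + K.

(** At distance [x] the excursion number [m] is between [x / c2] and [x / c1] up to constants. The
    excursion reached has length at most [(c2 - c1) m] up to a constant, hence the factor
    [1 + c2 - c1]. *)
Lemma height_left_bounds (c1 c2 : R) w (y : nat) : 0 < c1 -> c1 <= c2 ->
  almost_linear c1 c2 w -> exists C : R, forall x : nat, (y <= x)%N ->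
  x%:R / c2 - C <= (height w (y%:Z - x%:Z - 1))%:~R <= x%:R * ((1 + c2 - c1) / c1) + C.
Proof.
move=> c10 c12 [K HK]; have c20 : 0 < c2 by exact: lt_le_trans c12.
have K0 : 0 <= K by have := HK 0%N; rewrite !mulr0 /left_length big_ord0 => /andP[]; lra.
pose e0 : R := (elen (w 0))%:R; have e00 : 0 <= e0 by [].
have y0 : 0 <= y%:R :> R by [].
exists ((y%:R + K) / c2 + 2 + ((1 + e0 + K) * ((1 + c2 - c1) / c1) + c2 + 2 * K)) => x yx.
set z := y%:Z - x%:Z - 1.
have z0 : z < 0 by lia.
have [m [f1 f2 f3 f4]] := height_left_int w z0.
have /andP[_ Sup] := HK m.+1; have /andP[Slo _] := HK m.
have castN (n : nat) : n%:R = n%:Z%:~R :> R by [].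
have r1 : x%:R <= y%:R - 1 - e0 + (left_length w m.+1)%:R.
  have g : x%:Z <= y%:Z - 1 - (elen (w 0))%:Z + (left_length w m.+1)%:Z.
    by move: f2; rewrite /z; clear; lia.
  by rewrite /e0 !castN -[1]/(1%:~R) -!intrB -intrD ler_int.
have r2 : y%:R - 1 - e0 + (left_length w m)%:R <= x%:R.
  have g : y%:Z - 1 - (elen (w 0))%:Z + (left_length w m)%:Z <= x%:Z.
    by move: f1; rewrite /z; clear; lia.
  by rewrite /e0 !castN -[1]/(1%:~R) -!intrB -intrD ler_int.
have r3 : m%:R - 1 <= (height w z)%:~R :> R.
  by rewrite castN -[1]/(1%:~R) -intrB ler_int.
have r4 : (height w z)%:~R <= m%:R - 1 + ((left_length w m.+1)%:R - (left_length w m)%:R) :> R.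
  by rewrite !castN -[1]/(1%:~R) -!intrB -intrD ler_int.
rewrite -natr1 in Sup.
set h := (height w z)%:~R in r3 r4 *; set S1 := (left_length w m.+1)%:R in r1 r4 Sup.
set S0 := (left_length w m)%:R in r2 r4 Slo.
have q0 : 0 <= (1 + c2 - c1) / c1 by rewrite divr_ge0 // ?ltW //; lra.
have m0 : 0 <= m%:R :> R by [].
have A0 : 0 <= (1 + e0 + K) * ((1 + c2 - c1) / c1) by rewrite mulr_ge0 //; lra.
have B0 : 0 <= (y%:R + K) / c2 by apply: divr_ge0; [lra | exact: ltW].
apply/andP; split.
  have : x%:R / c2 <= (y%:R + K) / c2 + (m%:R + 1).
    rewrite ler_pdivrMr // mulrDl divfK ?lt0r_neq0 //.
    lra.
  by lra.
have mle : m%:R <= (x%:R + (1 + e0 + K)) / c1 by rewrite ler_pdivlMr //; lra.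
have : m%:R * (1 + c2 - c1) <= (x%:R + (1 + e0 + K)) / c1 * (1 + c2 - c1).
  by rewrite ler_wpM2r //; lra.
have -> : (x%:R + (1 + e0 + K)) / c1 * (1 + c2 - c1) =
  x%:R * ((1 + c2 - c1) / c1) + (1 + e0 + K) * ((1 + c2 - c1) / c1) by ring.
by lra.
Qed.

(** Each excursion accounts for one unit of height, so at distance [x] the height is about [x / L],
    and it determines the number of ones through [zsum_tau_concat]. *)
Lemma density_cvg w (y : nat) (L : R) : 1 <= L ->
  (forall m : nat, almost_linear (L - m.+2%:R^-1) (L + m.+2%:R^-1) w) ->
  density (tau y%:Z (concat_exc w)) @ \oo --> ((1 - L^-1) / 2 : R).
Proof.
move=> L1 al; apply/cvgrPdist_le => e e0.
(* For [L >= 1] and [d <= 1/2] the upper slope [(1 + 2 d) / (L - d)] is at most [1 / L + 6 d], with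
   equality at [L = 1], [d = 1/2]. *)
have [m me] : exists m : nat, 6 * m.+2%:R^-1 <= e.
  exists (Num.bound (6 / e)); rewrite ler_pdivrMr // mulrC -ler_pdivrMr //.
  apply: (@le_trans _ _ (Num.bound (6 / e))%:R).
    by rewrite ltW //; apply: archi_boundP; rewrite divr_ge0 // ltW.
  by rewrite ler_nat; lia.
set d := m.+2%:R^-1 in me.
have d0 : 0 < d by rewrite invr_gt0.
have d2 : d <= 2^-1 by rewrite lef_pV2 ?posrE // ler_nat.
have [|//|C HC] := @height_left_bounds (L - d) (L + d) w y _ _ (al m); [lra|lra|].
pose D := `|C| + `|(height w y)%:~R| + 1.
have D0 : 0 <= D by rewrite !addr_ge0.
near=> x.
have x0 : 0 < x%:R :> R by rewrite ltr0n; near: x; exists 1%N.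
have yx : (y <= x)%N by near: x; exists y.
have xD : D / e <= x%:R.
  near: x; exists (Num.bound (D / e)) => // n /= hn.
  apply: (@le_trans _ _ (Num.bound (D / e))%:R); last by rewrite ler_nat.
  by rewrite ltW //; apply: archi_boundP; rewrite divr_ge0 // ltW.
have {}HC := HC x yx.
have Z := congr1 (fun t : int => t%:~R : R) (zsum_tau_concat w y x).
move: Z HC; rewrite /= intrM !intrD intrN.
rewrite /density.
set Zs := (zsum _ _ _)%:~R; set hy := (height w y)%:~R.
set hx := (height w _)%:~R => Z /andP[h1 h2].
have lo : x%:R * (L^-1 - d) <= x%:R / (L + d).
  rewrite ler_pM2l // -subr_ge0.
  have -> : (L + d)^-1 - (L^-1 - d) = (d * (L * L + L * d - 1)) / (L * (L + d)).
    by field; rewrite !lt0r_neq0 //; lra.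
  by rewrite divr_ge0 ?mulr_ge0 //; nra.
have hi : x%:R * ((1 + (L + d) - (L - d)) / (L - d)) <= x%:R * (L^-1 + 6 * d).
  rewrite ler_pM2l // -subr_ge0.
  have -> : L^-1 + 6 * d - (1 + (L + d) - (L - d)) / (L - d) =
     d * (6 * L * (L - d) - 1 - 2 * L) / (L * (L - d)).
    by field; rewrite !lt0r_neq0 //; lra.
  by rewrite divr_ge0 ?mulr_ge0 //; nra.
have xe : D <= e * x%:R by rewrite mulrC -ler_pdivrMr.
have xd : 6 * d * x%:R <= e * x%:R by rewrite ler_pM2r.
have := ler_norm C; have := ler_norm hy; have := ler_norm (- hy); rewrite normrN => n1 n2 n3.
have Zx : Zs = (hy - hx + x%:R + 1) / 2 by lra.
have XE : x%:R * ((1 - L^-1) / 2 - x%:R^-1 * ((hy - hx + x%:R + 1) / 2)) =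
    (hx - x%:R * L^-1) / 2 - (hy + 1) / 2.
  by field; rewrite !lt0r_neq0 //; lra.
have dx : 0 <= d * x%:R by rewrite mulr_ge0 // ltW.
rewrite /D -/hy in xe; rewrite Zx ler_norml; apply/andP; split.
  by rewrite -(ler_pM2l x0) XE; clear - lo h1 xe xd n1 n2 n3 dx; lra.
by rewrite -(ler_pM2l x0) XE; clear - hi h2 xe xd n1 n2 n3 dx; lra.
Unshelve. all: by end_near. Qed.

End Density.

(** * Decoding a configuration into excursions *)

Section Decode.
Implicit Types (w : int -> excursion) (eta : int -> bool).

Definition unbounded_records eta : Prop := forall n : nat,
  (exists m : nat, is_record eta (n%:Z + m%:Z)) /\
  (exists m : nat, is_record eta (- n%:Z - m%:Z)).

Lemma unbounded_records_tau w (y : nat) :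
  unbounded_records (tau y%:Z (concat_exc w)).
Proof.
move=> n; split.
  exists `|(exc_start w (n%:Z + y%:Z) - y%:Z - n%:Z)%R|%N.
  apply/record_tau_concat; exists (n%:Z + y%:Z).
  have := @le_exc_start w 0 (n%:Z + y%:Z); rewrite exc_start0; lia.
exists `|(exc_start w (- n%:Z) - y%:Z + n%:Z)%R|%N.
apply/record_tau_concat; exists (- n%:Z).
have := @le_exc_start w (- n%:Z) 0; rewrite exc_start0; lia.
Qed.

Lemma next_record_exists eta x : unbounded_records eta ->
  exists r, [/\ is_record eta r, x < r & forall r', is_record eta r' -> x < r' -> r <= r'].
Proof.
move=> un; have [[m hm] _] := un `|x|.+1%N.
have ex : exists n : nat, `[< is_record eta (x + 1 + n%:Z) >].
  exists `|(`|x|.+1%N%:Z + m%:Z - x - 1)%R|%N; apply/asboolP.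
  by have -> : x + 1 + `|(`|x|.+1%N%:Z + m%:Z - x - 1)%R|%N = `|x|.+1%N%:Z + m%:Z by lia.
case: (ex_minnP ex) => n /asboolP rn nmin; exists (x + 1 + n%:Z); split=> //; first by lia.
move=> r' rr' xr'; have := nmin `|(r' - x - 1)%R|%N.
have -> : x + 1 + `|(r' - x - 1)%R|%N = r' by lia.
by move=> /(_ (asboolT rr')); lia.
Qed.

Lemma prev_record_exists eta x : unbounded_records eta ->
  exists r, [/\ is_record eta r, r < x & forall r', is_record eta r' -> r' < x -> r' <= r].
Proof.
move=> un; have [_ [m hm]] := un `|x|.+1%N.
have ex : exists n : nat, `[< is_record eta (x - 1 - n%:Z) >].
  exists `|(x - 1 + `|x|.+1%N%:Z + m%:Z)%R|%N; apply/asboolP.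
  by have -> : x - 1 - `|(x - 1 + `|x|.+1%N%:Z + m%:Z)%R|%N%:Z = - `|x|.+1%N%:Z - m%:Z by lia.
case: (ex_minnP ex) => n /asboolP rn nmin; exists (x - 1 - n%:Z); split=> //; first by lia.
move=> r' rr' xr'; have := nmin `|(x - 1 - r')%R|%N.
have -> : x - 1 - `|(x - 1 - r')%R|%N%:Z = r' by lia.
by move=> /(_ (asboolT rr')); lia.
Qed.

Lemma record_false eta x : is_record eta x -> eta x = false.
Proof.
move=> /is_record_height/(_ (x - 1)); have := conf_heightB eta x.
by rewrite /step; case: (eta x); rewrite /b2z //=; lia.
Qed.

Definition conf_word eta (a b : int) : seq bool :=
  mkseq (fun j => eta (a + j%:Z)) `|(b - a)%R|%N.

(* A first site below the height of a record is again a record. *)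
Lemma height_ge_record eta a b : is_record eta a ->
  (forall r, is_record eta r -> a < r -> b <= r) ->
  forall x, a <= x < b -> conf_height eta a <= conf_height eta x.
Proof.
move=> /is_record_height ra bmin x axb; have -> : x = a + `|(x - a)%R|%N by lia.
have : (`|(x - a)%R| < `|(b - a)%R|)%N by lia.
move: `|(x - a)%R|%N => n; elim/ltn_ind: n => n IH nb.
rewrite leNgt; apply/negP => hn.
have n0 : (0 < n)%N by case: (n) hn => //; rewrite addr0 ltxx.
suff rn : is_record eta (a + n%:Z) by have := bmin _ rn; lia.
apply/is_record_height => z zn; have [za|za] := ltP z a.
  by have := ra z za; lia.
have := IH `|(z - a)%R|%N; have -> : a + `|(z - a)%R|%N = z by lia.
by move=> h; apply: lt_le_trans hn _; apply: h; lia.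
Qed.

Lemma psum_conf_word eta a (n m : nat) : (m <= n)%N ->
  psum (take m (mkseq (fun j => eta (a + 1 + j%:Z)) n)) =
  conf_height eta (a + m%:Z) - conf_height eta a.
Proof.
elim: m => [|m IH] mn; first by rewrite take0 /psum big_nil addr0 subrr.
rewrite (take_nth false) ?size_mkseq // -cats1 /psum big_cat big_seq1 -/(psum _).
rewrite IH ?(ltnW mn) // nth_mkseq //.
have := conf_heightB eta (a + m.+1%:Z).
have -> : a + m.+1%:Z - 1 = a + m%:Z by lia.
have -> : a + m.+1%:Z = a + 1 + m%:Z by lia.
by move=> <- /=; lia.
Qed.

Lemma conf_word_excursion eta a b : is_record eta a -> is_record eta b ->
  a < b -> (forall r, is_record eta r -> a < r -> b <= r) ->
  is_excursion (conf_word eta a b).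
Proof.
move=> ra rb ab bmin.
have [n nE] : exists n : nat, b = a + 1 + n%:Z by exists `|(b - a - 1)%R|%N; lia.
have -> : conf_word eta a b = false :: mkseq (fun j => eta (a + 1 + j%:Z)) n.
  rewrite /conf_word nE; have -> : `|(a + 1 + n%:Z - a)%R|%N = n.+1 by lia.
  rewrite /mkseq /= addr0 record_false //; congr (_ :: _).
  rewrite -[1%N]addn0 iotaDl -map_comp; apply: eq_map => j /=.
  by congr eta; rewrite add1n; lia.
rewrite is_excursion_cons /=; apply/passage_rcons.
have H x := height_ge_record ra bmin (x := x).
split.
  move=> m; rewrite size_mkseq => mn; have mn' := ltnW mn.
  rewrite add0r (psum_conf_word _ _ mn').
  have Ha : a <= a + m%:Z < b by lia.
  by have := H _ Ha; rewrite subr_ge0.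
have psE : psum (mkseq (fun j => eta (a + 1 + j%:Z)) n) =
    conf_height eta (a + n%:Z) - conf_height eta a.
  by rewrite -(psum_conf_word _ _ (leqnn n)) take_oversize // size_mkseq.
rewrite add0r psE.
have h1 := H (a + n%:Z).
have := conf_heightB eta b; rewrite record_false //.
have -> : b - 1 = a + n%:Z by lia.
move/is_record_height : rb => /(_ a ab).
by rewrite /step /b2z /=; lia.
Qed.

(** The configuration is cut at its successive records, and [y] is the distance from the last record
    at or before the origin. *)
Lemma decode_exists eta : unbounded_records eta ->
  exists (y : nat) w, (y < elen (w 0%R))%N /\ eta = tau y%:Z (concat_exc w).
Proof.
move=> un.
have [nxt nxtP] := choice (fun x => next_record_exists x un).
have [prv prvP] := choice (fun x => prev_record_exists x un).
(* The largest record below 1, that is, the largest one at most 0. *)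
pose r0 := prv 1; have [rr0 r01 r0max] := prvP 1.
pose r (i : int) := match i with
  | Posz n => iter n nxt r0 | Negz n => iter n.+1 prv r0 end.
have rr i : is_record eta (r i).
  case: i => n; last by rewrite /r iterS; have [] := prvP (iter n prv r0).
  case: n => [//|n]; rewrite /r iterS; by have [] := nxtP (iter n nxt r0).
have nxtK a : is_record eta a -> nxt (prv a) = a.
  move=> ra; have [h1 h2 h3] := prvP a; have [h4 h5 h6] := nxtP (prv a).
  apply/eqP; rewrite eq_le h6 //= leNgt; apply/negP => h7.
  by have := h3 _ h4 h7; lia.
have rS i : r (i + 1) = nxt (r i).
  case: i => n; first by have -> : Posz n + 1 = Posz n.+1 by lia.
  case: n => [|n]; first by rewrite /r /= nxtK.
  have -> : Negz n.+1 + 1 = Negz n by lia.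
  have := rr (Negz n); rewrite /r [in RHS]iterS => rn.
  by rewrite nxtK.
have rlt i : r i < r (i + 1) by rewrite rS; have [] := nxtP (r i).
have rex i : is_excursion (conf_word eta (r i) (r (i + 1))).
  apply: conf_word_excursion => //.
  by move=> z rz iz; rewrite rS; have [_ _] := nxtP (r i); apply.
pose w i : excursion := Sub (conf_word eta (r i) (r (i + 1))) (rex i).
have lw i : (elen (w i))%:Z = r (i + 1) - r i.
  by rewrite /elen /= /conf_word size_mkseq; have := rlt i; lia.
have sw i : exc_start w i = r i - r0.
  elim/(@int_ind_from 0): i => [|i _ IH|i _ IH].
  - by rewrite exc_start0 /r /= subrr.
  - by rewrite exc_startS IH lw; lia.
  - have := exc_startS w (i - 1); rewrite subrK IH lw subrK; lia.
have r00 : r0 <= 0 by move: r01; rewrite -/r0; lia.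
exists `|r0|%N, w; split.
  have := lw 0; rewrite add0r.
  have : 0 < r 1.
    have [h1 h2 h3] := nxtP r0; have := r0max (r 1) (rr 1).
    by have := rlt 0; rewrite add0r /= -/r0; lia.
  have -> : r 0 = r0 by [].
  by lia.
apply/funext => x; rewrite /tau.
have [i [j [ji xE]]] := exc_pos w (x + `|r0|%N).
rewrite xE concat_at // /= /conf_word nth_mkseq; last first.
  by move: ji; rewrite /elen /= /conf_word size_mkseq.
by congr eta; move: xE; rewrite sw; lia.
Qed.

Definition decode eta : nat * (int -> excursion) :=
  xget (0%N, point) [set yw : nat * (int -> excursion) |
    (yw.1 < elen (yw.2 0%R))%N /\ eta = tau yw.1%:Z (concat_exc yw.2)].

(** The records give back the starts, hence [y] and the lengths, and then the letters. *)
Lemma tau_concat_inj w w' (y y' : nat) : (y < elen (w 0%R))%N ->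
  (y' < elen (w' 0%R))%N ->
  tau y%:Z (concat_exc w) = tau y'%:Z (concat_exc w') -> y = y' /\ w = w'.
Proof.
move=> yw yw' E.
have S i : exc_start w i - y%:Z = exc_start w' i - y'%:Z.
  by have := s_inf_tau i yw; rewrite E (s_inf_tau i yw') => -[].
have yy : y = y' by have := S 0; rewrite !exc_start0; lia.
subst y'; split=> //; apply/funext => i.
have S' j : exc_start w j = exc_start w' j by have := S j; lia.
have L : elen (w i) = elen (w' i).
  by have := exc_startS w i; rewrite !S' exc_startS; lia.
apply/val_inj/(@eq_from_nth _ false) => [//|j ji].
have ji' : (j < elen (w' i))%N by rewrite -L.
rewrite -(concat_at ji) -(concat_at ji') S'.
by have := congr1 (fun f => f (exc_start w' i + j%:Z - y%:Z)) E; rewrite /tau subrK.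
Qed.

Lemma decodeK w (y : nat) : (y < elen (w 0%R))%N ->
  decode (tau y%:Z (concat_exc w)) = (y, w).
Proof.
move=> yw; apply: xget_unique => //= -[y' w'] /= [yw' E].
by have [-> ->] := tau_concat_inj yw yw' E.
Qed.

End Decode.

(** * Measurability of the decoding *)

Section ConfMeasurability.
Local Notation excs := (zprod excursion).

Lemma nat_of_bool_inj : injective nat_of_bool. Proof. by case=> -[]. Qed.

Lemma pickle_inj : injective (@pickle excursion).
Proof. exact: (pcan_inj (@pickleK_inv _)). Qed.

Lemma zsum_local (V : zmodType) (F G : int -> V) (n : nat) a b :
  (`|a| <= n)%N -> (`|b| <= n)%N -> (forall v : int, (`|v| <= n)%N -> F v = G v) ->
  zsum a b F = zsum a b G.
Proof.
move=> an bn FG; have [ab|ba] := leP a b; last first.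
  by rewrite /zsum /zrange leNgt ba /= !big_nil.
have -> : b = a + `|(b - a)%R|.+1%N - 1 by lia.
rewrite !zsumE; apply: eq_bigr => j _; apply: FG; have := ltn_ord j; lia.
Qed.

Lemma measurable_conf_local (A : set conf) :
  (forall eta : conf, A eta -> exists n, forall eta' : conf, agree n eta eta' -> A eta') ->
  measurable A.
Proof. exact: (measurable_locally_determined nat_of_bool_inj). Qed.

Lemma measurable_record x : measurable [set eta : conf | is_record eta x].
Proof.
rewrite (_ : [set _ | _] = \bigcap_(n : nat)
  [set eta : conf | zsum (x - n%:Z) x (fun y => 2 * b2z (eta y) - 1) < 0]); last first.
  apply/seteqP; split=> eta h /=; first by move=> n _ /=; apply: h; lia.
  move=> z zx; have := h `|(x - z)%R|%N I.
  by rewrite /=; have -> : x - `|(x - z)%R|%N%:Z = z by lia.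
apply: bigcap_measurableType => n _; apply: measurable_conf_local => eta /= h.
exists (`|x| + n)%N => eta' ag.
rewrite (@zsum_local _ _ (fun y => 2 * b2z (eta y) - 1) (`|x| + n)) //; [lia|lia|].
by move=> v vn; rewrite ag.
Qed.

Definition decodable : set conf := [set eta | unbounded_records eta].

Lemma measurable_decodable : measurable decodable.
Proof.
rewrite (_ : decodable = \bigcap_(n : nat)
  ((\bigcup_(m : nat) [set eta : conf | is_record eta (n%:Z + m%:Z)]) `&`
   (\bigcup_(m : nat) [set eta : conf | is_record eta (- n%:Z - m%:Z)]))).
  apply: bigcap_measurableType => n _; apply: measurableI;
    apply: bigcupT_measurable => m; exact: measurable_record.
apply/seteqP; split=> eta h n.
  by move=> _; have [[m hm] [m' hm']] := h n; split; [exists m | exists m'].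
by have [[m _ hm] [m' _ hm']] := h n I; split; [exists m | exists m'].
Qed.

Lemma decodableP (eta : conf) : decodable eta ->
  exists (y : nat) (w : excs), (y < elen (w 0%R))%N /\ eta = tau y%:Z (concat_exc w).
Proof. exact: decode_exists. Qed.

Definition consecutive (a b : int) : set conf :=
  [set eta : conf | is_record eta a] `&` [set eta : conf | is_record eta b] `&`
  \bigcap_(n : nat) [set eta : conf | a < a + n%:Z < b -> ~ is_record eta (a + n%:Z)].

Lemma measurable_consecutive a b : measurable (consecutive a b).
Proof.
apply: measurableI; first by apply: measurableI; exact: measurable_record.
apply: bigcap_measurableType => n _; case: (boolP (a < a + n%:Z < b)) => h.
  rewrite (_ : [set _ | _] = ~` [set eta : conf | is_record eta (a + n%:Z)]).
    exact: measurableC (measurable_record _).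
  by apply/seteqP; split=> eta /=; [exact | move=> ? _].
by rewrite (_ : [set _ | _] = setT) //; apply/seteqP; split=> eta //= _ h'; case/negP: h.
Qed.

Lemma consecutive_tau (w : excs) (y : nat) a b : a < b ->
  consecutive a b (tau y%:Z (concat_exc w)) <->
  exists i, a = exc_start w i - y%:Z /\ b = exc_start w (i + 1) - y%:Z.
Proof.
move=> ab; split.
  move=> [[/record_tau_concat[i ia] /record_tau_concat[j jb]] h].
  exists i; split=> //.
  have ij : i < j by rewrite -(lt_exc_start w); lia.
  suff -> : i + 1 = j by [].
  apply/eqP; rewrite eq_le; apply/andP; split; first lia.
  rewrite leNgt; apply/negP => h2.
  have l1 : exc_start w i < exc_start w (i + 1) by rewrite lt_exc_start; lia.
  have l2 : exc_start w (i + 1) < exc_start w j by rewrite lt_exc_start.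
  apply: (h `|(exc_start w (i + 1) - y%:Z - a)%R|%N I) => /=; first lia.
  by apply/record_tau_concat; exists (i + 1); lia.
move=> [i [ia ib]]; split; first by split; apply/record_tau_concat; [exists i | exists (i + 1)].
move=> n _ /= an /record_tau_concat[j jn].
have h1 : exc_start w i < exc_start w j by lia.
have h2 : exc_start w j < exc_start w (i + 1) by lia.
by move: h1 h2; rewrite !lt_exc_start; lia.
Qed.

Definition s_inf_set (i a : int) : set conf := decodable `&` [set eta | s_inf eta i = a%:E].

Lemma s_inf_setP (w : excs) (y : nat) i a : (y < elen (w 0%R))%N ->
  s_inf_set i a (tau y%:Z (concat_exc w)) <-> a = exc_start w i - y%:Z.
Proof.
move=> yw; rewrite /s_inf_set; split=> [[_ /=]|->]; first by rewrite s_inf_tau // => -[].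
by split; [exact: unbounded_records_tau | rewrite /= s_inf_tau].
Qed.

Lemma eq_on_decodable (A B : set conf) : A `<=` decodable -> B `<=` decodable ->
  (forall (w : excs) (y : nat), (y < elen (w 0%R))%N ->
     A (tau y%:Z (concat_exc w)) <-> B (tau y%:Z (concat_exc w))) -> A = B.
Proof.
move=> AT BT AB; apply/seteqP; split=> eta h.
  by have [y [w [yw e]]] := decodableP (AT _ h); rewrite e in h *; apply/AB.
by have [y [w [yw e]]] := decodableP (BT _ h); rewrite e in h *; apply/AB.
Qed.

Lemma measurable_s_inf_set i a : measurable (s_inf_set i a).
Proof.
elim/(@int_ind_from 0): i a => [|i i0 IH|i i0 IH] a.
- case: (boolP (a <= 0)) => a0; last first.
    rewrite (_ : s_inf_set 0 a = set0) //; apply: eq_on_decodable => //; first by move=> eta [].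
    by move=> w y yw; rewrite s_inf_setP // exc_start0; split=> // e; exfalso; lia.
  (* For [a <= 0], the record [a] is the last one up to the origin exactly when the next record is
     positive. *)
  rewrite (_ : s_inf_set 0 a = decodable `&` \bigcup_(n : nat) consecutive a n.+1%:Z).
    apply: measurableI; first exact: measurable_decodable.
    by apply: bigcupT_measurable => n; exact: measurable_consecutive.
  apply: eq_on_decodable => [eta []//|eta []//|w y yw].
  rewrite s_inf_setP //; split.
    move=> ea; split; first exact: unbounded_records_tau.
    exists `|(exc_start w 1 - y%:Z - 1)%R|%N => //; apply/consecutive_tau; first lia.
    by exists 0; rewrite add0r; split=> //; rewrite exc_start1; lia.
  move=> [_ [n _ /consecutive_tau[|j [ja jb]]]]; first lia.
  suff -> : 0 = j by [].
  apply: (@exc_index_unique w y); last by apply/andP; split; lia.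
  by rewrite add0r exc_start0 exc_start1; lia.
- rewrite (_ : s_inf_set (i + 1) a = \bigcup_(n : nat)
      (s_inf_set i (a - n.+1%:Z) `&` consecutive (a - n.+1%:Z) a)).
    apply: bigcupT_measurable => n; apply: measurableI => //.
    exact: measurable_consecutive.
  apply: eq_on_decodable => [eta []//|eta [n _ [[]]]//|w y yw].
  rewrite s_inf_setP //; split.
    move=> ea; have l1 : exc_start w i < exc_start w (i + 1) by rewrite lt_exc_start; lia.
    exists `|(exc_start w (i + 1) - exc_start w i - 1)%R|%N => //; split.
      by apply/s_inf_setP => //; lia.
    apply/consecutive_tau; first lia.
    by exists i; split; lia.
  move=> [n _ [/s_inf_setP-/(_ yw) e1 /consecutive_tau[|j [ja jb]]]]; first lia.
  have <- // : j = i by apply: (@exc_start_inj w); lia.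
- rewrite (_ : s_inf_set (i - 1) a = \bigcup_(n : nat)
      (s_inf_set i (a + n.+1%:Z) `&` consecutive a (a + n.+1%:Z))).
    apply: bigcupT_measurable => n; apply: measurableI => //.
    exact: measurable_consecutive.
  apply: eq_on_decodable => [eta []//|eta [n _ [[]]]//|w y yw].
  rewrite s_inf_setP //; split.
    move=> ea; have l1 : exc_start w (i - 1) < exc_start w i by rewrite lt_exc_start; lia.
    exists `|(exc_start w i - exc_start w (i - 1) - 1)%R|%N => //; split.
      by apply/s_inf_setP => //; lia.
    apply/consecutive_tau; first lia.
    by exists (i - 1); rewrite subrK; split; lia.
  move=> [n _ [/s_inf_setP-/(_ yw) e1 /consecutive_tau[|j [ja jb]]]]; first lia.
  have e2 : j + 1 = i by apply: (@exc_start_inj w); lia.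
  by have -> : i - 1 = j by lia.
Qed.

(** A countable union over the possible values of the excursion and of its starting site. *)
Lemma measurable_decode_coord i (B : set excursion) :
  measurable (decodable `&` [set eta : conf | B ((decode eta).2 i)]).
Proof.
rewrite (_ : _ `&` _ = \bigcup_(p : excursion * int)
   (if `[< B p.1 >] then s_inf_set i p.2 `&` s_inf_set (i + 1) (p.2 + (elen p.1)%:Z) `&`
      \bigcap_(j in `I_(elen p.1)) [set eta : conf | eta (p.2 + j%:Z) = nth false (val p.1) j]
    else set0)).
  apply: countable_bigcupT_measurable => // p; case: asboolP => // _.
  apply: measurableI; first by apply: measurableI; exact: measurable_s_inf_set.
  apply: bigcap_measurableType => j _.
  exact: (measurable_coord _ [set b | b = nth false (val p.1) j]).
apply: eq_on_decodable => [eta []//|eta [p _]|w y yw].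
  by case: asboolP => // _ [[[]]].
split.
  move=> [_ /=]; rewrite decodeK //= => Bw.
  exists (w i, exc_start w i - y%:Z) => //=; case: asboolP => // _.
  split; first by split; apply/s_inf_setP => //; rewrite exc_startS; lia.
  by move=> j /= ji; rewrite /tau addrAC subrK concat_at.
move=> [[e a] _ /=]; case: asboolP => // Be [[/s_inf_setP-/(_ yw) e1 /s_inf_setP-/(_ yw) e2] h].
split; first exact: unbounded_records_tau.
rewrite /= decodeK //=; suff -> : w i = e by [].
move: e1 e2 => /= e1 e2; have L : elen (w i) = elen e.
  by move: e2; rewrite exc_startS; lia.
apply/val_inj/(@eq_from_nth _ false) => [//|j ji].
have := h j; rewrite /= -L => /(_ ji) <-.
by rewrite /tau e1 addrAC subrK concat_at.
Qed.

Lemma measurable_decode_shift (y : nat) :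
  measurable (decodable `&` [set eta : conf | (decode eta).1 = y]).
Proof.
rewrite (_ : _ `&` _ = s_inf_set 0 (- y%:Z)); first exact: measurable_s_inf_set.
apply: eq_on_decodable => [eta []//|eta []//|w y' yw].
rewrite s_inf_setP // exc_start0; split=> [[_ /=]|e].
  by rewrite decodeK //= => ->; rewrite sub0r.
by split; [exact: unbounded_records_tau | rewrite /= decodeK //=; lia].
Qed.

(** Spares a direct study of [seat], [s_inf] and [Psi], which involve choice: an explicit formula in
    [(y, w)] is enough. *)
Lemma measurable_fun_decodable d (Y : measurableType d) (g : conf -> Y)
    (H : nat -> excs -> Y) :
  (forall y, measurable_fun setT (H y)) ->
  (forall (w : excs) (y : nat), (y < elen (w 0%R))%N ->
     g (tau y%:Z (concat_exc w)) = H y w) ->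
  measurable_fun decodable g.
Proof.
move=> mH gH mT B mB.
pose D (eta : conf) : excs := (decode eta).2.
have mD : measurable_fun decodable D.
  move=> _ A mA; pose D' (eta : conf) : excs := if `[< decodable eta >] then D eta else point.
  have mD' : measurable_fun setT D'.
    apply: measurable_fun_zprod => x C.
    rewrite (_ : [set eta | C (D' eta x)] =
      (decodable `&` [set eta : conf | C ((decode eta).2 x)]) `|`
      (~` decodable `&` [set eta | C point])).
      apply: measurableU; first exact: measurable_decode_coord.
      apply: measurableI; first exact: measurableC.
      by have [Cp|nCp] := pselect (C point);
        [rewrite (_ : [set _ | _] = setT) | rewrite (_ : [set _ | _] = set0)] => //;
        apply/seteqP; split.
    apply/seteqP; split=> eta /=; rewrite /D'; case: asboolP => T //=.
    + by move=> h; left.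
    + by move=> h; right.
    + by move=> [[]//|[]].
    + by move=> [[]//|[]].
  rewrite (_ : decodable `&` D @^-1` A = decodable `&` (setT `&` D' @^-1` A)).
    by apply: measurableI => //; exact: mD'.
  by apply/seteqP; split=> eta [T h]; split=> //=; move: h; rewrite /D' /= ?setTI /=;
    [move=> h; split=> // | move=> [_]]; rewrite asboolT.
rewrite (_ : decodable `&` g @^-1` B = \bigcup_(y : nat)
   ((decodable `&` [set eta : conf | (decode eta).1 = y]) `&`
    (decodable `&` D @^-1` (setT `&` H y @^-1` B)))).
  apply: bigcupT_measurable => y; apply: measurableI; first exact: measurable_decode_shift.
  by apply: mD => //; exact: mH.
apply: eq_on_decodable => [eta []//|eta [y _ [[]]]//|w y yw].
have uT : decodable (tau y%:Z (concat_exc w)) := unbounded_records_tau w y.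
split=> [[_ /=]|[y' _ [[_ /=]]]].
  rewrite gH // => HB; exists y => //; split; first by split=> //=; rewrite decodeK.
  by split=> //=; rewrite /D decodeK.
rewrite decodeK //= => <- [_ [_ /=]]; rewrite /D decodeK //= => HB.
by split=> //=; rewrite gH.
Qed.

Lemma exc_start_agree (w w' : excs) (n : nat) : agree n w w' ->
  forall i : int, (`|i| <= n)%N -> exc_start w i = exc_start w' i.
Proof.
move=> ag i; elim/(@int_ind_from 0): i => [|i i0 IH|i i0 IH] il.
- by rewrite !exc_start0.
- by rewrite !exc_startS IH ?ag //; lia.
- have := exc_startS w (i - 1); have := exc_startS w' (i - 1); rewrite subrK.
  rewrite (ag (i - 1)) // IH; last lia.
  lia.
Qed.

(** Excursions have length at least 1, so the site [x] lies in one of index at most [|x|] in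
    absolute value. *)
Lemma concat_agree (w w' : excs) (n : nat) (x : int) : agree n w w' -> (`|x| <= n)%N ->
  concat_exc w x = concat_exc w' x.
Proof.
move=> ag xn; have [i [j [ji xE]]] := exc_pos w x.
have il : (`|i| <= n)%N.
  have h1 := @le_exc_start w 0 i; have h2 := @le_exc_start w (i + 1) 0.
  rewrite exc_startS in h2; rewrite !exc_start0 in h1 h2.
  by have [i0|i0] := leP 0 i; lia.
rewrite xE concat_at // (exc_start_agree ag il) concat_at -?(ag i il) //.
Qed.

Lemma measurable_excs_local (A : set excs) :
  (forall w, A w -> exists n, forall w', agree n w w' -> A w') -> measurable A.
Proof. exact: (measurable_locally_determined pickle_inj). Qed.

Lemma measurable_concat : measurable_fun setT (concat_exc : excs -> conf).
Proof.
apply: measurable_fun_zprod => x B; apply: measurable_excs_local => w /= Bw.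
by exists `|x|%N => w' ag; rewrite -(concat_agree ag (leqnn _)).
Qed.

Lemma measurable_tau y : measurable_fun setT (tau y : conf -> conf).
Proof. by apply: measurable_fun_zprod => x B; exact: (measurable_coord (x + y) B). Qed.

Lemma measurable_tau_concat y :
  measurable_fun setT ((fun w => tau y (concat_exc w)) : excs -> conf).
Proof. exact: measurableT_comp (measurable_tau y) measurable_concat. Qed.

Lemma measurable_is_local d (Y : measurableType d) (f : conf -> Y) (s : seq int) :
  (forall eta eta' : conf, (forall x, x \in s -> eta x = eta' x) -> f eta = f eta') ->
  measurable_fun setT f.
Proof.
move=> fs _ B _; rewrite setTI; apply: measurable_conf_local => eta /= Bf.
exists (\max_(x <- s) `|x|%N) => eta' ag; rewrite -(fs eta) // => x xs.
have h : (absz x <= \max_(z <- s) absz z)%N by exact: (leq_bigmax_seq x xs).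
exact: ag.
Qed.

Lemma measurable_density_cvg (R : realType) (rho : R) :
  measurable [set eta : conf | density R eta @ \oo --> rho].
Proof.
rewrite (_ : [set _ | _] = \bigcap_(m : nat) \bigcup_(N : nat) \bigcap_(x : nat)
  [set eta : conf | `|rho - density R eta (N + x)| <= m.+1%:R^-1]).
  apply: bigcap_measurableType => m _; apply: bigcupT_measurable => N.
  apply: bigcap_measurableType => x _; apply: measurable_conf_local => eta /= h.
  exists (N + x)%N => eta' ag.
  rewrite /density -(@zsum_local _ (fun y => b2z (eta y)) _ (N + x)) //; first lia.
  by move=> v vn; rewrite ag.
apply/seteqP; split=> eta /=.
  move=> /cvgrPdist_le h m _.
  have m0 : 0 < m.+1%:R^-1 :> R by rewrite invr_gt0.
  have [N _ hN] := h _ m0; exists N => // x _ /=; apply: hN => /=; exact: leq_addr.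
move=> h; apply/cvgrPdist_le => e e0.
have [m me] : exists m : nat, m.+1%:R^-1 <= e.
  have ei : 0 <= e^-1 by rewrite invr_ge0 ltW.
  exists (Num.bound e^-1); rewrite -[leRHS]invrK lef_pV2 ?posrE ?invr_gt0 //.
  by apply: ltW; apply: lt_trans (archi_boundP ei) _; rewrite ltr_nat.
have [N _ hN] := h m I; exists N => // x /= Nx.
have := hN (x - N)%N I; rewrite /= subnKC // => h1; exact: le_trans h1 me.
Qed.

End ConfMeasurability.

(** * The stationary law *)

Section Domains.
Context d (T : measurableType d) (R : realType).
Import HBNNSimple.

(* [D] need not be measurable: the integral is the supremum of the integrals
   of the simple functions below the integrand. *)
Lemma integral_conull (m : {measure set T -> \bar R}) (G D : set T)
    (f : T -> \bar R) : measurable G -> G `<=` D -> m (~` G) = 0%E ->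
  (forall x, 0 <= f x)%E -> (\int[m]_(x in D) f x = \int[m]_(x in G) f x)%E.
Proof.
move=> mG GD mG0 f0; rewrite !ge0_integralE //.
apply/eqP; rewrite eq_le; apply/andP; split; last first.
  apply: le_ereal_sup => _ [h hf <-]; exists h => // x.
  apply: le_trans (hf x) _; rewrite /patch; case: ifPn => [|_].
    by rewrite inE => /GD xD; rewrite ifT // inE.
  by case: ifP.
apply: ge_ereal_sup => _ [h hf <-].
(* Cutting a simple function off outside [G] changes it on a null set only, and makes it admissible
   for the domain [G]. *)
have -> : sintegral m h = sintegral m (proj_nnsfun h mG).
  rewrite -!integralT_nnsfun.
  rewrite (@ge0_negligible_integral _ _ _ m setT (~` G)) //; last 3 first.
  - exact: measurableC.
  - exact/measurable_EFinP.
  - by move=> x _; rewrite lee_fin.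
  rewrite setTD setCK integral_mkcond; apply: eq_integral => x _.
  by rewrite /patch /= mindicE; case: ifP; rewrite (mulr0, mulr1).
apply: ereal_sup_ubound; exists (proj_nnsfun h mG) => // x.
rewrite /patch /= mindicE; case: ifP => xG; rewrite (mulr0, mulr1) //.
have := hf x; rewrite /patch ifT //.
by move: xG; rewrite !inE => /GD.
Qed.

Lemma ae_eq_integral_conull (m : {measure set T -> \bar R}) (G : set T)
    (f g : T -> \bar R) : measurable G -> m (~` G) = 0%E ->
  measurable_fun setT f -> measurable_fun setT g ->
  (forall x, 0 <= f x)%E -> (forall x, 0 <= g x)%E ->
  (forall x, G x -> f x = g x) -> (\int[m]_x f x = \int[m]_x g x)%E.
Proof.
move=> mG mG0 mf mg f0 g0 fg.
rewrite (@integral_conull m G setT) // (@integral_conull m G setT) //.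
by apply: eq_integral => x; rewrite inE => /fg.
Qed.

Lemma integral_mrestr (m : {measure set T -> \bar R}) (E : set T)
    (mE : measurable E) (f : T -> \bar R) :
  measurable_fun setT f -> (forall x, 0 <= f x)%E ->
  (\int[mrestr m mE]_x f x = \int[m]_(x in E) f x)%E.
Proof.
move=> mf f0; have -> : (\int[mrestr m mE]_x f x = \int[mrestr m mE]_(x in E) f x)%E.
  apply: integral_conull => //.
  by rewrite -[LHS]/(m (~` E `&` E)) setICl measure0.
apply: eq_measure_integral => A mA AE.
by rewrite -[LHS]/(m (A `&` E)) setIidl.
Qed.

End Domains.

Section LinearGrowth.
Variable R : realType.
Local Notation excs := (zprod excursion).
Variables (alpha : nat -> R) (P : probability excs R).
Hypothesis sw : summable_weights alpha.
Hypothesis ebar_lty : (ebar_ext alpha < +oo)%E.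
Hypothesis iP : is_iid (nu alpha) P.
Local Notation L := (ebar alpha).
Local Notation length_real := (fun e : excursion => (elen e)%:R : R).

Lemma ebar_ge1 : 1 <= L.
Proof. by rewrite -lee_fin -ebar_ext_fin //; exact: ebar_ext_ge1. Qed.

Lemma pmean_cst (c : R) : 0 <= c -> pmean (nu alpha) (fun=> c) = c%:E.
Proof.
move=> c0; rewrite /pmean; under eq_esum do rewrite mulrC EFinM.
by rewrite esumZl // ?esum_nu ?mule1 // => e _; rewrite lee_fin nu_ge0.
Qed.

Lemma pmean_elen : pmean (nu alpha) length_real = L%:E.
Proof.
by rewrite -ebar_ext_fin // /pmean /ebar_ext; apply: eq_esum => e _; rewrite mulrC.
Qed.

(** For every [m], the left lengths stay, up to a constant, between the slopes [L - 1/(m + 2)] and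
    [L + 1/(m + 2)]. The margin provides the strict drift, and [m + 2] keeps the lower slope
    positive as [L >= 1]. *)
Definition linear_growth : set excs := \bigcap_(m : nat)
  (~` walk_unbounded length_real (fun=> L + m.+2%:R^-1) `&`
   ~` walk_unbounded (fun=> L - m.+2%:R^-1) length_real).

Lemma measurable_linear_growth : measurable linear_growth.
Proof.
apply: bigcap_measurableType => m _.
by apply: measurableI; apply: measurableC; exact: measurable_walk_unbounded.
Qed.

Lemma linear_growth_conull : P (~` linear_growth) = 0%E.
Proof.
rewrite -negligibleP; last first.
  by apply: measurableC; exact: measurable_linear_growth.
rewrite /linear_growth setC_bigcap; apply: negligible_bigcup => m.
have m0 : 0 < m.+2%:R^-1 :> R by rewrite invr_gt0.
have m1 : m.+2%:R^-1 <= 1 :> R by rewrite invf_le1 // ler1n.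
move: (m.+2%:R^-1) m0 m1 => x m0 m1.
have L1 := ebar_ge1; have n0 e : 0 <= nu alpha e by exact: nu_ge0.
rewrite setCI !setCK; apply: negligibleU; apply/negligibleP;
  try exact: measurable_walk_unbounded.
  apply: (walk_unbounded_null iP) => //.
  - by move=> _; lra.
  - by rewrite pmean_elen ltry.
  - by rewrite pmean_elen pmean_cst ?lte_fin; lra.
apply: (walk_unbounded_null iP) => //.
- by move=> _; lra.
- by rewrite pmean_cst ?ltry //; lra.
- by rewrite pmean_elen pmean_cst ?lte_fin; lra.
Qed.

Lemma walk_bounded (U V : excursion -> R) w : ~ walk_unbounded U V w ->
  exists K : R, forall n, walk U V n w <= K.
Proof.
move=> h; apply: contrapT => nK; apply: h => K.
apply: contrapT => nn; apply: nK; exists K%:R => n.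
by rewrite leNgt; apply/negP => hn; apply: nn; exists n.
Qed.

Lemma walk_length (c : R) n w :
  walk length_real (fun=> c) n w = (left_length w n)%:R - c * n%:R.
Proof. by rewrite /walk sumrB sumr_const card_ord mulr_natr /left_length natr_sum. Qed.

Lemma walk_lengthN (c : R) n w :
  walk (fun=> c) length_real n w = c * n%:R - (left_length w n)%:R.
Proof. by rewrite /walk sumrB sumr_const card_ord mulr_natr /left_length natr_sum. Qed.

Lemma linear_growth_density w (y : nat) : linear_growth w ->
  density R (tau y%:Z (concat_exc w)) @ \oo --> ((1 - L^-1) / 2 : R).
Proof.
move=> h; apply: density_cvg; first exact: ebar_ge1.
move=> m; have [/walk_bounded[K1 h1] /walk_bounded[K2 h2]] := h m I.
exists (Num.max K1 K2) => n; have := h1 n; have := h2 n.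
rewrite walk_length walk_lengthN => le2 le1.
have M1 : K1 <= Num.max K1 K2 by rewrite le_max lexx.
have M2 : K2 <= Num.max K1 K2 by rewrite le_max lexx orbT.
move: (_ * n%:R) ((L - _) * n%:R) le1 le2 => b a le1 le2.
by apply/andP; split; lra.
Qed.

End LinearGrowth.

Lemma s_inf0_record eta : s_inf eta 0 = 0%:E <-> is_record eta 0.
Proof.
rewrite /s_inf /=; split; last first.
  by move=> r0; apply: emax_eq; [split | move=> y []].
rewrite /emax; by case: xgetP => [_ _ [m [[rm _] _] <-] [m0]|//]; rewrite -m0.
Qed.

Lemma zsum_ge0 (R : realType) a b (F : int -> R) : (forall x, 0 <= F x) -> 0 <= zsum a b F.
Proof. by move=> F0; apply: sumr_ge0. Qed.

Section SitePartition.
Variable R : realType.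
Local Notation excs := (zprod excursion).
Variable P : probability excs R.

Definition site_in_first (y : nat) : set excs := [set w | (y < elen (w 0%R))%N].

Lemma measurable_site_in_first y : measurable (site_in_first y).
Proof. exact: (measurable_coord 0 [set e | (y < elen e)%N]). Qed.

Lemma measurable_fun_first d (Y : measurableType d) (Phi : excursion -> excs -> Y) :
  (forall e, measurable_fun setT (Phi e)) ->
  measurable_fun setT (fun w : excs => Phi (w 0%R) w).
Proof.
move=> mPhi _ B mB; rewrite setTI (_ : _ @^-1` _ = \bigcup_(e : excursion)
  ([set w : excs | w 0%R = e] `&` (setT `&` Phi e @^-1` B))).
  apply: countable_bigcupT_measurable => // e; apply: measurableI.
    exact: (measurable_coord 0 [set e' | e' = e]).
  exact: mPhi.
apply/seteqP; split=> w /=; first by move=> Bw; exists (w 0%R).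
by move=> [e _ [/= <- [_]]].
Qed.

Lemma nneseries_lt (a : nat -> \bar R) n :
  (\sum_(y <oo) (if (y < n)%N then a y else 0) = \sum_(y < n) a y)%E.
Proof.
rewrite (@lim_near_cst _ _ _ _ _ (\sum_(y < n) a y)%E) //.
exists n => // N /= nN.
rewrite (big_cat_nat (leq0n n) nN) /= [X in (_ + X)%E](_ : _ = 0%E) ?adde0.
  by rewrite big_mkord; apply: eq_bigr => i _; rewrite ltn_ord.
rewrite big_nat_cond; apply: big1 => i; rewrite andbT => /andP[ni _].
by rewrite ltnNge ni.
Qed.

Lemma measurable_sum_first (H : nat -> excs -> \bar R) :
  (forall y, measurable_fun setT (H y)) -> (forall y w, 0 <= H y w)%E ->
  measurable_fun setT (fun w : excs => \sum_(y < elen (w 0%R)) H y w)%E.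
Proof.
move=> mH H0; apply: (@measurable_fun_first _ _ (fun e w => \sum_(y < elen e) H y w)%E) => e.
exact: emeasurable_sum.
Qed.

Lemma sum_integral_site (H : nat -> excs -> \bar R) :
  (forall y, measurable_fun setT (H y)) -> (forall y w, 0 <= H y w)%E ->
  (\sum_(y <oo) \int[P]_(w in site_in_first y) H y w =
   \int[P]_w \sum_(y < elen (w 0%R)) H y w)%E.
Proof.
move=> mH H0; under eq_eseriesr do rewrite integral_mkcond.
rewrite -integral_nneseries //; last 2 first.
- move=> y; apply/(measurable_restrictT _ (measurable_site_in_first y)).
  exact: measurable_funTS.
- by move=> y w _; rewrite /patch; case: ifP.
apply: eq_integral => w _; rewrite -(nneseries_lt (H^~ w)); apply: eq_eseriesr => y _.
by rewrite /patch mem_setE.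
Qed.

Lemma sum_first_esum (p : excursion -> R) (H : nat -> excs -> \bar R) : is_iid p P ->
  (forall e, 0 <= p e) ->
  (forall y, measurable_fun setT (H y)) -> (forall y w, 0 <= H y w)%E ->
  (\int[P]_w \sum_(y < elen (w 0%R)) H y w =
   \esum_(e in [set: excursion])
     ((p e)%:E * \sum_(y < elen e) \int[P]_w H y (replace0 w e)))%E.
Proof.
move=> iP p0 mH H0; rewrite (integral_replace0 iP) //; last 2 first.
- exact: measurable_sum_first.
- by move=> w; apply: sume_ge0.
apply: eq_esum => e _; congr (_ * _)%E.
rewrite -ge0_integral_sum //; last first.
  by move=> y; exact: measurableT_comp (mH y) (measurable_replace0l e).
Qed.

End SitePartition.

Section StationaryLaw.
Variable R : realType.
Local Notation excs := (zprod excursion).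
Variable alpha : nat -> R.
Hypothesis sw : summable_weights alpha.
Hypothesis ebar_lty : (ebar_ext alpha < +oo)%E.
Local Notation L := (ebar alpha).
Local Notation P := (iid_law (nu alpha)).
Local Notation T y := ((fun w => tau y%:Z (concat_exc w)) : excs -> conf).

Let iP : is_iid (nu alpha) P.
Proof. by apply: iid_lawP; [exact: nu_ge0 | exact: esum_nu]. Qed.

Let L1 : 1 <= L. Proof. exact: ebar_ge1. Qed.

(* A measurable set of full measure inside [Omega_star]; in this way the
   measurability of [Omega_star] itself is never needed. *)
Definition typical : set conf :=
  decodable `&` [set eta | density R eta @ \oo --> ((1 - L^-1) / 2 : R)].

Lemma measurable_typical : measurable typical.
Proof.
by apply: measurableI; [exact: measurable_decodable | exact: measurable_density_cvg].
Qed.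

Lemma typical_Omega_star : typical `<=` Omega_star R.
Proof.
move=> eta [/decodableP[y [w [yw ->]]] h]; split; last by move=> i; rewrite s_inf_tau.
exists ((1 - L^-1) / 2) => //.
have : 0 < L^-1 by rewrite invr_gt0 (lt_le_trans ltr01 L1).
by move: (L^-1) => x; lra.
Qed.

Lemma typical_tau w (y : nat) : linear_growth alpha w -> typical (T y w).
Proof.
by move=> h; split; [exact: unbounded_records_tau | exact: linear_growth_density].
Qed.

Lemma typical_conull y : P (T y @^-1` (~` typical)) = 0%E.
Proof.
have mlg := measurable_linear_growth alpha.
apply/eqP; rewrite -measure_le0 -(linear_growth_conull sw ebar_lty iP).
apply: le_measure; rewrite ?inE; last by move=> w /= h h'; apply: h; exact: typical_tau.
- rewrite -[_ @^-1` _]setTI; apply: measurable_tau_concat => //.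
  by apply: measurableC; exact: measurable_typical.
- exact: measurableC.
Qed.

Section Evaluation.
Variables (g : conf -> \bar R) (H : nat -> excs -> \bar R).
Hypothesis mH : forall y, measurable_fun setT (H y).
Hypothesis H0 : forall y w, (0 <= H y w)%E.
Hypothesis g0 : forall eta, (0 <= g eta)%E.
Hypothesis gH : forall (w : excs) (y : nat), (y < elen (w 0%R))%N -> g (T y w) = H y w.

Lemma measurable_restrict_typical (G : set conf) : measurable G -> G `<=` decodable ->
  measurable_fun setT (g \_ G).
Proof.
move=> mG GD; apply/(measurable_restrictT _ mG).
by apply: measurable_funS (measurable_fun_decodable mH gH) => //; exact: measurable_decodable.
Qed.

Lemma restrict_ge0 (G : set conf) eta : (0 <= (g \_ G) eta)%E.
Proof. by rewrite /patch; case: ifP. Qed.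

(** Stated for any set function [m] with the right values on measurable sets, so that it serves both
    [mu_hat] on [Omega_r] and the conditioned law on [Omega_star]. *)
Lemma integral_mu_hat (m : set conf -> \bar R) (G D : set conf) :
  (forall A, measurable A -> m A = P (concat_exc @^-1` A)) ->
  measurable G -> G `<=` decodable -> G `<=` D ->
  (forall w, linear_growth alpha w -> G (concat_exc w)) ->
  (\int[m]_(eta in D) g eta = \int[P]_w H 0 w)%E.
Proof.
move=> mE mG Gdec GD lgG; have mlg := measurable_linear_growth alpha.
have [M ME] := pushforward_measure P measurable_concat.
rewrite (@eq_set_function_integral _ _ _ m M); last by move=> A mA; rewrite mE // ME.
rewrite (integral_conull mG GD) //; last first.
  rewrite ME; apply/eqP; rewrite -measure_le0 -(linear_growth_conull sw ebar_lty iP).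
  apply: le_measure; rewrite ?inE; last by move=> w /= h /lgG.
    rewrite -[_ @^-1` _]setTI; apply: measurable_concat => //; exact: measurableC.
  exact: measurableC.
rewrite integral_mkcond (integral_of_pushforward measurable_concat (fun A _ => ME A));
  [|exact: measurable_restrict_typical|exact: restrict_ge0].
apply: (@ae_eq_integral_conull _ _ _ _ (linear_growth alpha)) => //.
- exact: linear_growth_conull.
- apply: measurableT_comp measurable_concat.
  exact: measurable_restrict_typical.
- by move=> w; exact: restrict_ge0.
- move=> w /lgG h; rewrite /patch ifT ?inE //.
  by rewrite -(gH (w := w) (y := 0)) ?elen_gt0 // /tau; congr g; apply/funext => x; rewrite addr0.
Qed.

Lemma integral_T (y : nat) (m : {measure set conf -> \bar R}) :
  (forall A, m A = mrestr P (measurable_site_in_first y) (T y @^-1` A)) ->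
  (\int[m]_eta (g \_ typical) eta = \int[P]_(w in site_in_first y) H y w)%E.
Proof.
move=> mE; have mT := measurable_tau_concat y%:Z.
have mgt : measurable_fun setT (g \_ typical).
  by apply: measurable_restrict_typical => [|eta []//]; exact: measurable_typical.
have ms := measurable_site_in_first y.
rewrite (integral_of_pushforward mT (fun A _ => mE A)) //; last exact: restrict_ge0.
rewrite integral_mrestr //; last 2 first.
- exact: measurableT_comp mT.
- by move=> w; exact: restrict_ge0.
rewrite integral_mkcond [RHS]integral_mkcond.
apply: (@ae_eq_integral_conull _ _ _ _ (linear_growth alpha)).
- exact: measurable_linear_growth.
- exact: linear_growth_conull.
- apply/(measurable_restrictT _ ms); apply: measurable_funTS.
  exact: measurableT_comp mT.
- by apply/(measurable_restrictT _ ms); exact: measurable_funTS.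
- by move=> w; rewrite /patch; case: ifP => // _; case: ifP.
- by move=> w; rewrite /patch; case: ifP.
move=> w h; rewrite /patch; case: ifP => //; rewrite inE => yw.
by rewrite ifT ?gH // inE; exact: typical_tau.
Qed.

End Evaluation.
End StationaryLaw.

(** * Integrals against [mu] and its conditioned version *)

Section StationaryIntegrals.
Variable R : realType.
Local Notation excs := (zprod excursion).
Variable alpha : nat -> R.
Hypothesis sw : summable_weights alpha.
Hypothesis ebar_lty : (ebar_ext alpha < +oo)%E.
Local Notation L := (ebar alpha).
Local Notation P := (iid_law (nu alpha)).
Local Notation T y := ((fun w => tau y%:Z (concat_exc w)) : excs -> conf).

Let iP : is_iid (nu alpha) P.
Proof. by apply: iid_lawP; [exact: nu_ge0 | exact: esum_nu]. Qed.

Let L1 : 1 <= L. Proof. exact: ebar_ge1. Qed.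

Let L_ge0 : 0 <= L^-1. Proof. by rewrite invr_ge0 (le_trans ler01). Qed.

Lemma measurable_EFin_indic_tau (A : set conf) (y : int) : measurable A ->
  measurable_fun setT ((fun w => (\1_A (tau y (concat_exc w)))%:E) : excs -> \bar R).
Proof.
move=> mA; apply/measurable_EFinP.
by apply: measurableT_comp (measurable_tau_concat y); exact: measurable_indic.
Qed.

Lemma muE (A : set conf) : measurable A ->
  mu alpha A = ((L^-1)%:E * \sum_(y <oo) P (T y @^-1` A `&` site_in_first y))%E.
Proof.
move=> mA; rewrite /mu; congr (_ * _)%E.
(* The integrand of [mu] at [tau y (concat_exc w)]: [elen (w 0) - y] sites remain before the next
   record. *)
pose H (y : nat) (w : excs) : \bar R :=
  (\sum_(v < (elen (w 0%R) - y)%N) (\1_A (tau (v%:Z + y%:Z) (concat_exc w)))%:E)%E.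
have mH y : measurable_fun setT (H y).
  apply: (@measurable_fun_first _ _ (fun e w => \sum_(v < (elen e - y)%N)
    (\1_A (tau (v%:Z + y%:Z) (concat_exc w)))%:E)%E) => e.
  by apply: emeasurable_sum => v; exact: measurable_EFin_indic_tau.
have mG : measurable (typical alpha `&` [set eta | is_record eta 0]).
  by apply: measurableI; [exact: measurable_typical | exact: measurable_record].
rewrite (@integral_mu_hat _ _ sw ebar_lty _ H mH _ _ _ (mu_hat alpha) _ _ _ mG) //.
- transitivity (\int[P]_w \sum_(y < elen (w 0%R)) (\1_A (T y w))%:E)%E.
    by apply: eq_integral => w _; rewrite /H subn0; apply: eq_bigr => v _; rewrite addr0.
  rewrite -(sum_integral_site _ (H := fun y w => (\1_A (T y w))%:E)); last 2 first.
  + by move=> y; exact: measurable_EFin_indic_tau.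
  + by move=> y w; rewrite lee_fin.
  apply: eq_eseriesr => y _; have mT := measurable_tau_concat y%:Z.
  have mTA : measurable (T y @^-1` A) by rewrite -[_ @^-1` _]setTI; exact: mT.
  rewrite -(integral_indic P (measurable_site_in_first y) mTA).
  by apply: eq_integral => w _.
- by move=> y w; apply: sume_ge0 => v _; rewrite lee_fin.
- by move=> eta; rewrite lee_fin zsum_ge0.
- move=> w y yw; rewrite s_inf_tau //= exc_start1 /H.
  have -> : (elen (w 0%R))%:Z - y%:Z - 1 = 0 + (elen (w 0%R) - y)%N%:Z - 1 by lia.
  rewrite zsumE -sumEFin; apply: eq_bigr => v _; congr (\1_A _)%:E.
  by apply/funext => x; rewrite /tau; congr concat_exc; lia.
- by move=> eta [[]].
- move=> eta [Teta /= r0]; split; first exact: (typical_Omega_star sw ebar_lty).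
  exact/s_inf0_record.
- move=> w h; split.
    have := typical_tau sw ebar_lty 0 h; congr typical.
    by apply/funext => x; rewrite /tau addr0.
  by apply/is_record_start; exists 0; rewrite exc_start0.
Qed.

(** On measurable sets [mu] is [L^-1] times the sum over [y] of images of the i.i.d. law restricted
    to [y < elen (w 0)]; in particular it coincides there with a measure. *)
Lemma mu_mixture : exists2 m : nat -> {measure set conf -> \bar R},
  forall y A, m y A = mrestr P (measurable_site_in_first y) (T y @^-1` A) &
  forall A, measurable A -> mu alpha A = mscale (NngNum L_ge0) (mseries m 0) A.
Proof.
have [m mE] := choice (fun y => pushforward_measure
  (mrestr P (measurable_site_in_first y)) (measurable_tau_concat y%:Z)).
exists m => // A mA; rewrite muE //; congr (_ * _)%E; apply: eq_eseriesr => y _.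
by rewrite mE.
Qed.

Section Evaluation.
Variables (g : conf -> \bar R) (H : nat -> excs -> \bar R).
Hypothesis mH : forall y, measurable_fun setT (H y).
Hypothesis H0 : forall y w, (0 <= H y w)%E.
Hypothesis g0 : forall eta, (0 <= g eta)%E.
Hypothesis gH : forall (w : excs) (y : nat), (y < elen (w 0%R))%N -> g (T y w) = H y w.

Lemma integral_mu :
  (\int[mu alpha]_(eta in Omega_star R) g eta = (L^-1)%:E *
   \esum_(e in [set: excursion])
     ((nu alpha e)%:E * \sum_(y < elen e) \int[P]_w H y (replace0 w e)))%E.
Proof.
have [m mE ME] := mu_mixture.
have mt := measurable_typical alpha.
have mgt : measurable_fun setT (g \_ (typical alpha)).
  by apply: (measurable_restrict_typical mH gH) => // eta [].
have gt0 eta : (0 <= (g \_ (typical alpha)) eta)%E by rewrite restrict_ge0.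
rewrite (eq_set_function_integral _ _ ME).
rewrite (@integral_conull _ _ _ _ (typical alpha)) //; last 2 first.
- exact: (typical_Omega_star sw ebar_lty).
- apply: etrans (esym (ME _ (measurableC mt))) _.
  rewrite muE; last exact: measurableC.
  rewrite eseries0 ?mule0 // => y _ _; apply/eqP; rewrite -measure_le0.
  rewrite -(typical_conull sw ebar_lty y); apply: le_measure; rewrite ?inE.
  + apply: measurableI; last exact: measurable_site_in_first.
    rewrite -[_ @^-1` _]setTI; apply: measurable_tau_concat => //; exact: measurableC.
  + rewrite -[_ @^-1` _]setTI; apply: measurable_tau_concat => //; exact: measurableC.
  + by move=> w [].
rewrite integral_mkcond ge0_integral_mscale //; congr (_ * _)%E.
rewrite ge0_integral_measure_series //.
rewrite -(sum_first_esum iP) ?sum_integral_site //; last exact: nu_ge0.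
rewrite -sum_integral_site //; apply: eq_eseriesr => y _.
exact: (integral_T sw ebar_lty mH H0 g0 gH).
Qed.

(** A record at the origin forces [y = 0], so one term of the series remains; the conditioning event
    has mass [L^-1], which cancels. *)
Lemma cond_on_record (A : set conf) : measurable A ->
  cond_on (mu alpha) [set eta | s_inf eta 0 = 0%:E] A = P (concat_exc @^-1` A).
Proof.
have recE : [set eta | s_inf eta 0 = 0%:E] = [set eta : conf | is_record eta 0].
  by apply/seteqP; split=> eta /s_inf0_record.
have mr := measurable_record 0.
have E B : measurable B ->
    mu alpha ([set eta : conf | is_record eta 0] `&` B) = ((L^-1)%:E * P (concat_exc @^-1` B))%E.
  move=> mB; rewrite muE; last exact: measurableI.
  rewrite nneseries_recl // ?eseries0 ?adde0; last first.
    move=> y y0 _; rewrite (_ : _ `&` _ = set0) ?measure0 //.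
    apply/seteqP; split=> // w [[/record_tau_concat[i /= e] _] yw].
    have : exc_start w 0 < exc_start w i by rewrite exc_start0; lia.
    have : exc_start w i < exc_start w 1 by rewrite exc_start1; move: yw; rewrite /site_in_first /=; lia.
    by rewrite !lt_exc_start; lia.
  congr (_ * P _)%E; apply/seteqP; split=> w.
    move=> [[_ h] _]; move: h; congr (B _).
    by apply/funext => x; rewrite /tau addr0.
  move=> h; split; last exact: elen_gt0.
  split; first by apply/record_tau_concat; exists 0; rewrite exc_start0.
  by move: h; congr (B _); apply/funext => x; rewrite /tau addr0.
move=> mA; rewrite /cond_on recE [A `&` _]setIC E //.
have := E _ (@measurableT _ conf); rewrite setIT => ->.
rewrite preimage_setT probability_setT mule1 /= invrK muleA -EFinM mulfV ?mul1e //.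
by rewrite gt_eqF // (lt_le_trans ltr01 L1).
Qed.

Lemma integral_cond_on_record :
  (\int[cond_on (mu alpha) [set eta | s_inf eta 0 = 0%:E]]_(eta in Omega_star R) g eta =
   \int[P]_w H 0 w)%E.
Proof.
apply: (integral_mu_hat sw ebar_lty mH H0 g0 gH cond_on_record (measurable_typical alpha)).
- by move=> eta [].
- exact: (typical_Omega_star sw ebar_lty).
move=> w h; have := typical_tau sw ebar_lty 0 h; congr typical.
by apply/funext => x; rewrite /tau addr0.
Qed.

End Evaluation.
End StationaryIntegrals.

(** * Integrals along the k-skip *)

Section SkipMap.
Variable R : realType.
Local Notation excs := (zprod excursion).
Variables (alpha : nat -> R) (k : nat) (f : conf -> R) (C : R).
Hypothesis sw : summable_weights alpha.
Hypothesis ebar_lty : (ebar_ext alpha < +oo)%E.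
Hypothesis f_ge0 : forall eta, 0 <= f eta.
Hypothesis f_leC : forall eta, f eta <= C.
Hypothesis mf : measurable_fun setT f.
Local Notation theta_k := (iter k (@theta R) alpha).
Local Notation P := (iid_law (nu alpha)).
Local Notation Q := (iid_law (nu theta_k)).
Local Notation L := (ebar alpha).
Local Notation L' := (ebar theta_k).

Let sw' : summable_weights theta_k. Proof. exact: summable_iter_theta. Qed.

Let ebar_lty' : (ebar_ext theta_k < +oo)%E. Proof. exact: ebar_ext_theta_lty. Qed.

Let iP : is_iid (nu alpha) P.
Proof. by apply: iid_lawP; [exact: nu_ge0 | exact: esum_nu]. Qed.

Let iQ : is_iid (nu theta_k) Q.
Proof. by apply: iid_lawP; [exact: nu_ge0 | exact: esum_nu]. Qed.

Let C_ge0 : 0 <= C. Proof. exact: le_trans (f_ge0 point) (f_leC point). Qed.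

Definition phi (z : nat) (w : excs) : \bar R := (f (tau z%:Z (concat_exc w)))%:E.

Lemma measurable_phi z : measurable_fun setT (phi z).
Proof. by apply/measurable_EFinP; exact: measurableT_comp mf (measurable_tau_concat z%:Z). Qed.

Lemma phi_ge0 z w : (0 <= phi z w)%E. Proof. by rewrite lee_fin. Qed.

Definition phi_psi (y : nat) (w : excs) : \bar R :=
  phi (kept_index_iter k (w 0%R) y) (psi_iter k w).

Lemma measurable_phi_psi y : measurable_fun setT (phi_psi y).
Proof.
apply: (@measurable_fun_first _ _ (fun e w => phi (kept_index_iter k e y) (psi_iter k w))) => e.
exact: measurableT_comp (measurable_phi _) (measurable_map_coord (iter k psi)).
Qed.

Lemma PsiE (w : excs) (y : nat) : (y < elen (w 0%R))%N ->
  (f (Psi k (tau y%:Z (concat_exc w))))%:E = phi_psi y w.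
Proof. by move=> yw; rewrite Psi_tau. Qed.

Lemma integral_Psi_cond :
  (\int[cond_on (mu alpha) [set eta | s_inf eta 0 = 0%:E]]_(eta in Omega_star R)
     (f (Psi k eta))%:E =
   \int[cond_on (mu theta_k) [set eta | s_inf eta 0 = 0%:E]]_(eta in Omega_star R)
     (f eta)%:E)%E.
Proof.
have Psi_ge0 eta : (0 <= (f (Psi k eta))%:E)%E by rewrite lee_fin.
have phi_psi_ge0 y w : (0 <= phi_psi y w)%E by exact: phi_ge0.
have f_ge0E eta : (0 <= (f eta)%:E)%E by rewrite lee_fin.
apply: etrans (integral_cond_on_record sw ebar_lty measurable_phi_psi phi_psi_ge0 Psi_ge0 PsiE) _.
apply: etrans _ (esym (integral_cond_on_record sw' ebar_lty' measurable_phi phi_ge0 f_ge0E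
  (fun w y _ => erefl))).
rewrite -(integral_psi_iter sw iP iQ (measurable_phi 0) (phi_ge0 0)).
apply: eq_integral => w _; rewrite /phi_psi; congr phi.
by elim: (k) (w 0%R) => //= j IH e; rewrite kept_index0 IH.
Qed.

(** The mean of [f] seen from site [z] of [e], the other excursions being random; it plays the role
    of [phi] in [esum_nu_iter]. *)
Definition site_mean (e : excursion) (z : nat) : R := fine (\int[Q]_w phi z (replace0 w e)).

Lemma integral_phi_bounds e z :
  (0 <= \int[Q]_w phi z (replace0 w e) <= C%:E)%E.
Proof.
apply/andP; split; first by apply: integral_ge0 => w _; exact: phi_ge0.
have -> : C%:E = (\int[Q]_w cst C%:E w)%E.
  by rewrite integral_cst // [X in (_ * X)%E](probability_setT Q) mule1.
apply: ge0_le_integral => //.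
- by move=> w _; exact: phi_ge0.
- exact: measurableT_comp (measurable_phi z) (measurable_replace0l e).
- by move=> w _; rewrite lee_fin.
Qed.

Lemma site_meanE e z : (\int[Q]_w phi z (replace0 w e))%E = (site_mean e z)%:E.
Proof.
have /andP[h0 hC] := integral_phi_bounds e z.
by rewrite fineK // ge0_fin_numE // (le_lt_trans hC) // ltry.
Qed.

Lemma site_mean_bounds e z : 0 <= site_mean e z <= C.
Proof. by have := integral_phi_bounds e z; rewrite site_meanE !lee_fin. Qed.

Lemma site_mean_ge0 e z : 0 <= site_mean e z.
Proof. by have /andP[] := site_mean_bounds e z. Qed.

Definition moment (c : bool -> R) : \bar R :=
  \esum_(e in [set: excursion])
    (nu theta_k e * \sum_(i < elen e) site_mean e i * c (flips e i))%:E.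

Lemma integral_mu_flips (c : bool -> R) (g : conf -> R) : (forall b, 0 <= c b) ->
  (forall eta, 0 <= g eta) ->
  (forall (w : excs) (y : nat), (y < elen (w 0%R))%N ->
    g (tau y%:Z (concat_exc w)) =
    c (flips (w 0%R) y) * f (tau y%:Z (concat_exc w))) ->
  (\int[mu theta_k]_(eta in Omega_star R) (g eta)%:E = L'^-1%:E * moment c)%E.
Proof.
move=> c0 g0 gE.
pose H (y : nat) (w : excs) := ((c (flips (w 0%R) y))%:E * phi y w)%E.
have mH y : measurable_fun setT (H y).
  apply: (@measurable_fun_first _ _ (fun e w => ((c (flips e y))%:E * phi y w)%E)) => e.
  by apply: measurable_funeM; exact: measurable_phi.
have H0 y w : (0 <= H y w)%E by rewrite mule_ge0 ?phi_ge0 // lee_fin.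
have g0E eta : (0 <= (g eta)%:E)%E by rewrite lee_fin.
have gH (w : excs) (y : nat) : (y < elen (w 0%R))%N ->
    (g (tau y%:Z (concat_exc w)))%:E = H y w.
  by move=> yw; rewrite gE // EFinM.
apply: etrans (integral_mu sw' ebar_lty' mH H0 g0E gH) _; congr (_ * _)%E.
apply: eq_esum => e _; rewrite [RHS]EFinM -sumEFin; congr (_ * _)%E; apply: eq_bigr => i _.
transitivity (\int[Q]_w ((c (flips e i))%:E * phi i (replace0 w e)))%E.
  by apply: eq_integral => w _; rewrite /H {1}/replace0 eqxx.
rewrite ge0_integralZl_EFin //; last 2 first.
- by move=> w _; exact: phi_ge0.
- exact: measurableT_comp (measurable_phi i) (measurable_replace0l e).
by rewrite site_meanE [RHS]EFinM muleC.
Qed.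

(** Given [w 0 = e], the other excursions of the k-skip have the law of [Q], so the inner integral
    is [site_mean] at the image of the site. Then [esum_nu_iter] applies with the initial site
    weight 1, that is [a = 1], [b = 0]. *)
Lemma integral_Psi_moment :
  (\int[mu alpha]_(eta in Omega_star R) (f (Psi k eta))%:E =
   L^-1%:E * moment (fun b => (mix k alpha 1 0).1 + (mix k alpha 1 0).2 * b%:R)%R)%E.
Proof.
have Psi_ge0 eta : (0 <= (f (Psi k eta))%:E)%E by rewrite lee_fin.
have phi_psi_ge0 y w : (0 <= phi_psi y w)%E by exact: phi_ge0.
apply: etrans (integral_mu sw ebar_lty measurable_phi_psi phi_psi_ge0 Psi_ge0 PsiE) _.
congr (_ * _)%E.
rewrite /moment -(@esum_nu_iter _ k alpha 1 0 site_mean) //; last exact: site_mean_ge0.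
apply: eq_esum => e _; rewrite [RHS]EFinM -sumEFin; congr (_ * _)%E; apply: eq_bigr => y _.
rewrite mul0r addr0 mulr1 -site_meanE.
rewrite -(@integral_psi_iter _ k alpha P Q
  (fun w => phi (kept_index_iter k e y) (replace0 w (iter k psi e)))) //; last 2 first.
- exact: measurableT_comp (measurable_phi _) (measurable_replace0l _).
- by move=> w; exact: phi_ge0.
apply: eq_integral => w _; rewrite /phi_psi {1}/replace0 eqxx; congr phi.
by apply/funext => i; rewrite /psi_iter /replace0; case: ifP.
Qed.

Lemma moment_ge0 c : (forall b, 0 <= c b) -> (0 <= moment c)%E.
Proof.
move=> c0; apply: esum_ge0 => e _; rewrite lee_fin mulr_ge0 ?nu_ge0 //.
by apply: sumr_ge0 => i _; rewrite mulr_ge0 // site_mean_ge0.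
Qed.

Lemma moment_affine (a b : R) : 0 <= a -> 0 <= b ->
  (moment (fun x => a + b * x%:R)%R =
   a%:E * moment (fun=> 1%R) + b%:E * moment (fun x => x%:R%R))%E.
Proof.
move=> a0 b0; have term_ge0 (c : bool -> R) e : (forall x, 0 <= c x) ->
    (0 <= (nu theta_k e * \sum_(i < elen e) site_mean e i * c (flips e i))%:E)%E.
  move=> c0; rewrite lee_fin mulr_ge0 ?nu_ge0 //.
  by apply: sumr_ge0 => i _; rewrite mulr_ge0 // site_mean_ge0.
have t1 e := term_ge0 (fun=> 1) e (fun=> ler01).
have tx e := term_ge0 (fun x => x%:R) e (fun=> ler0n _ _).
rewrite /moment -!esumZl // -esumD; last 2 first.
- by move=> e _; rewrite mule_ge0.
- by move=> e _; rewrite mule_ge0.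
apply: eq_esum => e _; rewrite -!EFinM -EFinD; congr EFin.
rewrite !mulr_sumr -big_split /=; apply: eq_bigr => i _.
by ring.
Qed.

Lemma moment_le (c : bool -> R) : (forall b, 0 <= c b) ->
  (moment c <= C%:E * \esum_(e in [set: excursion])
     (nu theta_k e * \sum_(i < elen e) c (flips e i))%:E)%E.
Proof.
move=> c0; rewrite /moment -esumZl //; last first.
  by move=> e _; rewrite lee_fin mulr_ge0 ?nu_ge0 // sumr_ge0.
apply: le_esum => e _; rewrite -EFinM lee_fin mulrCA ler_wpM2l ?nu_ge0 //.
rewrite mulr_sumr; apply: ler_sum => i _; rewrite ler_wpM2r //.
by have /andP[] := site_mean_bounds e i.
Qed.

Lemma moment1_lty : (moment (fun=> 1%R) < +oo)%E.
Proof.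
apply: le_lt_trans (moment_le _) _ => //.
under eq_esum do rewrite sumr_const card_ord mulrC.
by rewrite -/(ebar_ext theta_k) ebar_ext_fin // -EFinM ltry.
Qed.

(** Gives finiteness and, when the two mean lengths coincide, the vanishing of the flip term. *)
Lemma moment_flips_le :
  (moment (fun x => x%:R%R) <= (C * (L' - ebar (theta theta_k)))%:E)%E.
Proof.
apply: le_trans (moment_le _) _ => //.
under eq_esum do rewrite sum_flips.
by rewrite -/(flip_mean theta_k) flip_meanE.
Qed.

End SkipMap.

(** * From nonnegative to signed local functions *)

Lemma integral_pos_neg d (T : measurableType d) (R : realType)
    (m : set T -> \bar R) (M : {measure set T -> \bar R}) (D : set T) (F : T -> R) :
  (forall A, measurable A -> m A = M A) ->
  (\int[m]_(x in D) (F x)%:E = \int[m]_(x in D) (Num.max (F x) 0)%:E -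
                               \int[m]_(x in D) (Num.max (- F x) 0)%:E)%E.
Proof.
move=> mM; rewrite !(eq_set_function_integral _ _ mM) integralE.
by congr (_ - _)%E; apply: eq_integral => x _;
  rewrite ?funeposE ?funenegE -?EFinN -EFin_max.
Qed.

Lemma is_local_comp (R : realType) (f : conf -> R) (h : R -> R) :
  is_local f -> is_local (fun eta => h (f eta)).
Proof. by move=> [s fs]; exists s => eta eta' e; rewrite (fs _ _ e). Qed.

(** A local function has finitely many values, one per pattern on [s]; the sum of their absolute
    values is a bound. *)
Lemma is_local_bounded (R : realType) (f : conf -> R) : is_local f ->
  exists C, forall eta, f eta <= C.
Proof.
move=> [s fs]; pose pat (t : (size s).-tuple bool) : conf := fun x => nth false t (index x s).
exists (\sum_t `|f (pat t)|) => eta.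
pose t : (size s).-tuple bool := map_tuple (eta : int -> bool) (in_tuple s).
have -> : f eta = f (pat t).
  apply: fs => x xs; rewrite /pat /= (nth_map 0) ?index_mem //.
  by rewrite nth_index.
rewrite (bigD1 t) //=; apply: le_trans (ler_norm _) _.
by rewrite lerDl sumr_ge0.
Qed.

Lemma is_local_measurable (R : realType) (f : conf -> R) : is_local f ->
  measurable_fun setT f.
Proof. by move=> [s fs]; exact: measurable_is_local fs. Qed.

Section FlipObservable.
Variable R : realType.

Lemma seat_up_ge0 eta W k x : 0 <= seat_up eta W k x.
Proof.
rewrite /seat_up !mulr_ge0 //; try by case: (eta x); case: (W k (x - 1)).
by apply: prodr_ge0 => j _; case: (W j (x - 1)).
Qed.

Lemma seat_down_ge0 eta W k x : 0 <= seat_down eta W k x.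
Proof.
rewrite /seat_down !mulr_ge0 //; try by case: (eta x); case: (W k (x - 1)).
by apply: prodr_ge0 => j _; case: (W j (x - 1)).
Qed.

Definition flip_at1 (eta : conf) : R := (eta_up eta 1 1 + eta_down eta 1 1)%:~R.

Lemma flip_at1_ge0 eta : 0 <= flip_at1 eta.
Proof. by rewrite ler0z addr_ge0 ?seat_up_ge0 ?seat_down_ge0. Qed.

Lemma flip_at1_tau (w : zprod excursion) (y : nat) : (y < elen (w 0%R))%N ->
  flip_at1 (tau y%:Z (concat_exc w)) = (flips (w 0%R) y)%:R.
Proof.
move=> yw; rewrite /flip_at1 eta_flip_tau.
have := concat_flips yw; rewrite exc_start0 add0r.
have -> : 1 + y%:Z - 1 = y%:Z by lia.
by rewrite [y%:Z + 1]addrC => ->; rewrite /b2z; case: (flips _ _).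
Qed.

End FlipObservable.

Section SkipMapIntegral.
Variables (R : realType) (alpha : nat -> R) (k : nat).
Hypothesis sw : summable_weights alpha.
Hypothesis ebar_lty : (ebar_ext alpha < +oo)%E.
Local Notation theta_k := (iter k (@theta R) alpha).
Local Notation L := (ebar alpha).
Local Notation L' := (ebar theta_k).
Local Notation L'' := (ebar (theta theta_k)).

Let sw' : summable_weights theta_k. Proof. exact: summable_iter_theta. Qed.

Let ebar_lty' : (ebar_ext theta_k < +oo)%E. Proof. exact: ebar_ext_theta_lty. Qed.

Let L_neq0 : L != 0. Proof. by rewrite gt_eqF // (lt_le_trans ltr01) ?ebar_ge1. Qed.

Let L'_neq0 : L' != 0. Proof. by rewrite gt_eqF // (lt_le_trans ltr01) ?ebar_ge1. Qed.

Definition flip_coef : R := L' * (L - L' * ebar (Ctrunc k alpha)) / (L * (L' - L'')).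

Lemma integral_Psi_ge0 (f : conf -> R) : is_local f -> (forall eta, 0 <= f eta) ->
  exists I J : R,
  [/\ (\int[mu theta_k]_(eta in Omega_star R) (f eta)%:E = I%:E)%E,
      (\int[mu theta_k]_(eta in Omega_star R) (flip_at1 R eta * f eta)%:E = J%:E)%E &
      (\int[mu alpha]_(eta in Omega_star R) (f (Psi k eta))%:E =
       (L' * ebar (Ctrunc k alpha) / L * I + if L' == L'' then 0 else flip_coef * J)%:E)%E].
Proof.
move=> lf f0; have [C fC] := is_local_bounded lf; have mf := is_local_measurable lf.
have m1lty := moment1_lty k sw ebar_lty f0 fC mf.
have m1_0 : (0 <= moment alpha k f (fun=> 1%R))%E by exact: moment_ge0.
have mfle := moment_flips_le k sw ebar_lty f0 fC mf.
have mf_0 : (0 <= moment alpha k f (fun x => x%:R%R))%E by apply: moment_ge0 => // x.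
have m1E : moment alpha k f (fun=> 1%R) = (fine (moment alpha k f (fun=> 1%R)))%:E.
  by rewrite fineK // ge0_fin_numE.
have mfE : moment alpha k f (fun x => x%:R%R) =
    (fine (moment alpha k f (fun x => x%:R%R)))%:E.
  by rewrite fineK // ge0_fin_numE // (le_lt_trans mfle) // ltry.
set M1 := fine _ in m1E; set Mf := fine _ in mfE.
exists (L'^-1 * M1), (L'^-1 * Mf); split.
- rewrite EFinM -m1E; apply: integral_mu_flips => // w y yw.
  by rewrite mul1r.
- rewrite EFinM -mfE; apply: integral_mu_flips => //.
  + by move=> eta; rewrite mulr_ge0 // flip_at1_ge0.
  + by move=> w y yw; rewrite flip_at1_tau.
have [c1 c2] := mix_ge0 k sw ler01 (lexx (0 : R)).
rewrite (integral_Psi_moment k sw ebar_lty f0 fC mf) (moment_affine k sw f0 fC mf) // m1E mfE.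
rewrite -!EFinM; congr EFin.
have := ebar_mix k sw ebar_lty; rewrite /flip_coef ebar_Ctrunc //.
set a := (mix k alpha 1 0).1; set b := (mix k alpha 1 0).2 => /= LE.
case: eqVneq => [e|ne].
  have Mf0 : Mf = 0.
    apply/eqP; rewrite eq_le -!lee_fin -mfE mf_0 andbT.
    by apply: le_trans mfle _; rewrite e subrr mulr0.
  by rewrite Mf0; field; rewrite L_neq0 L'_neq0.
have d0 : L' - L'' != 0 by rewrite subr_eq0.
(* This is [ebar_mix] solved for the second coefficient of [mix]. *)
have -> : L - L' * a = b * (L' - L'') by rewrite LE; ring.
by field; rewrite L_neq0 L'_neq0 d0.
Qed.

End SkipMapIntegral.

Section LawsAreMeasures.
Variables (R : realType) (alpha : nat -> R).
Hypothesis sw : summable_weights alpha.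
Hypothesis ebar_lty : (ebar_ext alpha < +oo)%E.

Lemma mu_measure : exists M : {measure set conf -> \bar R},
  forall A, measurable A -> mu alpha A = M A.
Proof. by have [m _ mE] := mu_mixture sw ebar_lty; eexists; exact: mE. Qed.

Lemma cond_on_record_measure : exists M : {measure set conf -> \bar R},
  forall A, measurable A -> cond_on (mu alpha) [set eta | s_inf eta 0 = 0%:E] A = M A.
Proof.
have [M ME] := pushforward_measure (iid_law (nu alpha)) measurable_concat.
by exists M => A mA; rewrite ME; exact: cond_on_record.
Qed.

End LawsAreMeasures.

Theorem theorem5p10 (R : realType) (alpha : nat -> R) (k : nat)
    (f : conf -> R) (halpha : in_Aplus alpha) (hk : (0 < k)%N)
    (hf : is_local f) :
  let rec0 : set conf := [set eta | s_inf eta 0 = 0%:E] in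
  let theta_k := iter k (@theta R) alpha in
  let theta_k1 := iter k.+1 (@theta R) alpha in
  (\int[cond_on (mu alpha) rec0]_(eta in Omega_star R) (f (Psi k eta))%:E
   = \int[cond_on (mu theta_k) rec0]_(eta in Omega_star R) (f eta)%:E)%E
  /\
  (\int[mu alpha]_(eta in Omega_star R) (f (Psi k eta))%:E
   = (ebar theta_k * ebar (Ctrunc k alpha) / ebar alpha)%:E
       * \int[mu theta_k]_(eta in Omega_star R) (f eta)%:E
     + (if ebar theta_k == ebar theta_k1 then 0%:E
        else (ebar theta_k
                * (ebar alpha - ebar theta_k * ebar (Ctrunc k alpha))
                / (ebar alpha * (ebar theta_k - ebar theta_k1)))%:E
             * \int[mu theta_k]_(eta in Omega_star R)
                 (((eta_up eta 1 1 + eta_down eta 1 1)%:~R : R) * f eta)%:E))%E.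
Proof.
move=> rec0 theta_k theta_k1.
have [[a01 Zfin] ebar_lty] := halpha.
have sw : summable_weights alpha by split=> // j j0; have /andP[] := a01 j j0.
have sw' : summable_weights theta_k by exact: summable_iter_theta.
have ebar_lty' : (ebar_ext theta_k < +oo)%E by exact: ebar_ext_theta_lty.
(* Both parts of [f] are local and nonnegative, and their integrals against [mu] are finite, so the
   identities extend by subtraction. *)
pose fp (eta : conf) : R := Num.max (f eta) 0.
pose fn (eta : conf) : R := Num.max (- f eta) 0.
have fp0 eta : 0 <= fp eta by rewrite le_max lexx orbT.
have fn0 eta : 0 <= fn eta by rewrite le_max lexx orbT.
have lfp : is_local fp by exact: (is_local_comp (fun x => Num.max x 0)).
have lfn : is_local fn by exact: (is_local_comp (fun x => Num.max (- x) 0)).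
split.
  have [M ME] := cond_on_record_measure sw ebar_lty.
  have [M' ME'] := cond_on_record_measure sw' ebar_lty'.
  have Ep := integral_Psi_cond k sw ebar_lty fp0 (is_local_measurable lfp).
  have En := integral_Psi_cond k sw ebar_lty fn0 (is_local_measurable lfn).
  apply: etrans (integral_pos_neg (Omega_star R) (fun eta => f (Psi k eta)) ME) _.
  apply: etrans _ (esym (integral_pos_neg (Omega_star R) f ME')).
  exact: (congr2 (fun x y => x - y)%E Ep En).
have [M ME] := mu_measure sw ebar_lty.
have [M' ME'] := mu_measure sw' ebar_lty'.
have [Ip [Jp [IpE JpE Ep]]] := integral_Psi_ge0 k sw ebar_lty lfp fp0.
have [In [Jn [InE JnE En]]] := integral_Psi_ge0 k sw ebar_lty lfn fn0.
have LHS : (\int[mu alpha]_(eta in Omega_star R) (f (Psi k eta))%:E =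
    \int[mu alpha]_(eta in Omega_star R) (fp (Psi k eta))%:E -
    \int[mu alpha]_(eta in Omega_star R) (fn (Psi k eta))%:E)%E.
  exact: integral_pos_neg ME.
have IE : (\int[mu theta_k]_(eta in Omega_star R) (f eta)%:E = (Ip - In)%:E)%E.
  by rewrite EFinB -IpE -InE; exact: integral_pos_neg ME'.
have JE : (\int[mu theta_k]_(eta in Omega_star R)
    (((eta_up eta 1 1 + eta_down eta 1 1)%:~R : R) * f eta)%:E = (Jp - Jn)%:E)%E.
  (* The flip indicator is nonnegative, so it commutes with taking positive and negative parts. *)
  have maxp : (fun eta => (Num.max (flip_at1 R eta * f eta) 0)%:E) =
      (fun eta => (flip_at1 R eta * fp eta)%:E).
    by apply/funext => eta; rewrite maxr_pMr ?mulr0 // flip_at1_ge0.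
  have maxn : (fun eta => (Num.max (- (flip_at1 R eta * f eta)) 0)%:E) =
      (fun eta => (flip_at1 R eta * fn eta)%:E).
    by apply/funext => eta; rewrite -mulrN maxr_pMr ?mulr0 // flip_at1_ge0.
  rewrite EFinB -JpE -JnE.
  apply: etrans (integral_pos_neg _ (fun eta => flip_at1 R eta * f eta) ME') _.
  exact: (congr2 (fun F G => integral (mu theta_k) (Omega_star R) F -
    integral (mu theta_k) (Omega_star R) G)%E maxp maxn).
apply: etrans LHS _; apply: etrans (congr2 (fun x y => x - y)%E Ep En) _.
apply: etrans _ (esym (congr2 (fun x y => _%:E * x +
  (if _ == _ then 0 else _%:E * y))%E IE JE)).
rewrite /flip_coef -[theta_k1]/(theta (iter k (@theta R) alpha)) /theta_k.
case: ifP => _; rewrite -?EFinM -?EFinD -?EFinB; congr EFin; first by ring.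
by move: (_ / (_ * (_ - _))) => c; ring.
Qed.
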